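(* Let $\mathbf a_1,\mathbf a_2\in\mathbf A^+$ be fixed minimal points (so $\mathbf a_1\not\ge\mathbf a_2$ and $\mathbf a_2\not\ge\mathbf a_1$). Let $\mathbf h_1,\mathbf h_2\in\mathbf A$ be such that $\langle\mathbf h_1,\mathbf h_2\rangle\cong\mathbb Z^2$, and suppose that $\langle\mathbf h_1,\mathbf h_2\rangle$ contains at least one vector whose components are all strictly positive. Let $L\subseteq\langle\mathbf h_1,\mathbf h_2\rangle$ be the set of elements that can be realized as limit directions, i.e. such that there is a non-degenerate non-twin root $(R)$ with minimal points $\mathbf a_1,\mathbf a_2$ and vectors Nielsen equivalent to $\mathbf h_1,\mathbf h_2$, whose limit directions $\mathbf l^-,\mathbf l^+$ are defined, with the given element equal to $\mathbf l^+$ or to $\mathbf l^-$. Then: 1. $L$ is a finite union of arithmetic progressions in $\langle\mathbf h_1,\mathbf h_2\rangle$. 2. This finite set of arithmetic progressions can be algorithmically computed from $\mathbf a_1,\mathbf a_2,\mathbf h_1,\mathbf h_2$. 3. If $P\subseteq\langle\mathbf h_1,\mathbf h_2\rangle\otimes\mathbb R$ is the open cone consisting of the linear combinations with positive coefficients of elements of $\langle\mathbf h_1,\mathbf h_2\rangle$ with all components strictly positive, then the set of limit directions has no accumulation point in the interior of $P$; that is, for every closed cone $K\subseteq P\cup\{0\}$, only finitely many limit directions lie in $K$.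
   Context: Fix a finite set $\mathcal P$ of primes (the primes dividing the labels of a one-vertex two-edge generalized Baumslag–Solitar graph) and let $\mathbf A=\mathbb Z/2\mathbb Z\oplus\bigoplus_{r\in\mathcal P}\mathbb Z$. For $\mathbf a=(a_0,a_r:r\in\mathcal P)\in\mathbf A$ write $\mathbf a\ge\mathbf 0$ if $a_r\ge0$ for all $r\in\mathcal P$ (no condition on the $\mathbb Z/2\mathbb Z$-component $a_0$); $\mathbf a\ge\mathbf b$ means $\mathbf a-\mathbf b\ge\mathbf 0$; $\mathbf A^+=\{\mathbf a:\mathbf a\ge\mathbf 0\}$. ''All components strictly positive'' refers to the components $a_r$, $r\in\mathcal P$, only. $\mathbb N$ contains $0$. An (unoriented) edge joining $\mathbf p,\mathbf q\in\mathbf A^+$ is written $\mathbf p - \mathbf q$. An arithmetic progression is a set $\{\mathbf t+n\mathbf r: n\in I\}$ with $I$ an interval of integers (possibly finite, or truncated on one or both sides). Configurations. A configuration with minimal points $\mathbf a_1,\mathbf a_2\in\mathbf A^+$ and vectors $\mathbf x_1,\mathbf x_2\in\mathbf A$ is the pair of edges $\mathbf a_1-(\mathbf a_1+\mathbf x_1)$ (first edge) and $\mathbf a_2-(\mathbf a_2+\mathbf x_2)$ (second edge), where: $\mathbf a_1\not\ge\mathbf a_2$ and $\mathbf a_2\not\ge\mathbf a_1$; $\mathbf a_1+\mathbf x_1$ is $\ge$ at least one of $\mathbf a_1,\mathbf a_2$; $\mathbf a_2+\mathbf x_2$ is $\ge$ at least one of $\mathbf a_1,\mathbf a_2$. It is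 degenerate if (1) at least one of $\mathbf x_1,\mathbf x_2$ lies in $\mathbb Z/2\mathbb Z\le\mathbf A$, or (2) the edges are $\mathbf a_1-(\mathbf a_2+\mathbf e)$ and $\mathbf a_2-(\mathbf a_1+\mathbf e')$ with $\mathbf e,\mathbf e'\in\mathbb Z/2\mathbb Z$, or (3) $\mathbf a_1+\mathbf x_1\not\ge\mathbf a_2$ and $\mathbf a_2+\mathbf x_2\not\ge\mathbf a_1$. It is full-tree if $\mathbf a_1+\mathbf x_1$ and $\mathbf a_2+\mathbf x_2$ are both $\ge\mathbf a_1$ and $\ge\mathbf a_2$. Sons and roots. If $\mathbf a_1+\mathbf x_1\ge\mathbf a_2$, the first son $(C1)$ of $(C)$ is the configuration with the same minimal points and vectors $\mathbf x_1+\mathbf x_2,\mathbf x_2$; if $\mathbf a_2+\mathbf x_2\ge\mathbf a_1$, the second son $(C2)$ has vectors $\mathbf x_1,\mathbf x_2+\mathbf x_1$. For a finite word $s\in\{1,2\}^*$, $(Cs)$ is the iterated son obtained by reading $s$ from left to right (if all steps are possible). A root is a configuration with $\mathbf a_1+\mathbf x_1\not\ge\mathbf a_2+\mathbf x_2$ and $\mathbf a_2+\mathbf x_2\not\ge\mathbf a_1+\mathbf x_1$. Two non-degenerate roots $(R),(Q)$ are twin roots if $(R)$ has edges $\mathbf a_1-(\mathbf a_2+\mathbf e)$, $\mathbf a_2-(\mathbf a_2+\mathbf x_2)$ and $(Q)$ has edges $\mathbf a_1-(\mathbf a_1+\mathbf x_1)$, $\mathbf a_2-(\mathbf a_1+\mathbf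 e)$ with $\mathbf e\in\mathbb Z/2\mathbb Z$, $\mathbf x_1,\mathbf x_2\not\ge\mathbf 0$ and $\mathbf x_1+\lambda\mathbf a_1=\mathbf x_2+\lambda\mathbf a_2+\lambda\mathbf e$ for some integer $\lambda\ge2$. A root is non-twin if it is not a member of a pair of twin roots. Connections. A configuration with vectors $\mathbf x_1,\mathbf x_2$ allows for a connection with the first edge controlling the endpoint of the second if $\mathbf x_1\ge\mathbf 0$ and $\mathbf a_1\le\mathbf a_2+\mathbf x_2\le\mathbf a_1+k\mathbf x_1$ for some $k\in\mathbb N$; the result (with parameter $k$) is the configuration with the same minimal points and vectors $k\mathbf x_1-\mathbf x_2,\ \mathbf x_1$. It allows for a connection with the second edge controlling the endpoint of the first if $\mathbf x_2\ge\mathbf 0$ and $\mathbf a_2\le\mathbf a_1+\mathbf x_1\le\mathbf a_2+k\mathbf x_2$ for some $k\in\mathbb N$; the result has vectors $\mathbf x_2,\ k\mathbf x_2-\mathbf x_1$. Sequence of roots. For a non-degenerate root $(R)$, $(R^-)$ (resp. $(R^+)$) denotes the non-degenerate root obtained from $(R)$, if possible, by the connection with the first edge controlling the endpoint of the second (resp. the second controlling the first), using the minimum possible $k$. One has $(R^{-+})=(R)$ if $(R^-)$ exists, and $(R^{+-})=(R)$ if $(R^+)$ exists. Iterating gives a sequence of roots $\dots,(R^{-}),(R),(R^{+}),\dots$ (finite or infinite on each side; $(R^{+i})$, $i\in\mathbb Z$, denotes its $i$-th term) and a sequence $\dots,\mathbf v_{-1},\mathbf v_0,\mathbf v_1,\mathbf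 v_2,\dots$ in $\mathbf A$ such that $(R^{+i})$ has vectors $\mathbf v_i,\mathbf v_{i+1}$. Limit directions. Let $(R)$ be a non-degenerate non-twin root. If the sequence is infinite on the right, $\mathbf l^+=\mathbf v_{i+1}-\mathbf v_i$ for $i$ big enough (this is eventually constant). If it terminates on the right and some root in the sequence has a full-tree iterated son, take the maximum $i$ such that $(R^{+i})$ has a full-tree iterated son; among the finitely many words $s$ such that $(R^{+i}s)$ is full-tree and no proper initial segment $s'$ of $s$ has $(R^{+i}s')$ full-tree, take the unique one beginning with the most digits $2$, and let $\mathbf l^+$ be the second vector of $(R^{+i}s)$. If no root in the sequence has a full-tree iterated son, $\mathbf l^+$ is not defined. Symmetrically: if the sequence is infinite on the left, $\mathbf l^-=\mathbf v_{i-1}-\mathbf v_i$ for $i$ negative enough; if it terminates on the left and some root has a full-tree iterated son, take the minimum $i$ such that $(R^{+i})$ has a full-tree iterated son; among the finitely many words $s$ such that $(R^{+i}s)$ is full-tree and no proper initial segment $s'$ of $s$ has $(R^{+i}s')$ full-tree, take the unique one beginning with the most digits $1$, and let $\mathbf l^-$ be the first vector of $(R^{+i}s)$; otherwise $\mathbf l^-$ is not defined. Nielsen equivalence of ordered pairs of elements of $\mathbf A$ is the equivalence relation generated by $(\mathbf x_1,\mathbf x_2)\sim(\mathbf x_1\pm\mathbf x_2,\mathbf x_2)$ and $(\mathbf x_1,\mathbf x_2)\sim(\mathbf x_1,\mathbf x_2\pm\mathbf x_1)$.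
   Formalization: The minimal full-tree word ''beginning with the most digits 2'' (resp. 1) defining l^+ (resp. l^-) need not be unique (e.g. a1=(0,2), a2=(2,0), x1=(4,-1), x2=(-1,2): words 12 and 112); ties are broken lexicographically, with 2 before 1 for l^+ and 1 before 2 for l^-. *)

(* Defs.v *)
From HB Require Import structures.
From Stdlib Require Import Relation_Operators.
From Stdlib Require List.
From mathcomp Require Import all_boot all_order all_algebra.
From mathcomp Require Import finmap.
From mathcomp Require Import all_classical all_reals all_analysis.

Set Implicit Arguments.
Unset Strict Implicit.
Unset Printing Implicit Defensive.

Import Order.TTheory GRing.Theory Num.Theory.
Import numFieldNormedType.Exports.

Local Open Scope ring_scope.

(* Z/2Z (+) \bigoplus_(r in P) Z *)
Definition A (P : {fset nat}) := ('Z_2 * {ffun P -> int})%type.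

(* No condition is put on the Z/2Z-component. *)
Definition nneg P (a : A P) : bool := [forall r, 0 <= a.2 r].
Definition spos P (a : A P) : bool := [forall r, 0 < a.2 r].
(* [geA] is only a preorder: [geA a b && geA b a] allows a - b in Z/2Z. *)
Definition geA P (a b : A P) : bool := nneg (a - b).

Definition tors P (e : 'Z_2) : A P := (e, 0).
Arguments tors P e : clear implicits.
Definition in_tors P (a : A P) : Prop := exists e, a = tors P e.

Record config (P : {fset nat}) := Config {
  pt1 : A P; pt2 : A P; vec1 : A P; vec2 : A P }.

Definition end1 P (C : config P) : A P := pt1 C + vec1 C.
Definition end2 P (C : config P) : A P := pt2 C + vec2 C.

Definition is_config P (C : config P) : Prop :=
  [/\ nneg (pt1 C) /\ nneg (pt2 C),
      ~~ geA (pt1 C) (pt2 C) /\ ~~ geA (pt2 C) (pt1 C),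
      geA (end1 C) (pt1 C) || geA (end1 C) (pt2 C)
    & geA (end2 C) (pt1 C) || geA (end2 C) (pt2 C)].

Definition degenerate P (C : config P) : Prop :=
  [\/ in_tors (vec1 C) \/ in_tors (vec2 C),
      exists e e', end1 C = pt2 C + tors P e /\ end2 C = pt1 C + tors P e'
    | ~~ geA (end1 C) (pt2 C) /\ ~~ geA (end2 C) (pt1 C)].

Definition full_tree P (C : config P) : bool :=
  [&& geA (end1 C) (pt1 C), geA (end1 C) (pt2 C),
      geA (end2 C) (pt1 C) & geA (end2 C) (pt2 C)].

(* The digit 1 is [false] and the digit 2 is [true]. *)
Definition digit1 : bool := false.
Definition digit2 : bool := true.

Definition son P (d : bool) (C : config P) : option (config P) :=
  if d == digit1 then
    if geA (end1 C) (pt2 C)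
    then Some (Config (pt1 C) (pt2 C) (vec1 C + vec2 C) (vec2 C)) else None
  else
    if geA (end2 C) (pt1 C)
    then Some (Config (pt1 C) (pt2 C) (vec1 C) (vec2 C + vec1 C)) else None.

Fixpoint iter_son P (C : config P) (s : seq bool) : option (config P) :=
  if s is d :: s' then obind (fun C' => iter_son C' s') (son d C) else Some C.

Definition is_root P (C : config P) : Prop :=
  [/\ is_config C, ~~ geA (end1 C) (end2 C) & ~~ geA (end2 C) (end1 C)].

Definition ndroot P (C : config P) : Prop := is_root C /\ ~ degenerate C.

Definition twin P (R Q : config P) : Prop :=
  [/\ ndroot R /\ ndroot Q,
      pt1 Q = pt1 R /\ pt2 Q = pt2 R
    & exists (e : 'Z_2) (lam : int),
      [/\ end1 R = pt2 R + tors P e /\ end2 Q = pt1 Q + tors P e,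
          ~~ nneg (vec1 Q) /\ ~~ nneg (vec2 R),
          2 <= lam
        & vec1 Q + pt1 R *~ lam = vec2 R + pt2 R *~ lam + tors P e *~ lam]].

Definition non_twin P (R : config P) : Prop :=
  ~ exists Q, twin R Q \/ twin Q R.

(* [connection1 C k C']: C' is the result with parameter k of the connection of C
   with the first edge controlling the endpoint of the second; [connection2] is
   the one with the second edge controlling the endpoint of the first. *)
Definition connection1 P (C : config P) (k : nat) (C' : config P) : Prop :=
  [/\ nneg (vec1 C), geA (end2 C) (pt1 C),
      geA (pt1 C + vec1 C *+ k) (end2 C)
    & C' = Config (pt1 C) (pt2 C) (vec1 C *+ k - vec2 C) (vec1 C)].

Definition connection2 P (C : config P) (k : nat) (C' : config P) : Prop :=
  [/\ nneg (vec2 C), geA (end1 C) (pt2 C),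
      geA (pt2 C + vec2 C *+ k) (end1 C)
    & C' = Config (pt1 C) (pt2 C) (vec2 C) (vec2 C *+ k - vec1 C)].

Definition min_connection P
    (connection : config P -> nat -> config P -> Prop) (R R' : config P) : Prop :=
  exists k, connection R k R' /\
    (forall k' C', connection R k' C' -> (k <= k')%N).

(* R' is R^- (resp. R^+) *)
Definition prev_root P (R R' : config P) : Prop :=
  [/\ ndroot R, min_connection (@connection1 P) R R' & ndroot R'].
Definition next_root P (R R' : config P) : Prop :=
  [/\ ndroot R, min_connection (@connection2 P) R R' & ndroot R'].

Fixpoint rel_iter T (E : T -> T -> Prop) (n : nat) (x y : T) : Prop :=
  if n is n'.+1 then exists2 z, rel_iter E n' x z & E z y else x = y.

(* R^{+i} exists and is equal to Q *)
Definition root_at P (R : config P) (i : int) (Q : config P) : Prop :=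
  match i with
  | Posz n => rel_iter (@next_root P) n R Q
  | Negz n => rel_iter (@prev_root P) n.+1 R Q
  end.

Definition infinite_right P (R : config P) : Prop :=
  forall n : nat, exists Q, root_at R n%:Z Q.
Definition infinite_left P (R : config P) : Prop :=
  forall n : nat, exists Q, root_at R (- n%:Z) Q.

Definition ft_word P (C : config P) (s : seq bool) : Prop :=
  exists2 C', iter_son C s = Some C' & full_tree C'.

Definition has_ft_son P (C : config P) : Prop := exists s, ft_word C s.

Definition min_ft_word P (C : config P) (s : seq bool) : Prop :=
  ft_word C s /\ (forall s', prefix s' s -> s' != s -> ~ ft_word C s').

(* number of digits d at the beginning of s *)
Definition leading (d : bool) (s : seq bool) : nat := find (predC1 d) s.

(* at the first place where s and s' differ, s has the digit d *)
Definition lex_before (d : bool) (s s' : seq bool) : Prop :=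
  exists p t t', s = p ++ d :: t /\ s' = p ++ ~~ d :: t'.

(* The minimal full-tree word beginning with the most digits d. Several minimal
   words can attain the maximal number of leading digits d (e.g. the minimal
   full-tree words can be exactly 12 and 112, both with no leading 2); the
   lexicographic clause only breaks such ties. *)
Definition extremal_ft_word P (d : bool) (C : config P) (s : seq bool) : Prop :=
  min_ft_word C s /\
  (forall s', min_ft_word C s' -> s' != s ->
     (leading d s' < leading d s)%N \/
     (leading d s' = leading d s /\ lex_before d s s')).

(* R^{+i} has vectors v_i, v_{i+1}; hence [vec2 Q - vec1 Q] is v_{i+1} - v_i
   in [limit_plus], and [vec1 Q - vec2 Q] is v_{j-1} - v_j with j = i + 1 in
   [limit_minus]. *)
Definition limit_plus P (R : config P) (l : A P) : Prop :=
  (infinite_right R /\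
   exists N : int, forall i Q, N <= i -> root_at R i Q ->
     l = vec2 Q - vec1 Q) \/
  (~ infinite_right R /\
   exists i Q s C,
     [/\ root_at R i Q /\ has_ft_son Q,
         forall j Q', root_at R j Q' -> has_ft_son Q' -> j <= i,
         extremal_ft_word digit2 Q s,
         iter_son Q s = Some C
       & l = vec2 C]).

Definition limit_minus P (R : config P) (l : A P) : Prop :=
  (infinite_left R /\
   exists N : int, forall i Q, i <= N -> root_at R i Q ->
     l = vec1 Q - vec2 Q) \/
  (~ infinite_left R /\
   exists i Q s C,
     [/\ root_at R i Q /\ has_ft_son Q,
         forall j Q', root_at R j Q' -> has_ft_son Q' -> i <= j,
         extremal_ft_word digit1 Q s,
         iter_son Q s = Some C
       & l = vec1 C]).

Variant nielsen_step P : A P * A P -> A P * A P -> Prop :=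
| nielsen_addl x y : nielsen_step (x, y) (x + y, y)
| nielsen_subl x y : nielsen_step (x, y) (x - y, y)
| nielsen_addr x y : nielsen_step (x, y) (x, y + x)
| nielsen_subr x y : nielsen_step (x, y) (x, y - x).

Definition nielsen P : A P * A P -> A P * A P -> Prop :=
  clos_refl_sym_trans _ (@nielsen_step P).

Definition comb P (h1 h2 : A P) (z : int * int) : A P := h1 *~ z.1 + h2 *~ z.2.

Definition in_span P (h1 h2 x : A P) : Prop := exists z, x = comb h1 h2 z.

Definition span_isoZ2 P (h1 h2 : A P) : Prop :=
  exists phi : {additive (int * int)%type -> A P},
    injective phi /\ (forall x, in_span h1 h2 x <-> exists z, phi z = x).

Definition admissible P (a1 a2 h1 h2 : A P) : Prop :=
  [/\ nneg a1 /\ nneg a2,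
      ~~ geA a1 a2 /\ ~~ geA a2 a1,
      span_isoZ2 h1 h2
    & exists x, in_span h1 h2 x /\ spos x].

Definition limit_direction P (a1 a2 h1 h2 l : A P) : Prop :=
  in_span h1 h2 l /\
  exists x1 x2 : A P, let R := Config a1 a2 x1 x2 in
    [/\ ndroot R, non_twin R, nielsen (h1, h2) (x1, x2)
      & exists lm lp,
        [/\ limit_minus R lm, limit_plus R lp & l = lp \/ l = lm]].

(* A bound [None] is absent. *)
Record progression (P : {fset nat}) := Progression {
  prog_base : A P; prog_step : A P;
  prog_lower : option int; prog_upper : option int }.

Definition in_prog P (p : progression P) (x : A P) : Prop :=
  exists n : int,
    [/\ (if prog_lower p is Some m then m <= n else true),
        (if prog_upper p is Some m then n <= m else true)
      & x = prog_base p + prog_step p *~ n].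

Definition prog_in_span P (h1 h2 : A P) (p : progression P) : Prop :=
  in_span h1 h2 (prog_base p) /\ in_span h1 h2 (prog_step p).

(* [ps] is a list of progressions in <h1, h2> whose union is the set of
   all limit directions. *)
Definition describes P (ps : seq (progression P)) (a1 a2 h1 h2 : A P) : Prop :=
  (forall p, List.In p ps -> prog_in_span h1 h2 p) /\
  (forall l, limit_direction a1 a2 h1 h2 l <->
             exists2 p, List.In p ps & in_prog p l).

(* <h1, h2> (x) R is R^2, through the basis (h1, h2): [real_pt z] is the point
   of <h1, h2> (x) R given by comb h1 h2 z. *)
Definition real_pt (R : realType) (z : int * int) : 'rV[R]_2 :=
  \row_(j < 2) (if j == 0 then z.1 else z.2)%:~R.

Definition pos_cone (R : realType) P (h1 h2 : A P) : set 'rV[R]_2 :=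
  [set v | exists (n : nat) (c : 'I_n.+1 -> R) (z : 'I_n.+1 -> int * int),
     [/\ forall j, 0 < c j, forall j, spos (comb h1 h2 (z j))
       & v = \sum_j c j *: real_pt R (z j)]].

Arguments pos_cone R {P} h1 h2.

Definition is_cone (R : realType) (K : set 'rV[R]_2) : Prop :=
  forall (c : R) v, 0 < c -> K v -> K (c *: v).

(* Partial recursive functions. The arguments are a list of natural numbers, a
   missing argument being read as 0. [RRec f g] is primitive recursion on the
   first argument, [RMu f] is unbounded minimization on the first argument. *)
Inductive recfun : Type :=
| RZero
| RSucc
| RProj of nat
| RComp of recfun & seq recfun
| RRec of recfun & recfun
| RMu of recfun.

Inductive reval : recfun -> seq nat -> nat -> Prop :=
| reval_zero xs : reval RZero xs 0%N
| reval_succ xs : reval RSucc xs (nth 0%N xs 0).+1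
| reval_proj i xs : reval (RProj i) xs (nth 0%N xs i)
| reval_comp f gs xs ys z :
    revals gs xs ys -> reval f ys z -> reval (RComp f gs) xs z
| reval_rec0 f g xs z : reval f xs z -> reval (RRec f g) (0%N :: xs) z
| reval_recS f g n xs y z :
    reval (RRec f g) (n :: xs) y -> reval g [:: n, y & xs] z ->
    reval (RRec f g) (n.+1 :: xs) z
| reval_mu f xs n (ys : nat -> nat) :
    (forall m, (m < n)%N -> reval f (m :: xs) (ys m).+1) ->
    reval f (n :: xs) 0%N -> reval (RMu f) xs n
with revals : seq recfun -> seq nat -> seq nat -> Prop :=
| revals_nil xs : revals [::] xs [::]
| revals_cons g gs xs y ys :
    reval g xs y -> revals gs xs ys -> revals (g :: gs) xs (y :: ys).

Definition code_int (n : int) : nat :=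
  match n with Posz m => m.*2 | Negz m => m.*2.+1 end.

Definition code_bound (b : option int) : nat :=
  if b is Some n then (code_int n).+1 else 0%N.

Definition code_vec P (a : A P) : seq nat :=
  (a.1 : nat) :: [seq code_int (a.2 r) | r : P].

Definition code_input P (a1 a2 h1 h2 : A P) : seq nat :=
  code_vec a1 ++ code_vec a2 ++ code_vec h1 ++ code_vec h2.

(* [CodeSeq.code] is the bijection of boot/choice.v from seq nat to nat. *)
Definition code_prog P (p : progression P) : nat :=
  CodeSeq.code (code_vec (prog_base p) ++ code_vec (prog_step p) ++
                [:: code_bound (prog_lower p); code_bound (prog_upper p)]).

Definition code_progs P (ps : seq (progression P)) : nat :=
  CodeSeq.code [seq code_prog p | p <- ps].

(* Main.v *)
Require Import Defs.
From HB Require Import structures.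
From Stdlib Require Import Relation_Operators.
From mathcomp Require Import all_boot all_order all_algebra.
From mathcomp Require Import finmap.
From mathcomp Require Import all_classical all_reals all_analysis.
From mathcomp Require Import zify ring lra.

(** Let d = a2 - a1 and H = <h1, h2>. Only roots whose vectors form an oriented
    basis of H matter ([oriented]). For them degeneracy comes from the order
    alone, so that being a nondegenerate root is a system of inequalities between
    the coordinates of the vectors ([ndrootE]). The coordinates are nonzero linear
    forms on H, because H contains a strictly positive vector.

    The limit directions have a description that mentions neither sequences nor
    words ([right_limit]). On an infinite sequence the increments v_(i+1) - v_i
    grow, while the root condition keeps one of their coordinates below that of
    - d, so they are eventually constant ([infinite_right_stable]): the sequence
    ends as y, y + l, y + 2 l and so on, with l >= 0 and l >= - d false. A root
    with two neighbours is full-tree ([inner_full]), so on a finite sequence only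
    the last or the last but one root counts; its extremal word and the vector
    that this word selects are explicit ([word_coef_selects],
    [has_ft_word_coef]). A root has a twin if and only if one of its edges ends
    at the other minimal point ([non_twinE]). All this concerns l^+; exchanging
    the two edges turns l^- into l^+ ([limit_swap], [limit_directionE]).

    Finiteness comes from one identity: for a basis (x, y) of H and coordinates
    r, s, the number x_r y_s - x_s y_r depends on r, s only ([cross]). The
    inequalities of each case provide r and s for which the identity bounds all
    four factors, and then x and y are in an explicit box. The only exceptions are
    the strictly positive l for which l >= d or l >= - d fails. Such an l has a
    coordinate l_r = c in a finite range. If v >= 0 has v_r = 0, the shear
    x |-> x + x_r v preserves bases and inequalities and moves l to l + c v, so
    that limit directions come in progressions of step c v
    ([sound_right_limit]), and going back along the progression leads into the
    box ([slide_interior]). Hence a finite box of certificates describes all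
    limit directions ([right_limit_covered]).

    The box and the test of a certificate are computable, which gives the
    algorithm ([limit_progs_computable]). Finally a nonzero step s = c v has a
    zero coordinate, so it is not in the positive cone; since the directions of
    the points b + n s tend to s, only finitely many of these points are in a
    closed cone K ([cone_finite]). *)

Set Implicit Arguments.
Unset Strict Implicit.
Unset Printing Implicit Defensive.

Import Order.TTheory GRing.Theory Num.Theory.
Import numFieldNormedType.Exports.

Local Open Scope classical_set_scope.
Local Open Scope ring_scope.

(** * Coordinates in A *)
Section Components.
Variable P : {fset nat}.
Implicit Types x y : A P.

Lemma coordD x y r : (x + y).2 r = x.2 r + y.2 r.
Proof. by rewrite ffunE. Qed.

Lemma coordN x r : (- x).2 r = - x.2 r.
Proof. by rewrite ffunE. Qed.

Lemma coord0 r : (0 : A P).2 r = 0.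
Proof. by rewrite ffunE. Qed.

Lemma coordMn x k r : (x *+ k).2 r = x.2 r * k%:Z.
Proof. by elim: k => [|k IH]; rewrite ?mulr0n ?coord0 ?mulr0 // mulrS coordD IH; lia. Qed.

Lemma coordMz x (n : int) r : (x *~ n).2 r = x.2 r * n.
Proof. by case: n => k; rewrite /intmul ?coordN coordMn //; lia. Qed.

Lemma coord_tors e r : (tors P e).2 r = 0.
Proof. by rewrite ffunE. Qed.

Definition torsion x : 'Z_2 := x.1.

Lemma A_ext x y : torsion x = torsion y -> (forall r, x.2 r = y.2 r) -> x = y.
Proof. by case: x y => [x1 x2] [y1 y2]; rewrite /torsion /= => -> /ffunP ->. Qed.

Lemma torsionD x y : torsion (x + y) = torsion x + torsion y. Proof. by []. Qed.
Lemma torsionN x : torsion (- x) = - torsion x. Proof. by []. Qed.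
Lemma torsion0 : torsion (0 : A P) = 0. Proof. by []. Qed.
Lemma torsion_tors e : torsion (tors P e) = e. Proof. by []. Qed.

Lemma Z2_opp (e : 'Z_2) : - e = e.
Proof. by apply/eqP; case: e => -[|[|//]] i; rewrite -val_eqE. Qed.

Lemma Z2_addrr (e : 'Z_2) : e + e = 0.
Proof. by rewrite -{1}[e]Z2_opp addNr. Qed.

Lemma torsionMn x k : torsion (x *+ k) = torsion x * k%:R.
Proof. by elim: k => [|k IH]; rewrite ?mulr0n ?mulr0 // mulrS torsionD IH -natr1; ring. Qed.

Lemma torsionMz x (n : int) : torsion (x *~ n) = torsion x * n%:~R.
Proof.
case: n => k; rewrite /intmul; first by rewrite torsionMn.
by rewrite torsionN torsionMn mulrN.
Qed.

Lemma eq_add_tors x y e :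
  torsion y = torsion x + e -> (forall r, y.2 r = x.2 r) -> y = x + tors P e.
Proof. by move=> e1 e2; apply: A_ext => // r; rewrite e2 coordD coord_tors addr0. Qed.
End Components.

Hint Rewrite coordD coordN coordMn coordMz coord0 coord_tors : coord.
Ltac coords := autorewrite with coord.

Hint Rewrite torsionD torsionN torsionMn torsionMz torsion0 torsion_tors : torsion.
Ltac torsions := autorewrite with torsion.

Section Order.
Variable P : {fset nat}.
Implicit Types x y a : A P.

Lemma geP x y : reflect (forall r, y.2 r <= x.2 r) (geA x y).
Proof.
apply: (iffP forallP) => H r; move: (H r); coords; lia.
Qed.

Lemma nnegP x : reflect (forall r, 0 <= x.2 r) (nneg x).
Proof. exact: forallP. Qed.

Lemma ngeP x y : ~~ geA x y -> exists r, x.2 r < y.2 r.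
Proof. by move=> /forallPn[r]; coords; move=> H; exists r; lia. Qed.

Lemma geA_add a x : geA (a + x) a = nneg x.
Proof. by rewrite /geA addrAC subrr add0r. Qed.

Lemma nnnegP x : ~~ nneg x -> exists r, x.2 r < 0.
Proof. by move=> /forallPn[r] H; exists r; lia. Qed.
End Order.

Ltac A_ring :=
  apply: A_ext; [torsions; ring | let r := fresh "r" in move=> r; coords; ring].

(* The order hypotheses are consumed: their instances at the coordinate r move to
   the goal, where lia finds them. *)
Ltac at_coord r :=
  repeat match goal with
  | H : is_true (geA _ _) |- _ => move: (geP _ _ H r); clear H
  | H : is_true (nneg _) |- _ => move: (nnegP _ H r); clear H
  end; coords.

Ltac ord_lia :=
  let r := fresh "r" in
  first [apply/geP => r | apply/nnegP => r]; at_coord r; lia.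

(* Two comparisons between different vectors must not be unfolded when they are
   compared up to conversion. *)
#[local] Opaque geA nneg.

(** * Configurations *)
Section Config.
Variable P : {fset nat}.
Implicit Types (x y a : A P) (C R Q Z : config P).

(** With d = a2 - a1, [geA (a1 + x) a2] says x >= d and [geA (a2 + x) a1] says
    x >= - d. For generic vectors, the first three clauses make a nondegenerate
    configuration and the last two a root. *)
Definition root_ineqs a1 a2 x1 x2 : bool :=
  [&& nneg x1 || geA (a1 + x1) a2, nneg x2 || geA (a2 + x2) a1,
      geA (a1 + x1) a2 || geA (a2 + x2) a1,
      ~~ geA (a1 + x1) (a2 + x2) & ~~ geA (a2 + x2) (a1 + x1)].

(** The two properties of a basis of the lattice that the theory of sequences
    uses. The first excludes the degenerate cases other than the third. *)
Definition generic x1 x2 : Prop :=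
  (forall m n : int, in_tors (x1 *~ m + x2 *~ n) -> m = 0 /\ n = 0) /\
  (forall r, x1.2 r <> 0 \/ x2.2 r <> 0).

Lemma ndrootE a1 a2 x1 x2 :
  nneg a1 -> nneg a2 -> ~~ geA a1 a2 -> ~~ geA a2 a1 -> generic x1 x2 ->
  ndroot (Config a1 a2 x1 x2) <-> root_ineqs a1 a2 x1 x2.
Proof.
move=> n1 n2 i1 i2 [gen _]; rewrite /ndroot /is_root /is_config /degenerate.
rewrite /end1 /end2 /= !geA_add; split.
  move=> [[[_ _ c1 c2] r1 r2] nd]; apply/and5P; split=> //.
    by rewrite orbC in c2; move: c2; rewrite orbC => /orP[->|->]; rewrite ?orbT.
  apply: contraT; rewrite negb_or => /andP[d1 d2]; exfalso; apply: nd.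
  by constructor 3.
move=> /and5P[c1 c2 nd r1 r2]; split; first by split=> //; split=> //; rewrite orbC.
case=> [[t|t]|[e [e' [t1 t2]]]|[d1 d2]].
- by have /gen[] : in_tors (x1 *~ 1 + x2 *~ 0) by rewrite mulr1z mulr0z addr0.
- by have /gen[] : in_tors (x1 *~ 0 + x2 *~ 1) by rewrite mulr1z mulr0z add0r.
- have /gen[] // : in_tors (x1 *~ 1 + x2 *~ 1).
  rewrite !mulr1z; exists (e + e').
  have -> : x1 + x2 = (a1 + x1) + (a2 + x2) - a1 - a2 by A_ring.
  by rewrite t1 t2; A_ring.
- by move: nd; rewrite (negPf d1) (negPf d2).
Qed.

(** For x2 >= 0, this is the condition for k x2 >= x1 - d to have a solution k:
    the obstructions are the coordinates where x2 vanishes. *)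
Definition catches_up a1 a2 x1 x2 : bool :=
  [forall r, (x2.2 r == 0) ==> (a1.2 r + x1.2 r <= a2.2 r)].

Lemma generic_next x1 x2 k : generic x1 x2 -> generic x2 (x2 *+ k - x1).
Proof.
move=> [gen nz]; split=> [m n t|r].
  have /gen[n0 m0] : in_tors (x1 *~ (- n) + x2 *~ (m + n * k%:Z)).
    by case: t => e t; exists e; rewrite -t; A_ring.
  have n00 : n = 0 by lia.
  by split; [move: m0; rewrite n00 mul0r addr0|].
have [z|z] := nz r; last by left.
case: (eqVneq (x2.2 r) 0) => [x20|/eqP x20]; last by left.
by right; coords; rewrite x20; lia.
Qed.

Lemma next_rootP a1 a2 x1 x2 Q : next_root (Config a1 a2 x1 x2) Q ->
  [/\ nneg x2, geA (a1 + x1) a2, catches_up a1 a2 x1 x2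
    & exists k, [/\ (2 <= k)%N, Q = Config a1 a2 x2 (x2 *+ k - x1)
      & geA (a2 + (x2 *+ k - x1)) a1]].
Proof.
move=> [[[_ _ /negP ncmp] _] [k [[c1 c2 c3 ->] _]] _]; rewrite /end1 /end2 /= in c1 c2 c3 *.
split=> //; first by apply/forallP=> r; apply/implyP=> /eqP x20; at_coord r; rewrite x20; lia.
exists k; split=> //; last by ord_lia.
case: k c3 => [|[|//]] c3; case: ncmp; rewrite /end1 /end2 /=; by ord_lia.
Qed.

Lemma next_root_fun R Q Q' : next_root R Q -> next_root R Q' -> Q = Q'.
Proof.
move=> [_ [k [c m]] _] [_ [k' [c' m']] _].
have ek : k = k' by apply/eqP; rewrite eqn_leq (m _ _ c') (m' _ _ c).
by move: c c'; rewrite ek => -[_ _ _ ->] [_ _ _ ->].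
Qed.

Lemma prev_root_fun R Q Q' : prev_root R Q -> prev_root R Q' -> Q = Q'.
Proof.
move=> [_ [k [c m]] _] [_ [k' [c' m']] _].
have ek : k = k' by apply/eqP; rewrite eqn_leq (m _ _ c') (m' _ _ c).
by move: c c'; rewrite ek => -[_ _ _ ->] [_ _ _ ->].
Qed.

(** Going back uses the same parameter: a smaller one would make the endpoints
    of the root R comparable. *)
Lemma next_root_prev R Q : next_root R Q -> prev_root Q R.
Proof.
case: R => a1 a2 x1 x2 [nR [k [[c1 c2 c3 ->] _]] nQ]; split=> //; exists k.
rewrite /end1 /end2 /= in c1 c2 c3 *; split.
  split=> //; rewrite /end1 /end2 /=; [by ord_lia|by ord_lia|].
  by congr Config; A_ring.
move=> k' C' [d1 d2 d3 _]; rewrite /end1 /end2 /= in d1 d2 d3; rewrite leqNgt.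
apply/negP=> lt; case: nR => -[_ /negP H _] _; apply: H; rewrite /end1 /end2 /=.
apply/geP=> r; at_coord r; nia.
Qed.

Lemma prev_root_next R Q : prev_root R Q -> next_root Q R.
Proof.
case: R => a1 a2 x1 x2 [nR [k [[c1 c2 c3 ->] _]] nQ]; split=> //; exists k.
rewrite /end1 /end2 /= in c1 c2 c3 *; split.
  split=> //; rewrite /end1 /end2 /=; [by ord_lia|by ord_lia|].
  by congr Config; A_ring.
move=> k' C' [d1 d2 d3 _]; rewrite /end1 /end2 /= in d1 d2 d3; rewrite leqNgt.
apply/negP=> lt; case: nR => -[_ _ /negP H] _; apply: H; rewrite /end1 /end2 /=.
apply/geP=> r; at_coord r; nia.
Qed.

(** The minimal parameter k is at least 2, since k <= 1 makes the endpoints of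
    the given root comparable; this is why the new root is again a root. *)
Lemma next_root_exists a1 a2 x1 x2 :
  nneg a1 -> nneg a2 -> ~~ geA a1 a2 -> ~~ geA a2 a1 -> generic x1 x2 ->
  root_ineqs a1 a2 x1 x2 -> nneg x2 -> geA (a1 + x1) a2 ->
  catches_up a1 a2 x1 x2 ->
  exists Q, next_root (Config a1 a2 x1 x2) Q.
Proof.
move=> n1 n2 i1 i2 gen rt p2 p1 cu.
have [k0 k0P] : exists k, geA (a2 + x2 *+ k) (a1 + x1).
  exists (\sum_r absz (a1.2 r + x1.2 r - a2.2 r)%R)%N; apply/geP => r.
  move: (implyP (forallP cu r)) (nnegP _ p2 r) (geP _ _ p1 r).
  coords; rewrite (bigD1 r) //=; set S := (\sum_(_ | _) _)%N; set y := x2.2 r.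
  case: (eqVneq y 0) => [-> /(_ isT)|y0 _]; first by lia.
  by nia.
pose p k := geA (a2 + x2 *+ k) (a1 + x1).
have exk : exists k, p k by exists k0.
case: (ex_minnP exk) => k kP kmin.
have k2 : (2 <= k)%N.
  case: k kP {kmin} => [|[|//]] kP; move: rt => /and5P[_ _ _ _ /negP[]]; rewrite /p in kP.
    by ord_lia.
  by ord_lia.
exists (Config a1 a2 x2 (x2 *+ k - x1)); split.
- exact/ndrootE.
- exists k; split; first by split.
  by move=> k' C' [_ _ c3 _]; apply: kmin.
- apply/ndrootE => //; first exact: generic_next.
  have q2 : geA (a2 + (x2 *+ k - x1)) a1 by move: kP; rewrite /p => kP; ord_lia.
  move: rt => /and5P[_ _ _ r1 r2]; apply/and5P; split; rewrite ?p2 ?q2 ?orbT //.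
    apply: contra r1 => H; apply/geP=> r; at_coord r; nia.
  apply/negP=> H; have : p k.-1 by apply/geP=> r; at_coord r; nia.
  by move/kmin; clear -k2; lia.
Qed.

(** Hence full-tree sons have to be looked for at the ends of a sequence only. *)
Lemma inner_full Z R Q : next_root Z R -> next_root R Q -> full_tree R.
Proof.
case: Z => a1 a2 w x1 ZR; case: (next_rootP ZR) => [p1 _ _ [k [_ eR q]]].
rewrite {}eR in ZR * => /next_rootP[p2 p3 _ _].
by apply/and4P; split; rewrite /end1 /end2 /= ?geA_add.
Qed.
End Config.

(** * Full-tree words *)
Section Words.
Variable P : {fset nat}.
Implicit Types (x y a : A P) (C : config P) (s t : seq bool).

Lemma nat_switch (Q : pred nat) n : Q 0%N -> ~~ Q n -> exists2 k, Q k & ~~ Q k.+1.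
Proof.
move=> Q0; elim: n => [|n IH] Qn; first by rewrite Q0 in Qn.
by case: (boolP (Q n)) => [q|/IH//]; exists n.
Qed.

(** Son 2 keeps the first vector, so that the inequality which lets son 1 exist
    cannot be gained on the way. *)
Lemma no_ft_word1 C s : ~~ geA (end1 C) (pt2 C) -> ~ ft_word C s.
Proof.
elim: s C => [|d s IH] C nd [C' /= eC ft].
  by case: eC ft nd => <- /and4P[_ ->].
case: d eC => /=; last by rewrite /son /= (negPf nd).
rewrite /son /=; case: ifP => // _ e.
by apply: (IH _ _ (ex_intro2 _ _ C' e ft)).
Qed.

Lemma no_ft_word2 C s : ~~ geA (end2 C) (pt1 C) -> ~ ft_word C s.
Proof.
elim: s C => [|d s IH] C nd [C' /= eC ft].
  by case: eC ft nd => <- /and4P[_ _ ->].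
case: d eC => /=; first by rewrite /son /= (negPf nd).
rewrite /son /=; case: ifP => // _ e.
by apply: (IH _ _ (ex_intro2 _ _ C' e ft)).
Qed.

Lemma ft_word_cons d C C' (e : son d C = Some C') s : ft_word C (d :: s) <-> ft_word C' s.
Proof. by rewrite /ft_word /= e. Qed.

Lemma ft_word_nil C : ft_word C [::] <-> full_tree C.
Proof. by split=> [[C' [<-]]|] //; exists C. Qed.

Lemma min_ft_word_cons d C C' (e : son d C = Some C') (nf : ~~ full_tree C) s :
  min_ft_word C (d :: s) <-> min_ft_word C' s.
Proof.
split=> -[ft mn]; split.
- exact/(ft_word_cons e).
- move=> t pt nt /(ft_word_cons e); apply: mn; first by rewrite /= eqxx.
  by rewrite eqseq_cons eqxx.
- exact/(ft_word_cons e).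
case=> [|d' t] /= pt nt; first by move/ft_word_nil; apply/negP.
have [dd {}pt] : d' = d /\ prefix t s by case: eqP pt.
rewrite dd; move/(ft_word_cons e); apply: mn => //.
by apply: contra nt => /eqP ->; rewrite dd.
Qed.

Lemma min_ft_word_full C s : full_tree C -> min_ft_word C s -> s = [::].
Proof.
move=> f; case: s => // d s [_ /(_ [::])]; case=> //; exact/ft_word_nil.
Qed.

Lemma extremal_nil d C : full_tree C -> extremal_ft_word d C [::].
Proof.
move=> f; split; first by split=> [|[]//]; apply/ft_word_nil.
by move=> s /(min_ft_word_full f) ->.
Qed.

(** A leading digit 2 beats every word that begins with 1. *)
Lemma extremal_cons2 C C' s : son digit2 C = Some C' -> ~~ full_tree C ->
  extremal_ft_word digit2 C' s -> extremal_ft_word digit2 C (digit2 :: s).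
Proof.
move=> e nf [mn ex]; split; first exact/(min_ft_word_cons e nf).
case=> [|[] t]; first by case=> /ft_word_nil; rewrite (negPf nf).
  move=> /(min_ft_word_cons e nf) mt nt.
  have {}nt : t != s by apply: contra nt => /eqP->.
  case: (ex t mt nt) => [lt|[le lx]]; [left|right]; first by rewrite /leading /= ltnS.
  split; first by rewrite /leading /= -/(leading _ _) le.
  by case: lx => p [u [u' [-> ->]]]; exists (digit2 :: p), u, u'.
by move=> _ _; left.
Qed.

Lemma leading_cat_neq d s s' : lex_before d s s' -> lex_before d s' s -> False.
Proof.
move=> [p [t [t' [-> ->]]]] [q [u [u' []]]].
elim: p q => [|b p IH] [|c q] /=.
- by case=> e _; case: (d) e.
- by move=> [e _] [e' _]; move: e'; rewrite -e; case: (d).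
- by move=> [e _] [e' _]; move: e'; rewrite e; case: (d).
- by move=> [_ e] [_ e']; apply: IH e e'.
Qed.

Lemma extremal_uniq d C s s' :
  extremal_ft_word d C s -> extremal_ft_word d C s' -> s = s'.
Proof.
move=> [m e] [m' e']; apply/eqP; apply: contraT => ne.
have := e _ m'; rewrite eq_sym => /(_ ne); have := e' _ m ne.
move=> [l|[l x]] [l'|[l' x']]; try lia.
by case: (leading_cat_neq x x').
Qed.

(** The extremal word for the digit 2 is empty if x1, x2 >= 0, and it is 2 if only
    x1 >= 0. Otherwise it consists of i digits 2 and a digit 1, for the largest i
    with x2 + i x1 >= - d; but if i = 0 and x2 >= 0 fails, it is 12. The node that
    it selects has second vector i x1 + j x2. *)
Definition word_coef a1 a2 x1 x2 (i j : int) : bool :=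
  [&& geA (a1 + x1) a2, geA (a2 + x2) a1 &
   if nneg x1 then (i == (~~ nneg x2 : nat)%:Z) && (j == 1)
   else [&& nneg x2 || (1 <= i), 0 <= i, j == 1, geA (a2 + (x2 + x1 *~ i)) a1
          & ~~ geA (a2 + (x2 + x1 *~ (i + 1))) a1]
     || [&& ~~ nneg x2, ~~ geA (a2 + (x2 + x1)) a1, geA (a1 + (x1 + x2)) a2,
          i == 1 & j == 2]].

Definition selects a1 a2 x1 x2 l :=
  exists s C, [/\ extremal_ft_word digit2 (Config a1 a2 x1 x2) s,
    iter_son (Config a1 a2 x1 x2) s = Some C & vec2 C = l].

Lemma full_treeE a1 a2 x1 x2 : full_tree (Config a1 a2 x1 x2) =
  [&& nneg x1, geA (a1 + x1) a2, geA (a2 + x2) a1 & nneg x2].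
Proof. by rewrite /full_tree /end1 /end2 /= !geA_add. Qed.

Lemma selects_son2 a1 a2 x1 x2 l : geA (a2 + x2) a1 -> ~~ (nneg x1 && nneg x2) ->
  selects a1 a2 x1 (x2 + x1) l -> selects a1 a2 x1 x2 l.
Proof.
move=> p2 nf [s [C [ex it v]]].
have e : son digit2 (Config a1 a2 x1 x2) = Some (Config a1 a2 x1 (x2 + x1)).
  by rewrite /son /= /end2 /= p2.
exists (digit2 :: s), C; split=> //; last by rewrite /= e.
apply: (extremal_cons2 e) => //; rewrite full_treeE; apply: contra nf.
by case/and4P=> -> _ _ ->.
Qed.

Lemma selects_full a1 a2 x1 x2 : geA (a1 + x1) a2 -> geA (a2 + x2) a1 ->
  nneg x1 -> nneg x2 -> selects a1 a2 x1 x2 x2.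
Proof.
move=> p1 p2 q1 q2; exists [::], (Config a1 a2 x1 x2); split=> //.
by apply: extremal_nil; rewrite full_treeE p1 p2 q1 q2.
Qed.

(** After k digits 2 the vectors are x1 and x2 + k x1. One digit 1 then suffices,
    while k + 1 digits 2 lose the condition x2 >= - d for good. *)
Lemma selects_power a1 a2 x1 x2 k : geA (a1 + x1) a2 -> geA (a2 + x2) a1 ->
  ~~ nneg x1 -> nneg x2 -> geA (a2 + (x2 + x1 *+ k)) a1 ->
  ~~ geA (a2 + (x2 + x1 *+ k.+1)) a1 -> selects a1 a2 x1 x2 (x2 + x1 *+ k).
Proof.
move=> p1; elim: k x2 => [|k IH] x2 p2 q1 q2 pk nk; last first.
  have y0 : nneg (x2 + x1) by ord_lia.
  have y1 : geA (a2 + (x2 + x1)) a1 by apply/geP => r; at_coord r; nia.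
  apply: selects_son2 => //; first by rewrite (negPf q1).
  rewrite mulrS addrA; apply: IH => //; first by rewrite -addrA -mulrS.
  by rewrite -addrA -mulrS.
set C := Config a1 a2 x1 x2.
have e1 : son digit1 C = Some (Config a1 a2 (x1 + x2) x2) by rewrite /son /= /end1 /= p1.
have f1 : full_tree (Config a1 a2 (x1 + x2) x2).
  rewrite full_treeE; apply/and4P; split=> //; by ord_lia.
have nf : ~~ full_tree C by rewrite full_treeE (negPf q1).
exists [:: digit1], (Config a1 a2 (x1 + x2) x2); rewrite addr0; split=> //; last by rewrite /= e1.
split; first by apply/(min_ft_word_cons e1 nf); case: (extremal_nil digit2 f1).
case=> [|[] t]; first by case=> /ft_word_nil; rewrite (negPf nf).
  have e2 : son digit2 C = Some (Config a1 a2 x1 (x2 + x1)) by rewrite /son /= /end2 /= p2.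
  by move=> /(min_ft_word_cons e2 nf) [ft _]; case: (no_ft_word2 _ ft).
by move=> /(min_ft_word_cons e1 nf) /(min_ft_word_full f1) ->.
Qed.

Lemma word_coef_selects a1 a2 x1 x2 i j :
  word_coef a1 a2 x1 x2 i j -> selects a1 a2 x1 x2 (x1 *~ i + x2 *~ j).
Proof.
case/and3P=> p1 p2; case: ifP => q1.
  case/andP=> /eqP -> /eqP ->; rewrite mulr1z; case: (boolP (nneg x2)) => q2.
    by rewrite mulr0z add0r; apply: selects_full.
  rewrite mulr1z; apply: selects_son2; rewrite ?(negPf q2) ?andbF //.
  rewrite addrC; apply: selects_full; rewrite // ?(addrC x1); by ord_lia.
case/orP=> [/and5P[q2 i0 /eqP-> pk nk]|].
  rewrite mulr1z addrC; case: i i0 q2 pk nk => [k|//] _ q2.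
  rewrite -PoszD addn1 -!pmulrn => pk nk.
  case/orP: q2 => q2; first by apply: selects_power; rewrite ?q1.
  case: k q2 pk nk => // k _ pk nk; apply: selects_son2 => //; first by rewrite q1.
  rewrite mulrS addrA; apply: selects_power; rewrite ?q1 //.
  - by apply/geP => r; at_coord r; nia.
  - by ord_lia.
  - by rewrite -addrA -mulrS.
  - by rewrite -addrA -mulrS.
case/and5P=> q2 n2 p12 /eqP-> /eqP->.
set C := Config a1 a2 x1 x2.
have e1 : son digit1 C = Some (Config a1 a2 (x1 + x2) x2) by rewrite /son /= /end1 /= p1.
set C1 := Config a1 a2 (x1 + x2) x2.
have e12 : son digit2 C1 = Some (Config a1 a2 (x1 + x2) (x2 + (x1 + x2))).
  by rewrite /son /= /end2 /= p2.
have nf : ~~ full_tree C by rewrite full_treeE q1.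
have nf1 : ~~ full_tree C1 by rewrite full_treeE (negPf q2) !andbF.
have f12 : full_tree (Config a1 a2 (x1 + x2) (x2 + (x1 + x2))).
  rewrite full_treeE; apply/and4P; split=> //; by ord_lia.
exists [:: digit1; digit2], (Config a1 a2 (x1 + x2) (x2 + (x1 + x2))); split.
- split.
    apply/(min_ft_word_cons e1 nf)/(min_ft_word_cons e12 nf1).
    by case: (extremal_nil digit2 f12).
  case=> [|[] t]; first by case=> /ft_word_nil; rewrite (negPf nf).
    have e2 : son digit2 C = Some (Config a1 a2 x1 (x2 + x1)) by rewrite /son /= /end2 /= p2.
    by move=> /(min_ft_word_cons e2 nf) [ft _]; case: (no_ft_word2 _ ft).
  move=> /(min_ft_word_cons e1 nf); case: t => [|[] t].
  + by case=> /ft_word_nil; rewrite (negPf nf1).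
  + by move=> /(min_ft_word_cons e12 nf1) /(min_ft_word_full f12) ->.
  + by move=> _ _; right; split=> //; exists [:: digit1], [::], t.
- by rewrite /= e1 /= e12.
- by rewrite /=; A_ring.
Qed.

Lemma has_ft_word_coef a1 a2 x1 x2 : has_ft_son (Config a1 a2 x1 x2) ->
  exists i j, word_coef a1 a2 x1 x2 i j.
Proof.
move=> [s ft].
have p1 : geA (a1 + x1) a2 by apply: contraT => n1; case: (@no_ft_word1 (Config a1 a2 x1 x2) s).
have p2 : geA (a2 + x2) a1 by apply: contraT => n1; case: (@no_ft_word2 (Config a1 a2 x1 x2) s).
rewrite /word_coef p1 p2 /=; case: (boolP (nneg x1)) => q1.
  by exists (~~ nneg x2 : nat)%:Z, 1; rewrite /= !eqxx.
have [r0 xr0] := nnnegP q1.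
pose Q k := geA (a2 + (x2 + x1 *+ k)) a1.
have [k Qk nQk] : exists2 k, Q k & ~~ Q k.+1.
  apply: (@nat_switch Q (absz (x2.2 r0 + a2.2 r0 - a1.2 r0)%R).+1).
    by rewrite /Q mulr0n addr0.
  by apply/negP=> /geP/(_ r0); coords; nia.
case: (boolP (nneg x2 || (0 < k)%N)) => [c|].
  exists k%:Z, 1; apply/orP; left; rewrite -PoszD addn1 -!pmulrn -/(Q k) Qk -/(Q _) nQk.
  by rewrite /= !andbT.
rewrite negb_or -eqn0Ngt => /andP[q2 /eqP k0]; rewrite k0 /Q mulr1n in nQk.
exists 1, 2; apply/orP; right; rewrite q2 nQk !eqxx !andbT /=; apply: contraT => n12.
case: s ft => [/ft_word_nil|[] s ft]; first by rewrite full_treeE (negPf q1).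
  have e2 : son digit2 (Config a1 a2 x1 x2) = Some (Config a1 a2 x1 (x2 + x1)).
    by rewrite /son /= /end2 /= p2.
  by move: ft; rewrite (ft_word_cons e2) => ft; case: (no_ft_word2 _ ft).
have e1 : son digit1 (Config a1 a2 x1 x2) = Some (Config a1 a2 (x1 + x2) x2).
  by rewrite /son /= /end1 /= p1.
by move: ft; rewrite (ft_word_cons e1) => ft; case: (no_ft_word1 _ ft).
Qed.

Lemma selects_has_ft a1 a2 x1 x2 l :
  selects a1 a2 x1 x2 l -> has_ft_son (Config a1 a2 x1 x2).
Proof. by move=> [s [C [[[ft _] _] _ _]]]; exists s. Qed.
End Words.

(** * Exchanging the two edges *)
Section Swap.
Variable P : {fset nat}.
Implicit Types (x y a l : A P) (C R Q : config P) (s t : seq bool).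

Definition swap C := Config (pt2 C) (pt1 C) (vec2 C) (vec1 C).

Lemma swapK C : swap (swap C) = C. Proof. by case: C. Qed.

Lemma swap_inj C C' : swap C = swap C' -> C = C'.
Proof. by move/(congr1 swap); rewrite !swapK. Qed.

Lemma is_root_swap C : is_root C -> is_root (swap C).
Proof.
by case: C => a1 a2 x1 x2 [[[n1 n2] [i1 i2] c1 c2] r1 r2]; do !split=> //; rewrite orbC.
Qed.

Lemma degenerate_swap C : degenerate C -> degenerate (swap C).
Proof.
case: C => a1 a2 x1 x2 [[t|t]|[e [e' [t1 t2]]]|[d1 d2]].
- by constructor 1; right.
- by constructor 1; left.
- by constructor 2; exists e', e.
- by constructor 3.
Qed.

Lemma ndroot_swap C : ndroot C <-> ndroot (swap C).
Proof.
have H D : ndroot D -> ndroot (swap D).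
  move=> [r d]; split; first exact: is_root_swap.
  by move/degenerate_swap; rewrite swapK.
by split=> /H //; rewrite swapK.
Qed.

Lemma connection_swap R k Q : connection1 R k Q <-> connection2 (swap R) k (swap Q).
Proof.
case: R Q => [a1 a2 x1 x2] [b1 b2 y1 y2].
by split=> -[c1 c2 c3 [-> -> -> ->]]; split.
Qed.

Lemma prev_root_swap R Q : prev_root R Q <-> next_root (swap R) (swap Q).
Proof.
split=> -[nR [k [c m]] nQ]; split; rewrite ?(ndroot_swap R) ?(ndroot_swap Q) //.
- by rewrite -ndroot_swap.
- exists k; split; first exact/connection_swap.
  by move=> k' C' c'; apply: (m k' (swap C')); apply/connection_swap; rewrite swapK.
- by rewrite -ndroot_swap.
- exists k; split; first exact/connection_swap.
  by move=> k' C' /connection_swap; apply: m.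
Qed.

Lemma rel_iter_swap n R Q :
  rel_iter (@prev_root P) n R Q <-> rel_iter (@next_root P) n (swap R) (swap Q).
Proof.
elim: n Q => [|n IH] Q /=; first by split=> [->|/swap_inj].
split=> -[Z]; first by move=> /IH rZ /prev_root_swap ZQ; exists (swap Z).
move=> rZ ZQ; exists (swap Z); first by apply/IH; rewrite swapK.
by apply/prev_root_swap; rewrite swapK.
Qed.

Lemma root_at_swap i R Q : root_at R i Q <-> root_at (swap R) (- i) (swap Q).
Proof.
case: i => [[|n]|n]; first exact: (rel_iter_swap 0).
  rewrite -NegzE; have := rel_iter_swap n.+1 (swap R) (swap Q); rewrite !swapK.
  by move=> H; split=> /H.
by rewrite NegzE opprK; exact: rel_iter_swap.
Qed.

Lemma full_tree_swap C : full_tree (swap C) = full_tree C.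
Proof.
case: C => a1 a2 x1 x2; rewrite /full_tree /=.
by do 4!case: (geA _ _).
Qed.

Lemma son_swap d C : son (~~ d) (swap C) = omap swap (son d C).
Proof.
by case: C d => a1 a2 x1 x2 [] /=; rewrite /son /=; case: ifP.
Qed.

Lemma iter_son_swap C s : iter_son (swap C) (map negb s) = omap swap (iter_son C s).
Proof.
by elim: s C => [|d s IH] C //=; rewrite son_swap; case: (son d C) => //= C'.
Qed.

Lemma negbK_map : involutive (map negb).
Proof. by move=> s; rewrite -map_comp map_id_in // => b _ /=; rewrite negbK. Qed.

Lemma ft_word_swap C s : ft_word C s <-> ft_word (swap C) (map negb s).
Proof.
have H D t : ft_word D t -> ft_word (swap D) (map negb t).
  by move=> [C' e f]; exists (swap C'); rewrite ?iter_son_swap ?e ?full_tree_swap.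
by split=> /H //; rewrite swapK negbK_map.
Qed.

Lemma has_ft_son_swap C : has_ft_son C <-> has_ft_son (swap C).
Proof.
have H D : has_ft_son D -> has_ft_son (swap D).
  by move=> [s /ft_word_swap]; exists (map negb s).
by split=> /H //; rewrite swapK.
Qed.

Lemma min_ft_word_swap C s : min_ft_word C s <-> min_ft_word (swap C) (map negb s).
Proof.
have H D t : min_ft_word D t -> min_ft_word (swap D) (map negb t).
  move=> [f m]; split; first exact: (proj1 (ft_word_swap _ _)).
  move=> u pu nu fu; apply: (m (map negb u)).
  - by move: pu => /prefixP[v e]; rewrite -[t]negbK_map e map_cat prefix_prefix.
  - by apply: contra nu => /eqP<-; rewrite negbK_map.
  - by move/ft_word_swap: fu; rewrite swapK.
by split=> /H //; rewrite swapK negbK_map.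
Qed.

Lemma leading_map d s : leading (~~ d) (map negb s) = leading d s.
Proof.
by rewrite /leading find_map; apply: eq_find => b /=; case: b d => [] [].
Qed.

Lemma extremal_swap d C s :
  extremal_ft_word d C s <-> extremal_ft_word (~~ d) (swap C) (map negb s).
Proof.
have H e D t : extremal_ft_word e D t -> extremal_ft_word (~~ e) (swap D) (map negb t).
  move=> [m ex]; split; first exact: (proj1 (min_ft_word_swap _ _)).
  move=> u mu nu; case: (ex (map negb u)).
  - by move/min_ft_word_swap: mu; rewrite swapK.
  - by apply: contra nu => /eqP<-; rewrite negbK_map.
  - by rewrite -(leading_map e t) -(leading_map e (map negb u)) negbK_map; left.
  move=> [l [p [v [v' [et eu]]]]]; right; split.
    by rewrite (leading_map e t) -l -(leading_map e (map negb u)) negbK_map.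
  exists (map negb p), (map negb v), (map negb v'); split; first by rewrite et map_cat.
  by rewrite -[u]negbK_map eu map_cat.
by split=> /H //; rewrite swapK negbK_map negbK.
Qed.

Lemma infinite_swap R : infinite_left R <-> infinite_right (swap R).
Proof.
split=> H n; have [Q] := H n; move/root_at_swap; rewrite ?opprK ?swapK; by exists (swap Q).
Qed.

Lemma limit_swap R l : limit_minus R l <-> limit_plus (swap R) l.
Proof.
split.
- case=> [[inf [N HN]]|[inf [i [Q [s [C [[rQ fQ] mx ex it ->]]]]]]].
    left; split; first exact/infinite_swap.
    exists (- N) => i Q iN /root_at_swap; rewrite swapK => rQ.
    by rewrite (HN (- i) (swap Q)) //; lia.
  right; split; first by move/infinite_swap.
  exists (- i), (swap Q), (map negb s), (swap C); split=> //.
  + split; [exact: (proj1 (root_at_swap _ _ _))|exact: (proj1 (has_ft_son_swap _))].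
  + move=> j Q' /root_at_swap; rewrite swapK => rj /has_ft_son_swap fj.
    by have := mx _ _ rj fj; lia.
  + by move/extremal_swap: ex.
  + by rewrite iter_son_swap it.
- case=> [[inf [N HN]]|[inf [i [Q [s [C [[rQ fQ] mx ex it ->]]]]]]].
    left; split; first exact/infinite_swap.
    exists (- N) => i Q iN /root_at_swap rQ.
    by rewrite (HN (- i) (swap Q)) //; lia.
  right; split; first by move/infinite_swap.
  exists (- i), (swap Q), (map negb s), (swap C); split=> //.
  + split; last exact: (proj1 (has_ft_son_swap _)).
    by apply/root_at_swap; rewrite opprK swapK.
  + move=> j Q' /root_at_swap rj /has_ft_son_swap fj.
    by have := mx _ _ rj fj; lia.
  + by move/extremal_swap: ex.
  + by rewrite iter_son_swap it.
Qed.

Lemma twin_swap R Q : twin R Q -> twin (swap Q) (swap R).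
Proof.
case: R Q => [a1 a2 x1 x2] [b1 b2 y1 y2].
move=> [[nR nQ] [/= e1 e2] [e [lam [[/= f1 f2] [g1 g2] l2 /= eq]]]].
subst b1 b2; split.
- split; [exact: (proj1 (ndroot_swap _) nQ)|exact: (proj1 (ndroot_swap _) nR)].
- by split; reflexivity.
exists e, lam; split; [by split|by split|exact: l2|]; rewrite /= eq {eq}.
apply: A_ext; last by move=> r; coords; ring.
torsions.
transitivity (torsion x2 + torsion a2 * lam%:~R + (e + e) * lam%:~R); last by ring.
by rewrite Z2_addrr; ring.
Qed.

Lemma non_twin_swap R : non_twin R <-> non_twin (swap R).
Proof.
have H D : non_twin D -> non_twin (swap D).
  move=> nt [Q [/twin_swap|/twin_swap]]; rewrite swapK => t; apply: nt.
    by exists (swap Q); right.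
  by exists (swap Q); left.
by split=> /H //; rewrite swapK.
Qed.
End Swap.

(** * Oriented bases of the lattice *)
Section Lattice.
Variable P : {fset nat}.
Implicit Types (x y a h : A P) (z w u V : int * int).

Definition det2 z w : int := z.1 * w.2 - z.2 * w.1.

(** The Nielsen moves have determinant 1, so orientation is preserved: this is
    the class of (h1, h2) by nielsen_oriented and oriented_nielsen. *)
Definition oriented h1 h2 x1 x2 : Prop :=
  exists z w, [/\ x1 = comb h1 h2 z, x2 = comb h1 h2 w & det2 z w = 1].

Lemma combD h1 h2 z w : comb h1 h2 (z + w) = comb h1 h2 z + comb h1 h2 w.
Proof. by case: z w => [z1 z2] [w1 w2]; rewrite /comb /=; A_ring. Qed.

Lemma combN h1 h2 z : comb h1 h2 (- z) = - comb h1 h2 z.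
Proof. by case: z => [z1 z2]; rewrite /comb /=; A_ring. Qed.

Lemma comb_coord h1 h2 z r : (comb h1 h2 z).2 r = h1.2 r * z.1 + h2.2 r * z.2.
Proof. by rewrite /comb; coords. Qed.

Lemma pair_add z w : z + w = (z.1 + w.1, z.2 + w.2).
Proof. by case: z w. Qed.

Lemma pair_opp z : - z = (- z.1, - z.2).
Proof. by case: z. Qed.

Lemma pair_mulz (b c k : int) : (b, c) *~ k = (b * k, c * k).
Proof.
have mn (n : nat) : (b, c) *+ n = (b * n%:Z, c * n%:Z).
  elim: n => [|n IH]; first by rewrite !mulr0.
  by rewrite mulrS IH pair_add /=; congr pair; lia.
by case: k => n; rewrite /intmul mn // pair_opp /=; congr pair; lia.
Qed.

(** The shear z |-> z + t z_r V has determinant 1, because V_r = 0. *)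
Lemma shear_det h1 h2 r z w V (t : int) : (comb h1 h2 V).2 r = 0 ->
  det2 (z.1 + V.1 * (t * (comb h1 h2 z).2 r), z.2 + V.2 * (t * (comb h1 h2 z).2 r))
       (w.1 + V.1 * (t * (comb h1 h2 w).2 r), w.2 + V.2 * (t * (comb h1 h2 w).2 r))
  = det2 z w.
Proof.
rewrite comb_coord => vr; rewrite /det2 !comb_coord /=.
transitivity (z.1 * w.2 - z.2 * w.1
  + t * (h1.2 r * V.1 + h2.2 r * V.2) * (z.1 * w.2 - z.2 * w.1)); first by ring.
by rewrite vr; ring.
Qed.

Lemma oriented_addl h1 h2 x y : oriented h1 h2 x y -> oriented h1 h2 (x + y) y.
Proof.
move=> [z [w [-> -> d]]]; exists (z + w), w; rewrite combD; split=> //.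
by rewrite -d /det2 pair_add /=; ring.
Qed.

Lemma oriented_subl h1 h2 x y : oriented h1 h2 x y -> oriented h1 h2 (x - y) y.
Proof.
move=> [z [w [-> -> d]]]; exists (z - w), w; rewrite combD combN; split=> //.
by rewrite -d /det2 pair_add pair_opp /=; ring.
Qed.

Lemma oriented_rot h1 h2 x y : oriented h1 h2 x y -> oriented h1 h2 (- y) x.
Proof.
move=> [z [w [-> -> d]]]; exists (- w), z; rewrite combN; split=> //.
by rewrite -d /det2 pair_opp /=; ring.
Qed.

Lemma oriented_unrot h1 h2 x y : oriented h1 h2 x y -> oriented h1 h2 y (- x).
Proof.
move=> [z [w [-> -> d]]]; exists w, (- z); rewrite combN; split=> //.
by rewrite -d /det2 pair_opp /=; ring.
Qed.

Lemma oriented_addr h1 h2 x y : oriented h1 h2 x y -> oriented h1 h2 x (y + x).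
Proof. by move/oriented_rot/oriented_subl/oriented_unrot; rewrite opprB opprK addrC. Qed.

Lemma oriented_subr h1 h2 x y : oriented h1 h2 x y -> oriented h1 h2 x (y - x).
Proof. by move/oriented_rot/oriented_addl/oriented_unrot; rewrite opprD opprK. Qed.

Lemma oriented_addrn h1 h2 x y k : oriented h1 h2 x y -> oriented h1 h2 x (y + x *+ k).
Proof.
move=> o; elim: k => [|k IH]; first by rewrite addr0.
by rewrite mulrSr addrA; apply: oriented_addr.
Qed.

Lemma oriented_addln h1 h2 x y k : oriented h1 h2 x y -> oriented h1 h2 (x + y *+ k) y.
Proof.
move=> o; elim: k => [|k IH]; first by rewrite addr0.
by rewrite mulrSr addrA; apply: oriented_addl.
Qed.

Lemma oriented_next h1 h2 x y k :
  oriented h1 h2 x y -> oriented h1 h2 y (y *+ k - x).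
Proof. by move/oriented_unrot/(oriented_addrn k); rewrite addrC. Qed.

Lemma oriented_swap h1 h2 x y : oriented h1 h2 x y -> oriented h2 h1 y x.
Proof.
move=> [[z1 z2] [[w1 w2] [-> -> d]]]; exists (w2, w1), (z2, z1).
rewrite /comb; split; [by A_ring|by A_ring|by rewrite -d /det2 /=; ring].
Qed.

Lemma oriented_in_span h1 h2 x y : oriented h1 h2 x y ->
  forall i j : int, in_span h1 h2 (x *~ i + y *~ j).
Proof.
move=> [[z1 z2] [[w1 w2] [-> -> _]]] i j; exists (z1 * i + w1 * j, z2 * i + w2 * j).
by rewrite /comb /=; A_ring.
Qed.

Lemma nielsen_oriented h1 h2 x y : nielsen (h1, h2) (x, y) -> oriented h1 h2 x y.
Proof.
have H p q : nielsen p q -> oriented h1 h2 p.1 p.2 <-> oriented h1 h2 q.1 q.2.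
  elim=> {p q} [p q []u v /=|p|p q _ [] //|p q r _ [i1 j1] _ [i2 j2]] //.
  - split; first exact: oriented_addl.
    by move/oriented_subl; rewrite addrK.
  - split; first exact: oriented_subl.
    by move/oriented_addl; rewrite subrK.
  - split; first exact: oriented_addr.
    by move/oriented_subr; rewrite addrK.
  - split; first exact: oriented_subr.
    by move/oriented_addr; rewrite subrK.
  by split=> [/i1/i2|/j2/j1].
move=> /H[h _]; apply: h; exists (1, 0), (0, 1).
by rewrite /comb /= !mulr1z !mulr0z addr0 add0r.
Qed.

Lemma nielsen_left_eq x y x' : x' = x + y \/ x' = x - y -> nielsen (x, y) (x', y).
Proof. by case=> ->; apply: rst_step; constructor. Qed.

Lemma nielsen_right_eq x y y' : y' = y + x \/ y' = y - x -> nielsen (x, y) (x, y').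
Proof. by case=> ->; apply: rst_step; constructor. Qed.

Lemma nielsen_sub x y (t : int) : nielsen (x, y) (x + y *~ t, y).
Proof.
elim/int_rec: t => [|n IH|n IH]; first by rewrite mulr0z addr0; apply: rst_refl.
  apply: rst_trans IH _; apply: rst_step.
  by rewrite intS mulrzDr mulr1z [y + _]addrC addrA; constructor.
apply: rst_trans IH _; apply: rst_step.
have -> : x + y *~ (- n.+1%:Z) = x + y *~ (- n%:Z) - y by A_ring.
by constructor.
Qed.

Lemma nielsen_rot x y : nielsen (x, y) (- y, x).
Proof.
apply: (rst_trans _ _ _ (x, y + x)); first by apply: nielsen_right_eq; left.
apply: (rst_trans _ _ _ (- y, y + x)).
  by apply: nielsen_left_eq; right; A_ring.
by apply: nielsen_right_eq; left; A_ring.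
Qed.

(** Euclid's algorithm on the first coordinates of the two basis vectors. *)
Lemma oriented_nielsen h1 h2 x y : oriented h1 h2 x y -> nielsen (h1, h2) (x, y).
Proof.
move=> [z [w [-> -> ]]]; have [n] := ubnP (absz z.1 + absz w.1)%N.
have base (b z2 w2 : int) : det2 (b, z2) (0, w2) = 1 ->
    nielsen (h1, h2) (comb h1 h2 (b, z2), comb h1 h2 (0, w2)).
  rewrite /det2 /= mulr0 subr0 => e.
  have [[-> ->]|[-> ->]] : (b = 1 /\ w2 = 1) \/ (b = -1 /\ w2 = -1).
    have := congr1 absz e; rewrite abszM => /eqP; rewrite muln_eq1 => /andP[/eqP e1 /eqP e2].
    have [b1|b1] : b = 1 \/ b = -1 by lia.
      by left; rewrite b1 in e *; lia.
    by right; rewrite b1 in e *; lia.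
    rewrite /comb /= mulr0z add0r !mulr1z; exact: nielsen_sub.
  apply: rst_trans (nielsen_rot _ _) _; apply: rst_trans (nielsen_rot _ _) _.
  rewrite /comb /= mulr0z add0r !mulrNz !mulr1z.
  have -> : - h1 + h2 *~ z2 = - h1 + (- h2) *~ (- z2) by A_ring.
  exact: nielsen_sub.
elim: n z w => // n IH [z1 z2] [w1 w2] /= lt d.
have d' := d; rewrite /det2 /= in d'.
have [w0|w0] := eqVneq w1 0; first by rewrite w0 in d *; apply: base.
have [z0|z0] := eqVneq z1 0.
  apply: rst_sym; apply: rst_trans (nielsen_rot _ _) _; apply: rst_sym.
  by rewrite -combN pair_opp z0; apply: base; move: d; rewrite z0 /det2 /=; lia.
have sg : (`|z1 + w1| < `|z1| \/ `|z1 - w1| < `|z1|) \/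
          (`|w1 + z1| < `|w1| \/ `|w1 - z1| < `|w1|) by lia.
case: sg => -[] l.
- apply: rst_trans (IH (z1 + w1, z2 + w2) (w1, w2) _ _) _ => /=; [lia|by rewrite /det2 /=; lia|].
  by apply: nielsen_left_eq; right; rewrite /comb /=; A_ring.
- apply: rst_trans (IH (z1 - w1, z2 - w2) (w1, w2) _ _) _ => /=; [lia|by rewrite /det2 /=; lia|].
  by apply: nielsen_left_eq; left; rewrite /comb /=; A_ring.
- apply: rst_trans (IH (z1, z2) (w1 + z1, w2 + z2) _ _) _ => /=; [lia|by rewrite /det2 /=; lia|].
  by apply: nielsen_right_eq; right; rewrite /comb /=; A_ring.
- apply: rst_trans (IH (z1, z2) (w1 - z1, w2 - z2) _ _) _ => /=; [lia|by rewrite /det2 /=; lia|].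
  by apply: nielsen_right_eq; left; rewrite /comb /=; A_ring.
Qed.

(** An isomorphism with Z^2 makes the matrix from it to (h1, h2) invertible, so
    h1 and h2 are independent, also modulo the torsion of A. *)
Lemma span_free h1 h2 z : span_isoZ2 h1 h2 -> in_tors (comb h1 h2 z) -> z = (0, 0).
Proof.
move=> [phi [inj sp]] [e te].
have hE1 : h1 = comb h1 h2 (1, 0) by rewrite /comb /= mulr1z mulr0z addr0.
have hE2 : h2 = comb h1 h2 (0, 1) by rewrite /comb /= mulr1z mulr0z add0r.
have [p pE] : exists p, phi p = h1 by apply/sp; exists (1, 0).
have [q qE] : exists q, phi q = h2 by apply/sp; exists (0, 1).
have [u uE] : in_span h1 h2 (phi (1, 0)) by apply/sp; exists (1, 0).
have [v vE] : in_span h1 h2 (phi (0, 1)) by apply/sp; exists (0, 1).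
have combE t : comb h1 h2 t = phi (p *~ t.1 + q *~ t.2).
  by rewrite raddfD !raddfMz pE qE.
case: p q pE qE combE => [p1 p2] [q1 q2] pE qE combE.
have comb_phi t : comb h1 h2 t = phi (p1 * t.1 + q1 * t.2, p2 * t.1 + q2 * t.2).
  by rewrite combE !pair_mulz pair_add.
have := inj _ _ (etrans uE (comb_phi u)); have := inj _ _ (etrans vE (comb_phi v)).
move=> [v1 v2] [u1 u2].
have z0 : comb h1 h2 (z + z) = phi 0.
  rewrite combD te raddf0; apply: A_ext; last by move=> r; coords.
  by torsions; rewrite Z2_addrr.
move: z0; rewrite comb_phi pair_add /= => /inj[e1 e2].
have dd : (p1 * q2 - p2 * q1) * (u.1 * v.2 - u.2 * v.1) = 1.
  have -> : (p1 * q2 - p2 * q1) * (u.1 * v.2 - u.2 * v.1) =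
    (p1 * u.1 + q1 * u.2) * (p2 * v.1 + q2 * v.2)
    - (p2 * u.1 + q2 * u.2) * (p1 * v.1 + q1 * v.2) by ring.
  by rewrite -u1 -u2 -v1 -v2; ring.
have dn0 : p1 * q2 - p2 * q1 != 0 by apply: contra_eq_neq dd => ->; rewrite mul0r.
have f1 : (p1 * q2 - p2 * q1) * (z.1 + z.1) = 0.
  have -> : (p1 * q2 - p2 * q1) * (z.1 + z.1) =
    (p1 * (z.1 + z.1) + q1 * (z.2 + z.2)) * q2 - (p2 * (z.1 + z.1) + q2 * (z.2 + z.2)) * q1 by ring.
  by rewrite e1 e2; ring.
have f2 : (p1 * q2 - p2 * q1) * (z.2 + z.2) = 0.
  have -> : (p1 * q2 - p2 * q1) * (z.2 + z.2) =
    (p2 * (z.1 + z.1) + q2 * (z.2 + z.2)) * p1 - (p1 * (z.1 + z.1) + q1 * (z.2 + z.2)) * p2 by ring.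
  by rewrite e1 e2; ring.
move/eqP: f1; move/eqP: f2; rewrite !mulf_eq0 (negPf dn0) /= => /eqP g2 /eqP g1.
by rewrite [z]surjective_pairing; congr pair; lia.
Qed.

Lemma comb_inj h1 h2 : span_isoZ2 h1 h2 -> injective (comb h1 h2).
Proof.
move=> iso z w e; apply/eqP; rewrite -subr_eq0; apply/eqP.
apply: (span_free iso); exists 0.
by rewrite combD combN e subrr.
Qed.

(** Every coordinate is a nonzero linear form on the lattice, because it is
    positive somewhere. *)
Lemma oriented_generic a1 a2 h1 h2 x1 x2 :
  admissible a1 a2 h1 h2 -> oriented h1 h2 x1 x2 -> generic x1 x2.
Proof.
move=> [_ _ iso [s [[u ->] /forallP sp]]] [z [w [-> -> d]]]; rewrite /det2 in d; split.
  move=> m n t.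
  have /(span_free iso)[e1 e2] : in_tors (comb h1 h2 (z.1 * m + w.1 * n, z.2 * m + w.2 * n)).
    by case: t => e t; exists e; rewrite -t /comb /=; A_ring.
  split.
    have -> : m = (z.1 * m + w.1 * n) * w.2 - (z.2 * m + w.2 * n) * w.1.
      by rewrite -[LHS]mulr1 -d; ring.
    by rewrite e1 e2; ring.
  have -> : n = (z.2 * m + w.2 * n) * z.1 - (z.1 * m + w.1 * n) * z.2.
    by rewrite -[LHS]mulr1 -d; ring.
  by rewrite e1 e2; ring.
move=> r; have [z0|/eqP z0] := eqVneq ((comb h1 h2 z).2 r) 0; last by left.
right=> w0; have := sp r; rewrite !comb_coord in z0 w0 *.
have -> : h1.2 r * u.1 + h2.2 r * u.2 = (h1.2 r * z.1 + h2.2 r * z.2) * (u.1 * w.2 - u.2 * w.1)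
  + (h1.2 r * w.1 + h2.2 r * w.2) * (z.1 * u.2 - z.2 * u.1).
  by rewrite -[LHS]mulr1 -d; ring.
by rewrite z0 w0 !mul0r.
Qed.
End Lattice.

(** * Sequences of roots *)
Section Sequences.
Variable P : {fset nat}.
Implicit Types (x y a l : A P) (R Q Z : config P).

Lemma root_at_fun R i Q Q' : root_at R i Q -> root_at R i Q' -> Q = Q'.
Proof.
have H E : (forall Z U V, E Z U -> E Z V -> U = V) ->
    forall n U V, rel_iter E n R U -> rel_iter E n R V -> U = V.
  move=> f; elim=> [|n IH] U V /=; first by move=> -> ->.
  by move=> [Z rZ ZU] [Z' rZ' ZV]; rewrite -(IH _ _ rZ rZ') in ZV; apply: f ZU ZV.
by case: i => n; apply: H => Z U V; [apply: next_root_fun|apply: prev_root_fun].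
Qed.

Lemma root_at_next R i Q Q' : root_at R i Q -> next_root Q Q' -> root_at R (i + 1) Q'.
Proof.
case: i => n /=; first by move=> rQ QQ'; rewrite addn1; exists Q.
move=> [Z rZ /prev_root_next QZ] /(next_root_fun QZ) <-.
rewrite NegzE -addn1 PoszD opprD addrNK; case: n rZ => [|n] rZ //.
Qed.

Lemma root_at_S R n Q : root_at R n.+1%:Z Q ->
  exists2 Z, root_at R n%:Z Z & next_root Z Q.
Proof. by []. Qed.

Lemma root_at_le R m n Q : (m <= n)%N -> root_at R n%:Z Q -> exists Z, root_at R m%:Z Z.
Proof.
elim: n Q => [|n IH] Q; first by rewrite leqn0 => /eqP-> rQ; exists Q.
rewrite leq_eqVlt => /orP[/eqP-> rQ|]; first by exists Q.
by rewrite ltnS => mn /root_at_S[Z rZ _]; apply: IH rZ.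
Qed.

Lemma stabilizes (T : Type) (D : nat -> T) (mu : T -> nat) :
  (forall n, D n.+1 = D n \/ (mu (D n.+1) < mu (D n))%N) ->
  exists N, forall n, (N <= n)%N -> D n = D N.
Proof.
move=> step; have [m] := ubnP (mu (D 0%N)).
suff H : forall k, (mu (D k) < m)%N -> exists N, forall n, (N <= n)%N -> D n = D N by apply: H.
elim: m => // m IH k lt.
have [const|/existsNP[j /not_implyP[kj ne]]] :=
  pselect (forall n, (k <= n)%N -> D n = D k); first by exists k.
have mono n : (mu (D (k + n)%N) <= mu (D k))%N.
  elim: n => [|n]; rewrite ?addn0 // addnS.
  by case: (step (k + n)%N) => [->//|]; lia.
have [n nD] : exists n, D (k + n)%N <> D k by exists (j - k)%N; rewrite subnKC.
have [i [eqi nei]] : exists i, D (k + i)%N = D k /\ D (k + i).+1 <> D k.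
  elim: n nD => [|n IHn]; first by rewrite addn0.
  rewrite addnS => nD; have [e|] := pselect (D (k + n)%N = D k); last exact: IHn.
  by exists n.
apply: (IH (k + i).+1); case: (step (k + i)%N) => [e|]; first by rewrite e in nei.
by rewrite eqi; lia.
Qed.

Section Fixed.
Variables a1 a2 h1 h2 : A P.
Hypothesis adm : admissible a1 a2 h1 h2.

Definition basis_root x1 x2 : Prop :=
  oriented h1 h2 x1 x2 /\ root_ineqs a1 a2 x1 x2.

Lemma basis_rootE x1 x2 : basis_root x1 x2 <->
  oriented h1 h2 x1 x2 /\ ndroot (Config a1 a2 x1 x2).
Proof.
have [[n1 n2] [i1 i2] _ _] := adm.
by split=> -[ori r]; split=> //; apply/(ndrootE n1 n2 i1 i2 (oriented_generic adm ori)).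
Qed.

(** A root with a full-tree son is the last such root of its sequence exactly
    when it is terminal: its right neighbour has vectors x2, k x2 - x1, where only
    x2 >= d can be missing for a full-tree son. *)
Definition terminal x1 x2 : bool :=
  ~~ [&& nneg x2, geA (a1 + x2) a2 & catches_up a1 a2 x1 x2].

Lemma next_basis x1 x2 Q : oriented h1 h2 x1 x2 -> next_root (Config a1 a2 x1 x2) Q ->
  exists y1 y2, Q = Config a1 a2 y1 y2 /\ basis_root y1 y2.
Proof.
move=> o n; have [_ _ nQ] := n; have [_ _ _ [k [_ eQ _]]] := next_rootP n.
exists x2, (x2 *+ k - x1); split=> //; apply/basis_rootE; rewrite -eQ; split=> //.
exact: oriented_next.
Qed.

Lemma root_at_right x1 x2 n Q : basis_root x1 x2 -> root_at (Config a1 a2 x1 x2) n%:Z Q ->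
  exists y1 y2, Q = Config a1 a2 y1 y2 /\ basis_root y1 y2.
Proof.
move=> b; elim: n Q => [|n IH] Q; first by move=> <-; exists x1, x2.
by move=> /root_at_S[Z /IH[y1 [y2 [-> [ori _]]]] /(next_basis ori)].
Qed.

Lemma next_basis_exists x1 x2 : basis_root x1 x2 -> geA (a1 + x1) a2 -> nneg x2 ->
  catches_up a1 a2 x1 x2 -> exists Q, next_root (Config a1 a2 x1 x2) Q.
Proof.
move=> [ori r] p1 p2 cu; have [[n1 n2] [i1 i2] _ _] := adm.
by apply: next_root_exists => //; apply: (oriented_generic adm ori).
Qed.

(** A zero coordinate of y would be zero, or of opposite signs, on the neighbours x
    and k y - x of y in the sequence of vectors. *)
Lemma inner_vector_spos x y Q : nneg x ->
  oriented h1 h2 x y -> next_root (Config a1 a2 x y) Q -> nneg (vec2 Q) -> spos y.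
Proof.
move=> px o n; have [py _ _ [k [_ -> _]]] := next_rootP n => /= pq.
apply/forallP=> r; have [_ nz] := oriented_generic adm o.
have := nz r; at_coord r; nia.
Qed.

(** With D = v_(i+1) - v_i, the root condition says that D < - d at some
    coordinate. A parameter k adds (k - 2) v_i to D, and v_i is strictly positive,
    so only finitely many parameters exceed 2. *)
Lemma infinite_right_stable x1 x2 : basis_root x1 x2 ->
  infinite_right (Config a1 a2 x1 x2) -> exists l, limit_plus (Config a1 a2 x1 x2) l.
Proof.
move=> b inf; set R := Config a1 a2 x1 x2 in inf *.
have [Q HQ] := choice inf.
have nxt n : next_root (Q n) (Q n.+1).
  by have [Z rZ ZQ] := root_at_S (HQ n.+1); rewrite (root_at_fun (HQ n) rZ).
pose D n := vec2 (Q n.+1) - vec1 (Q n.+1).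
pose defect (r : P) x := absz (Num.max 0 (a1.2 r - a2.2 r - x.2 r)).
pose mu x := (\sum_r defect r x)%N.
have [n|N HN] := @stabilizes _ D mu.
  have [y1 [y2 [e1 [ori1 _]]]] := root_at_right b (HQ n.+1).
  have := nxt n.+1; rewrite /D e1 => n1; have [p2 _ _ [k [k2 e2 _]]] := next_rootP n1.
  have [p1 _ _ _] : [/\ nneg y1, True, True & True].
    have [u1 [u2 [e0 _]]] := root_at_right b (HQ n).
    have := nxt n; rewrite e0 e1 => n0; have [q _ _ [k' [_ eq _]]] := next_rootP n0.
    by case: eq => ->.
  have p3 : nneg (vec2 (Q n.+2)).
    have [u1 [u2 [e0 _]]] := root_at_right b (HQ n.+2).
    by have := nxt n.+2; rewrite e0 => n0; have [q _ _ _] := next_rootP n0.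
  have /forallP y2pos := inner_vector_spos p1 ori1 n1 p3.
  have [_ _ [[_ _ rt] _]] := n1; move: rt; rewrite e2 /end1 /end2 /= => /ngeP[r0 lt0].
  have [k22|k3] := eqVneq k 2; first by left; rewrite k22; A_ring.
  right; have k3' : (3 <= k)%N by lia.
  rewrite /mu (bigD1 r0) //= [X in (_ < X)%N](bigD1 r0) //=.
  rewrite -addSn; apply: leq_add; last first.
    apply: leq_sum => r _; rewrite /defect; coords; have := y2pos r; nia.
  by move: lt0; rewrite /defect; coords; have := y2pos r0; nia.
exists (D N); left; split=> //; exists N.+1%:Z => -[[|i]|i] Z // iN rZ.
rewrite -(HN i) // /D -(root_at_fun (HQ i.+1) rZ) //.
Qed.
End Fixed.
End Sequences.

(** * Limits of sequences of roots *)
Section Limits.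
Variable P : {fset nat}.
Implicit Types (x y a l : A P) (R Q Z : config P).

Lemma admissible_swap a1 a2 h1 h2 : admissible a1 a2 h1 h2 -> admissible a2 a1 h2 h1.
Proof.
have sp x : in_span h1 h2 x -> in_span h2 h1 x.
  by move=> [[z1 z2] ->]; exists (z2, z1); rewrite /comb /= addrC.
have sp' x : in_span h2 h1 x -> in_span h1 h2 x.
  by move=> [[z1 z2] ->]; exists (z2, z1); rewrite /comb /= addrC.
move=> [[n1 n2] [i1 i2] [phi [inj im]] [s [ss pos]]]; split.
- by split; [exact: n2|exact: n1].
- by split; [exact: i2|exact: i1].
- exists phi; split; first exact: inj.
  by move=> x; split=> [/sp'/im|/im/sp].
- by exists s; split; [exact: sp|exact: pos].
Qed.

Section Fixed.
Variables a1 a2 h1 h2 : A P.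
Hypothesis adm : admissible a1 a2 h1 h2.
Local Notation basis_root := (basis_root a1 a2 h1 h2).
Local Notation terminal := (terminal a1 a2).
Local Notation conf := (Config a1 a2).

Lemma limit_plus_at R i x1 x2 l : ~ infinite_right R -> root_at R i (conf x1 x2) ->
  selects a1 a2 x1 x2 l ->
  (forall j Q, root_at R j Q -> has_ft_son Q -> j <= i) -> limit_plus R l.
Proof.
move=> ninf rQ sel mx; have ft := selects_has_ft sel.
have [s [C [ex it <-]]] := sel; right; split=> //.
by exists i, (conf x1 x2), s, C; split.
Qed.

(** If the last root has no full-tree son, the one before it does. *)
Lemma limit_plus_exists x1 x2 : basis_root x1 x2 -> has_ft_son (conf x1 x2) ->
  exists l, limit_plus (conf x1 x2) l.
Proof.
move=> b ft; have [inf|ninf] := pselect (infinite_right (conf x1 x2)).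
  exact: (infinite_right_stable adm b inf).
set R := conf x1 x2 in ft ninf *.
have [m [[Z rZ] last]] : exists m : nat,
    (exists Z, root_at R m%:Z Z) /\ ~ (exists Z, root_at R m.+1%:Z Z).
  apply: contra_notP ninf => H; elim=> [|n IH]; first by exists R.
  by apply: contra_notP H => H; exists n.
have bound j Q : root_at R j Q -> j <= m%:Z.
  case: j => [n|//] rQ; rewrite lez_nat leqNgt; apply/negP=> lt.
  exact: last (root_at_le lt rQ).
have sel i y1 y2 : root_at R i (conf y1 y2) -> has_ft_son (conf y1 y2) ->
    (forall j Q, root_at R j Q -> has_ft_son Q -> j <= i) -> exists l, limit_plus R l.
  move=> ri /has_ft_word_coef[c [d /word_coef_selects s]] mx.
  by eexists; apply: limit_plus_at ri s mx.
have [y1 [y2 [eZ bZ]]] := root_at_right adm b rZ.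
have [fZ|nfZ] := pselect (has_ft_son Z).
  rewrite eZ in rZ fZ; apply: sel rZ fZ _ => j Q /bound //.
case: m rZ last bound => [|m] rZ last bound; first by case: nfZ; rewrite -rZ.
have [Y rY YZ] := root_at_S rZ; have [u1 [u2 [eY bY]]] := root_at_right adm b rY.
have fY : has_ft_son Y.
  case: m rY {rZ last bound} => [<- //|m] /root_at_S[X _ XY].
  by exists [::]; apply/ft_word_nil; apply: inner_full XY YZ.
rewrite eY in rY fY; apply: (sel _ _ _ rY fY) => j Q rQ fQ.
have := bound _ _ rQ; rewrite le_eqVlt => /orP[/eqP e|].
  by case: nfZ; rewrite (root_at_fun rZ (Q' := Q)) // -e.
by clear; lia.
Qed.

(** The right neighbour of a terminal root, if it exists, has no full-tree son
    and is the last root of the sequence. *)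
Lemma limit_plus_terminal x1 x2 l : basis_root x1 x2 -> terminal x1 x2 ->
  selects a1 a2 x1 x2 l -> limit_plus (conf x1 x2) l.
Proof.
move=> b term sel; set R := conf x1 x2.
have nd Q : next_root R Q -> ~~ geA (end1 Q) (pt2 Q).
  move=> RQ; have [p2 _ cu [k [_ -> _]]] := next_rootP RQ; rewrite /end1 /=.
  by apply: contra term => d; rewrite p2 d cu.
have two Q : ~ root_at R 2%:Z Q.
  move=> /root_at_S[Z /root_at_S[Y <- RZ] ZQ]; have := nd _ RZ.
  have [_ _ _ [k [_ eZ _]]] := next_rootP RZ; rewrite eZ /end1 /= in ZQ *.
  by have [_ -> _ _] := next_rootP ZQ.
apply: (@limit_plus_at _ 0 _ _ _ _ erefl sel).
  by move=> /(_ 2) [Q /two].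
case=> [[|[|n]]|n] Q //.
  move=> /root_at_S[Y <- RQ] [s ft]; case: (no_ft_word1 (nd _ RQ) ft).
by move=> rQ; have [|Z /two //] := root_at_le (m := 2) _ rQ.
Qed.

(** The roots of vectors y + i l, y + (i + 1) l, each followed by the next with
    parameter 2. *)
Definition stationary y l : bool :=
  [&& geA (a1 + y) a2, geA (a2 + y) a1, nneg l & ~~ geA (a2 + l) a1].

Lemma stationary_root y l : oriented h1 h2 y l -> stationary y l -> basis_root y (y + l).
Proof.
have [_ [i1 i2] _ _] := adm.
move=> ori /and4P[p1 p2 p3 n4]; split; first by rewrite addrC; apply: oriented_addr.
apply/and5P; split; rewrite ?p1 ?orbT //.
- by apply/orP; left; ord_lia.
- by apply/negP=> H; case/negP: i1; ord_lia.
- by apply: contra n4 => H; ord_lia.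
Qed.

Lemma stationary_next y l : oriented h1 h2 y l -> stationary y l ->
  next_root (conf y (y + l)) (conf (y + l) (y + l + l)).
Proof.
move=> ori st; have [_ [i1 i2] _ _] := adm; have /and4P[p1 p2 p3 n4] := st.
have ori' : oriented h1 h2 (y + l) l by apply: oriented_addl.
have st' : stationary (y + l) l by apply/and4P; split=> //; by ord_lia.
have [_ n1] := (proj1 (basis_rootE adm _ _)) (stationary_root ori st).
have [_ n2] := (proj1 (basis_rootE adm _ _)) (stationary_root ori' st').
split=> //; exists 2%N; split.
  split; rewrite /end1 /end2 /=; [by ord_lia|by []|by ord_lia|].
  by congr Config; A_ring.
case=> [|[|//]] C' [_ _ c3 _]; rewrite /end1 /end2 /= in c3.
  by case/negP: i2; ord_lia.
by case/negP: n4; ord_lia.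
Qed.

Lemma stationary_limit y l : oriented h1 h2 y l -> stationary y l ->
  limit_plus (conf y (y + l)) l.
Proof.
move=> ori st; have seq n : root_at (conf y (y + l)) n%:Z (conf (y + l *+ n) (y + l *+ n + l)).
  elim: n => [|n IH]; first by rewrite /= addr0.
  exists (conf (y + l *+ n) (y + l *+ n + l)) => //.
  rewrite mulrSr addrA; apply: stationary_next; first exact: oriented_addln.
  have /and4P[p1 p2 p3 n4] := st; apply/and4P; split=> //; apply/geP=> r; at_coord r; nia.
left; split; first by move=> n; exists (conf (y + l *+ n) (y + l *+ n + l)).
exists 0; case=> [n|//] Q _ rQ; rewrite (root_at_fun rQ (seq n)) /=.
by rewrite addrC addKr.
Qed.

(** The vectors y + i l are nonnegative for all i, hence so is l, and the condition
    of a root gives the strict inequality. *)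
Lemma infinite_stationary x1 x2 l : basis_root x1 x2 ->
  infinite_right (conf x1 x2) ->
  (exists N : int, forall i Q, N <= i -> root_at (conf x1 x2) i Q -> l = vec2 Q - vec1 Q) ->
  exists2 y, oriented h1 h2 y l & stationary y l.
Proof.
move=> b inf [N HN]; set R := conf x1 x2 in inf HN.
have [Q HQ] := choice inf.
have nxt n : next_root (Q n) (Q n.+1).
  by have [Z rZ ZQ] := root_at_S (HQ n.+1); rewrite (root_at_fun (HQ n) rZ).
pose n := (absz N).+1; pose v := vec1 (Q n).
have eQ k : Q (n + k)%N = conf (v + l *+ k) (v + l *+ k.+1).
  have gen m : exists y, Q (n + m)%N = conf y (y + l).
    have [y1 [y2 [e _]]] := root_at_right adm b (HQ (n + m)%N).
    exists y1; rewrite e; congr Config.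
    have Nn : N <= (n + m)%N%:Z by rewrite /n; clear; lia.
    by have := HN _ _ Nn (HQ _); rewrite e /= => ->; rewrite addrC subrK.
  elim: k => [|k IH].
    by have [y e] := gen 0%N; rewrite addr0 mulr1n e /v; rewrite addn0 in e; rewrite e.
  have [y e] := gen k.+1; have := nxt (n + k)%N; rewrite IH -addnS e => nk.
  have [_ _ _ [k' [_ [-> _] _]]] := next_rootP nk.
  by move=> _; rewrite (mulrSr l k.+1) addrA.
have pos k : nneg (v + l *+ k.+1).
  by have := nxt (n + k)%N; rewrite eQ => nk; have [] := next_rootP nk.
have l0 : nneg l.
  apply/nnegP=> r; rewrite leNgt; apply/negP=> lt.
  have /nnegP/(_ r) := pos (absz (v.2 r)).+1; coords; nia.
have E0 : Q n = conf (v + l *+ 0) (v + l *+ 1) by have := eQ 0%N; rewrite addn0.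
have E1 : Q n.+1 = conf (v + l *+ 1) (v + l *+ 2) by have := eQ 1%N; rewrite addn1.
have n0 := nxt n; rewrite E0 E1 in n0.
have [_ _ _ [k [_ e q2]]] := next_rootP n0.
have {e} e1 : v + l *+ 2 = (v + l *+ 1) *+ k - (v + l *+ 0) := congr1 (@vec2 P) e.
rewrite -e1 in q2.
exists (v + l *+ 2).
  have [y1 [y2 [e [ori _]]]] := root_at_right adm b (HQ (n + 2)%N).
  move: e; rewrite eQ => -[e3 e4]; rewrite -e3 -e4 in ori.
  have el : v + l *+ 3 - (v + l *+ 2) = l by A_ring.
  by rewrite -{2}el; apply: oriented_subr.
have [_ p1 _ _] : [/\ nneg (v + l *+ 3), geA (a1 + (v + l *+ 2)) a2, True & True].
  by have := nxt (n + 2)%N; rewrite eQ => nk; have [? ? _ _] := next_rootP nk.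
have [_ _ [[_ _ rt] _]] := n0; rewrite /end1 /end2 /= in rt.
apply/and4P; split=> //; apply: contra rt => H; ord_lia.
Qed.
End Fixed.
End Limits.

(** * Limit directions without sequences *)
Section Characterization.
Variable P : {fset nat}.
Implicit Types (x y a l : A P) (R Q Z : config P).

Definition same_coord x y : bool := [forall r, x.2 r == y.2 r].

Lemma same_coordP x y : reflect (forall r, x.2 r = y.2 r) (same_coord x y).
Proof. by apply: (iffP forallP) => H r; apply/eqP; apply: H. Qed.

Section Fixed.
Variables a1 a2 h1 h2 : A P.
Hypothesis adm : admissible a1 a2 h1 h2.
Local Notation basis_root := (basis_root a1 a2 h1 h2).
Local Notation terminal := (terminal a1 a2).
Local Notation conf := (Config a1 a2).

(** When the first edge ends at the second minimal point, x1 has the direction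
    d = a2 - a1, and the twin has vectors x2 + lam x1 and - x1, for the first
    lam such that the former is not nonnegative. *)
Lemma meeting_twin x1 x2 : basis_root x1 x2 -> same_coord (a1 + x1) a2 ->
  exists Q, twin (conf x1 x2) Q.
Proof.
move=> b /same_coordP meet; have [ori rt] := b; have [[n1 n2] [i1 i2] _ _] := adm.
have {}meet r : x1.2 r = a2.2 r - a1.2 r by have := meet r; coords; lia.
have /and5P[_ c2 _ _ r2] := rt.
have q2 : ~~ nneg x2 by apply: contra r2 => q2; apply/geP=> r; have := meet r; at_coord r; lia.
have p2 : geA (a2 + x2) a1 by move: c2; rewrite (negPf q2).
have [r0 d0] := ngeP i2.
pose S k := nneg (x2 + x1 *+ k.+1).
have [k Sk nSk] : exists2 k, S k & ~~ S k.+1.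
  apply: (@nat_switch S (absz (x2.2 r0)).+1).
    by apply/nnegP=> r; have := meet r; at_coord r; lia.
  by apply/negP=> /nnegP/(_ r0); coords; have := meet r0; nia.
rewrite /S in Sk nSk; pose y := x2 + x1 *+ k.+2.
exists (conf y (- x1)).
have oriQ : oriented h1 h2 y (- x1) by apply: oriented_unrot; apply: oriented_addrn.
have rQ : root_ineqs a1 a2 y (- x1).
  have c1 : geA (a1 + y) a2 by apply/geP=> r; have := meet r; rewrite /y; at_coord r; nia.
  have c2' : geA (a2 - x1) a1 by apply/geP=> r; have := meet r; at_coord r; lia.
  apply/and5P; split; rewrite ?c1 ?c2' ?orbT //.
    apply: contra nSk => H; apply/nnegP=> r; have := meet r; rewrite -/y; at_coord r; lia.
  apply/negP=> H; have [r1 d1] := ngeP i1.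
  by have := meet r1; rewrite /y in H; at_coord r1; nia.
split.
- split; first exact: (proj2 (proj1 (basis_rootE adm _ _) b)).
  exact: (proj2 (proj1 (basis_rootE adm _ _) (conj oriQ rQ))).
- by split; reflexivity.
exists (torsion x1 - torsion a2 + torsion a1), k.+2%:Z; rewrite /end1 /end2 /=.
split; [split|by split|by []|].
- apply: eq_add_tors; first by torsions; ring.
  by move=> r; coords; rewrite meet; ring.
- apply: eq_add_tors; last by move=> r; coords; rewrite meet; ring.
  torsions; move: (torsion a1) (torsion x1) (torsion a2) => t u v.
  transitivity (t + t - (u - v)); first by rewrite Z2_addrr; ring.
  by rewrite Z2_opp; ring.
rewrite /y; apply: A_ext; first by torsions; ring.
by move=> r; coords; rewrite meet; ring.
Qed.

Lemma twin_meeting R Q : twin R Q -> same_coord (pt1 R + vec1 R) (pt2 R).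
Proof.
move=> [_ _ [e [lam [[f1 _] _ _ _]]]]; apply/same_coordP=> r.
rewrite /end1 in f1; rewrite f1 coordD coord_tors; lia.
Qed.

(** The roots of a twin pair have no nonnegative vector, so they are alone in their
    sequences, and being twin is a property of the sequence. *)
Lemma meeting_isolated x1 x2 R i : basis_root x1 x2 -> same_coord (a1 + x1) a2 ->
  root_at R i (conf x1 x2) -> R = conf x1 x2.
Proof.
move=> [ori rt] /same_coordP meet; have [[n1 n2] [i1 i2] _ _] := adm.
have {}meet r : x1.2 r = a2.2 r - a1.2 r by have := meet r; coords; lia.
case: i => [[|n]|n] //.
  move=> /root_at_S[Z _ ZR]; have [_ [k [[c1 _ _ _] _]] _] := next_root_prev ZR.
  by case/negP: i2; apply/geP=> r; have := meet r; rewrite /= in c1; at_coord r; lia.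
move=> /= [Z _ /prev_root_next ZR]; have [c2 _ _ _] := next_rootP ZR.
by case/and5P: rt => _ _ _ _ /negP[]; apply/geP=> r; have := meet r; at_coord r; lia.
Qed.
End Fixed.

Lemma root_ineqs_swap a1 a2 x1 x2 : root_ineqs a1 a2 x1 x2 -> root_ineqs a2 a1 x2 x1.
Proof.
move=> /and5P[c1 c2 nd r1 r2]; apply/and5P; split; [exact: c2|exact: c1| |exact: r2|exact: r1].
by rewrite orbC.
Qed.

Lemma basis_root_swap a1 a2 h1 h2 x1 x2 :
  basis_root a1 a2 h1 h2 x1 x2 -> basis_root a2 a1 h2 h1 x2 x1.
Proof. by move=> [ori rt]; split; [exact: oriented_swap|exact: root_ineqs_swap]. Qed.

(** An edge that ends at the other minimal point, up to torsion, is what gives a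
    root a twin. *)
Definition no_meeting a1 a2 x1 x2 : bool :=
  ~~ same_coord (a1 + x1) a2 && ~~ same_coord (a2 + x2) a1.

Lemma non_twinE a1 a2 h1 h2 x1 x2 : admissible a1 a2 h1 h2 ->
  basis_root a1 a2 h1 h2 x1 x2 ->
  non_twin (Config a1 a2 x1 x2) <-> no_meeting a1 a2 x1 x2.
Proof.
move=> adm b; split.
  move=> nt; apply/andP; split; apply/negP=> m; apply: nt.
    by have [Q t] := meeting_twin adm b m; exists Q; left.
  have [Q t] := meeting_twin (admissible_swap adm) (basis_root_swap b) m.
  by exists (swap Q); right; have := twin_swap t.
move=> /andP[/negP m1 /negP m2] [Q [/twin_meeting//|/twin_swap/twin_meeting]]; exact: m2.
Qed.

Lemma limit_minus_exists a1 a2 h1 h2 x1 x2 : admissible a1 a2 h1 h2 ->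
  basis_root a1 a2 h1 h2 x1 x2 -> has_ft_son (Config a1 a2 x1 x2) ->
  exists l, limit_minus (Config a1 a2 x1 x2) l.
Proof.
move=> adm b /has_ft_son_swap ft.
have [l lim] := limit_plus_exists (admissible_swap adm) (basis_root_swap b) ft.
by exists l; apply/limit_swap.
Qed.

Section Fixed2.
Variables a1 a2 h1 h2 : A P.
Hypothesis adm : admissible a1 a2 h1 h2.
Local Notation basis_root := (basis_root a1 a2 h1 h2).
Local Notation conf := (Config a1 a2).

(** The first kind comes from sequences that are infinite on the right, the second
    from the last root with a full-tree son. *)
Definition right_limit l : Prop :=
  (exists2 y, oriented h1 h2 y l & stationary a1 a2 y l) \/
  (exists x1 x2 i j, [/\ basis_root x1 x2, terminal a1 a2 x1 x2, no_meeting a1 a2 x1 x2,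
     word_coef a1 a2 x1 x2 i j & l = x1 *~ i + x2 *~ j]).

Lemma right_limit_realized l : right_limit l ->
  exists x1 x2, [/\ basis_root x1 x2, non_twin (conf x1 x2),
    limit_plus (conf x1 x2) l & exists lm, limit_minus (conf x1 x2) lm].
Proof.
have [_ [i1 i2] _ _] := adm.
case=> [[y ori st]|[x1 [x2 [i [j [b term nm wc ->]]]]]].
  have b := stationary_root adm ori st; have /and4P[p1 p2 p3 n4] := st.
  exists y, (y + l); split=> //.
  - apply/(non_twinE adm b)/andP; split; apply/negP=> /same_coordP m.
      by case/negP: i2; apply/geP=> r; have := m r; at_coord r; lia.
    by case/negP: i1; apply/geP=> r; have := m r; at_coord r; lia.
  - exact: (stationary_limit adm ori st).
  - apply: (limit_minus_exists adm b); exists [::]; apply/ft_word_nil.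
    by rewrite full_treeE p1; apply/and4P; split=> //; ord_lia.
have sel := word_coef_selects wc; exists x1, x2; split=> //.
- exact/(non_twinE adm b).
- exact: (limit_plus_terminal b term sel).
- exact: (limit_minus_exists adm b (selects_has_ft sel)).
Qed.

Lemma root_at_basis x1 x2 i Q : basis_root x1 x2 -> root_at (conf x1 x2) i Q ->
  exists y1 y2, Q = conf y1 y2 /\ basis_root y1 y2.
Proof.
case: i => [n|n] b rQ; first exact: (root_at_right adm b rQ).
have r' : root_at (Config a2 a1 x2 x1) n.+1%:Z (swap Q).
  by have := proj1 (root_at_swap _ _ _) rQ; rewrite NegzE opprK.
have [y1 [y2 [e b']]] := root_at_right (admissible_swap adm) (basis_root_swap b) r'.
exists y2, y1; split; last exact: basis_root_swap.
by rewrite -[Q]swapK e.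
Qed.

Lemma limit_plus_right_limit x1 x2 l : basis_root x1 x2 -> non_twin (conf x1 x2) ->
  limit_plus (conf x1 x2) l -> right_limit l.
Proof.
move=> b nt [[inf st]|[_ [i [Q [s [C [[rQ ft] mx ex it ->]]]]]]].
  by left; apply: (infinite_stationary adm b inf st).
have [y1 [y2 [eQ bQ]]] := root_at_basis b rQ; rewrite eQ in rQ ft ex it.
have [c [d wc]] := has_ft_word_coef ft; have [s' [C' [ex' it' e']]] := word_coef_selects wc.
right; exists y1, y2, c, d; split=> //.
- apply/negP=> /and3P[p2 p1' cu]; have /and3P[p1 _ _] := wc.
  have [Z nZ] := next_basis_exists adm bQ p1 p2 cu.
  have := mx (i + 1) Z (root_at_next rQ nZ).
  suff fZ : has_ft_son Z by move=> /(_ fZ); clear; lia.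
  have [_ _ _ [k [_ eZ q2]]] := next_rootP nZ; move: eZ q2; set z := (y2 *+ k - y1) => eZ q2.
  have [i' [j' wc']] : exists i' j', word_coef a1 a2 y2 z i' j'.
    by rewrite /word_coef p1' q2 p2 /=; exists (~~ nneg z : nat)%:Z, 1; rewrite !eqxx.
  by rewrite eZ; apply: selects_has_ft (word_coef_selects wc').
- have /andP[/negP m1 /negP m2] := proj1 (non_twinE adm b) nt.
  apply/andP; split; apply/negP=> m.
    by have [e _] := meeting_isolated adm bQ m rQ; case: m1; rewrite e.
  have r' := proj1 (root_at_swap _ _ _) rQ.
  have [e _] := meeting_isolated (admissible_swap adm) (basis_root_swap bQ) m r'.
  by case: m2; rewrite e.
- by rewrite -e' -(extremal_uniq ex ex') it in it' *; case: it' => ->.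
Qed.
End Fixed2.
End Characterization.

Section LimitDirections.
Variable P : {fset nat}.
Implicit Types (x y a l : A P).

Lemma right_limit_in_span a1 a2 h1 h2 l : right_limit a1 a2 h1 h2 l -> in_span h1 h2 l.
Proof.
case=> [[y [z [w [_ -> _]]] _]|[x1 [x2 [i [j [[ori _] _ _ _ ->]]]]]]; first by exists w.
exact: oriented_in_span.
Qed.

Lemma in_span_swap h1 h2 l : in_span h1 h2 l -> in_span h2 h1 l.
Proof. by move=> [[z1 z2] ->]; exists (z2, z1); rewrite /comb /= addrC. Qed.

Lemma limit_directionE a1 a2 h1 h2 l : admissible a1 a2 h1 h2 ->
  limit_direction a1 a2 h1 h2 l <->
  right_limit a1 a2 h1 h2 l \/ right_limit a2 a1 h2 h1 l.
Proof.
move=> adm; have adm' := admissible_swap adm; split.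
  move=> [_ [x1 [x2 [nd nt /nielsen_oriented ori [lm [lp [Hm Hp e]]]]]]].
  have b := proj2 (basis_rootE adm _ _) (conj ori nd).
  case: e => ->; first by left; apply: (limit_plus_right_limit adm b nt Hp).
  right; apply: (limit_plus_right_limit adm' (basis_root_swap b)).
    exact: (proj1 (non_twin_swap _) nt).
  exact: (proj1 (limit_swap _ _) Hm).
case=> rl.
  have [x1 [x2 [b nt lp [lm lmP]]]] := right_limit_realized adm rl.
  split; first exact: right_limit_in_span rl.
  have [ori nd] := proj1 (basis_rootE adm _ _) b.
  exists x1, x2; split; [exact: nd|exact: nt|exact: oriented_nielsen|].
  by exists lm, l; split=> //; left.
have [x1 [x2 [b nt lp [lm lmP]]]] := right_limit_realized adm' rl.
split; first by apply: in_span_swap; apply: right_limit_in_span rl.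
have b' := basis_root_swap b; have [ori nd] := proj1 (basis_rootE adm _ _) b'.
exists x2, x1; split; [exact: nd| |exact: oriented_nielsen|].
  exact: (proj1 (non_twin_swap _) nt).
exists l, lm; split; last by right.
  exact: (proj2 (limit_swap (Config a1 a2 x2 x1) l) lp).
exact: (proj1 (limit_swap _ _) lmP).
Qed.
End LimitDirections.

(** * Certificates for limit directions *)
Section Certificates.
Variable P : {fset nat}.
Implicit Types (x y a h l v : A P) (z w u V : int * int).

(** A certificate stands for the progression of base i x1 + j x2 and step c v, for
    the lattice vectors x1, x2, v with coordinates z, w, V. *)
Record certificate := Certificate {
  cert_z : int * int; cert_w : int * int; cert_V : int * int;
  cert_c : int; cert_i : int; cert_j : int }.

(** Either x2 is a limit direction of the first kind and the progression consists
    of its images under the shears x |-> x + n x_r v, or the base is a limit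
    direction of the second kind and the step is 0. *)
Definition sound a1 a2 h1 h2 (k : certificate) : bool :=
  let: Certificate z w V c i j := k in
  let x1 := comb h1 h2 z in let x2 := comb h1 h2 w in let v := comb h1 h2 V in
  (det2 z w == 1) &&
  ([&& stationary a1 a2 x1 x2, i == 0, j == 1, nneg v &
      [exists r, [&& x2.2 r == c, c + a2.2 r < a1.2 r & v.2 r == 0]]]
   || [&& c == 0, root_ineqs a1 a2 x1 x2, terminal a1 a2 x1 x2,
         no_meeting a1 a2 x1 x2 & word_coef a1 a2 x1 x2 i j]).

Definition cert_base h1 h2 (k : certificate) : A P :=
  comb h1 h2 (cert_z k) *~ cert_i k + comb h1 h2 (cert_w k) *~ cert_j k.
Definition cert_step h1 h2 (k : certificate) : A P :=
  comb h1 h2 (cert_V k) *~ cert_c k.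

(** The shears preserve all inequalities, because v >= 0 and the coordinate r,
    which is the witness of the strict one, does not change on x2. *)
Lemma sound_right_limit a1 a2 h1 h2 k (n : nat) : sound a1 a2 h1 h2 k ->
  right_limit a1 a2 h1 h2 (cert_base h1 h2 k + cert_step h1 h2 k *+ n).
Proof.
case: k => z w V c i j; rewrite /sound /cert_base /cert_step /=.
set x1 := comb h1 h2 z; set x2 := comb h1 h2 w; set v := comb h1 h2 V.
case/andP=> /eqP d /orP[/and5P[st /eqP-> /eqP-> v0 /existsP[r /and3P[/eqP xc cl /eqP vr]]]|].
  left; exists (x1 + v *~ (n%:Z * x1.2 r)).
    exists (z.1 + V.1 * (n%:Z * x1.2 r), z.2 + V.2 * (n%:Z * x1.2 r)).
    exists (w.1 + V.1 * (n%:Z * c), w.2 + V.2 * (n%:Z * c)); split.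
    - by rewrite /x1 /v /comb /=; A_ring.
    - by rewrite /x2 /v /comb /=; A_ring.
    by rewrite -[RHS]d -xc; exact: shear_det vr.
  have /and4P[p1 p2 p3 n4] := st.
  have x1r : 0 <= x1.2 r by move: (geP _ _ p1 r) (geP _ _ p2 r); coords; clear; lia.
  apply/and4P; split.
  - by apply/geP=> s; move: (geP _ _ p1 s) (nnegP _ v0 s); coords; clear - x1r; nia.
  - by apply/geP=> s; move: (geP _ _ p2 s) (nnegP _ v0 s); coords; clear - x1r; nia.
  - have c0 : 0 <= c by rewrite -xc; exact: (nnegP _ p3 r).
    by apply/nnegP=> s; move: (nnegP _ p3 s) (nnegP _ v0 s); coords; clear - c0; nia.
  - apply/negP=> /geP/(_ r); coords; rewrite vr xc; clear - cl; lia.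
case/and5P=> /eqP-> rt tm nm wc; right; exists x1, x2, i, j; split=> //.
  by split=> //; exists z, w.
by A_ring.
Qed.

Lemma right_limit_cert a1 a2 h1 h2 l : right_limit a1 a2 h1 h2 l ->
  (exists z w, [/\ det2 z w = 1, l = comb h1 h2 w & stationary a1 a2 (comb h1 h2 z) l]) \/
  (exists z w i j, sound a1 a2 h1 h2 (Certificate z w 0 0 i j) /\
    [/\ det2 z w = 1, root_ineqs a1 a2 (comb h1 h2 z) (comb h1 h2 w),
      terminal a1 a2 (comb h1 h2 z) (comb h1 h2 w),
      word_coef a1 a2 (comb h1 h2 z) (comb h1 h2 w) i j
     & l = comb h1 h2 z *~ i + comb h1 h2 w *~ j]).
Proof.
case=> [[y [z [w [ey el d]]] st]|[x1 [x2 [i [j [[[z [w [e1 e2 d]]] rt] tm nm wc ->]]]]]].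
  by left; exists z, w; split=> //; rewrite -ey.
right; exists z, w, i, j; rewrite /sound d -e1 -e2 rt tm nm wc eqxx /= orbT.
by split.
Qed.
End Certificates.

(** * Bounds *)
Section Magnitude.
Variable S : nat.
Hypothesis S2 : (2 <= S)%N.
Implicit Types (x y : int) (n m : nat).

(** Sizes are tracked as powers of one number that bounds the input. The estimates
    are crude: only the existence of a final exponent matters. *)
Definition magn n x : bool := (absz x <= S ^ n)%N.

Lemma magnW n m x : (n <= m)%N -> magn n x -> magn m x.
Proof. by move=> nm h; apply: leq_trans h _; rewrite leq_exp2l. Qed.

Lemma magn_le n x y : (absz x <= absz y)%N -> magn n y -> magn n x.
Proof. exact: leq_trans. Qed.

Lemma magnM n m x y : magn n x -> magn m y -> magn (n + m) (x * y).
Proof. by move=> hx hy; rewrite /magn abszM expnD leq_mul. Qed.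

Lemma magnD n x y : magn n x -> magn n y -> magn n.+1 (x + y).
Proof.
rewrite /magn => hx hy; apply: leq_trans (_ : 2 * S ^ n <= _)%N; last first.
  by rewrite expnS leq_mul2r S2 orbT.
by lia.
Qed.

Lemma magnN n x : magn n x -> magn n (- x).
Proof. by rewrite /magn abszN. Qed.

Lemma magnB n x y : magn n x -> magn n y -> magn n.+1 (x - y).
Proof. by move=> hx hy; apply: magnD => //; apply: magnN. Qed.

Lemma magn_factor n x y : y != 0 -> magn n (x * y) -> magn n x.
Proof. by move=> y0; apply: magn_le; rewrite abszM leq_pmulr // absz_gt0. Qed.

Lemma magn0 n : magn n 0. Proof. by []. Qed.

Lemma magn1 n : magn n 1.
Proof. by rewrite /magn expn_gt0 (ltnW S2). Qed.

Lemma magn2 n : magn n.+1 2.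
Proof. by rewrite /magn expnS; apply: leq_trans S2 _; rewrite leq_pmulr // expn_gt0 (ltnW S2). Qed.
End Magnitude.

Section Boxes.
Variable P : {fset nat}.
Implicit Types (x y a h l v : A P) (z w u V : int * int).

Definition size_input a1 a2 h1 h2 : nat :=
  (2 + \sum_(r : P) (absz (h1.2 r) + absz (h2.2 r) + absz (a2.2 r - a1.2 r)%R))%N.

Definition small B (k : certificate) : bool :=
  all (fun x : int => absz x <= B)%N
    [:: (cert_z k).1; (cert_z k).2; (cert_w k).1; (cert_w k).2;
        (cert_V k).1; (cert_V k).2; cert_c k; cert_i k; cert_j k].

Lemma small_intro B z w V c i j :
  (absz z.1 <= B)%N -> (absz z.2 <= B)%N -> (absz w.1 <= B)%N -> (absz w.2 <= B)%N ->
  (absz V.1 <= B)%N -> (absz V.2 <= B)%N -> (absz c <= B)%N -> (absz i <= B)%N ->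
  (absz j <= B)%N -> small B (Certificate z w V c i j).
Proof. by rewrite /small /= => -> -> -> -> -> -> -> -> ->. Qed.

Section Fixed.
Variables a1 a2 h1 h2 : A P.
Hypothesis adm : admissible a1 a2 h1 h2.
Local Notation S := (size_input a1 a2 h1 h2).
Local Notation mag := (magn S).
Local Notation cmb := (comb h1 h2).

Lemma size_input2 : (2 <= S)%N. Proof. by []. Qed.
Let S2 := size_input2.

Lemma size_input_magn r :
  [/\ mag 1 (h1.2 r), mag 1 (h2.2 r) & mag 1 (a2.2 r - a1.2 r)].
Proof.
rewrite /magn expn1 /size_input (bigD1 r) //=.
by set T := (\sum_(_ | _) _)%N; split; clear; lia.
Qed.

(** The determinant of the r-th and s-th coordinate forms. *)
Definition omega r s : int := h1.2 r * h2.2 s - h2.2 r * h1.2 s.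

Lemma magn_omega r s : mag 3 (omega r s).
Proof.
have [r1 r2 _] := size_input_magn r; have [s1 s2 _] := size_input_magn s.
exact: (magnB S2 (magnM r1 s2) (magnM r2 s1)).
Qed.

(** A pair of coordinates of a basis is tied by a constant. When the order
    conditions give the two products opposite signs, or bound one of them, they
    bound all four factors. *)
Lemma cross r s z w : (cmb z).2 r * (cmb w).2 s - (cmb z).2 s * (cmb w).2 r =
  omega r s * det2 z w.
Proof. by rewrite !comb_coord /omega /det2; ring. Qed.

Lemma positive_point : exists u, forall r, 0 < (cmb u).2 r.
Proof. by have [_ _ _ [x [[u ->] /forallP sp]]] := adm; exists u. Qed.

Lemma omega_neq0 r s z : (cmb z).2 r <= 0 -> 0 < (cmb z).2 s -> omega r s != 0.
Proof.
have [u up] := positive_point => zr zs; apply: contraTneq isT => o0.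
by have := cross r s z u; rewrite o0 mul0r; have := up r; have := up s; nia.
Qed.

Lemma omegaC r s : omega s r = - omega r s.
Proof. by rewrite /omega; ring. Qed.

Lemma omega_exists r : exists s, omega r s != 0.
Proof.
apply: contrapT => /forallNP o0; have [_ _ iso _] := adm.
have o s : omega r s = 0 by apply/eqP; apply: contra_notT (o0 s).
have /(span_free iso)[e2 e1] : in_tors (cmb (- h2.2 r, h1.2 r)).
  exists (torsion (cmb (- h2.2 r, h1.2 r))); apply: A_ext; first by [].
  by move=> s; rewrite coord_tors comb_coord -(o s) /omega /=; ring.
have h20 : h2.2 r = 0 by move: e2; clear; lia.
by have [u /(_ r)] := positive_point; rewrite comb_coord e1 h20 !mul0r.
Qed.

(** Two independent coordinates control a lattice point, by Cramer's rule. *)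
Lemma magn_pair r s z n : omega r s != 0 ->
  mag n ((cmb z).2 r) -> mag n ((cmb z).2 s) -> mag n.+2 z.1 /\ mag n.+2 z.2.
Proof.
move=> o0 mr ms; have [r1 r2 _] := size_input_magn r; have [s1 s2 _] := size_input_magn s.
have c1 : omega r s * z.1 = h2.2 s * (cmb z).2 r - h2.2 r * (cmb z).2 s.
  by rewrite !comb_coord /omega; ring.
have c2 : omega r s * z.2 = h1.2 r * (cmb z).2 s - h1.2 s * (cmb z).2 r.
  by rewrite !comb_coord /omega; ring.
split; apply: (magn_factor o0); rewrite mulrC.
  by rewrite c1; apply: (magnB S2); [exact: (magnM s2 mr)|exact: (magnM r2 ms)].
by rewrite c2; apply: (magnB S2); [exact: (magnM r1 ms)|exact: (magnM s1 mr)].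
Qed.

Lemma magn_coord r z n : mag n z.1 -> mag n z.2 -> mag n.+2 ((cmb z).2 r).
Proof.
move=> m1 m2; have [r1 r2 _] := size_input_magn r; rewrite comb_coord.
by apply: (magnD S2); [exact: (magnM r1 m1)|exact: (magnM r2 m2)].
Qed.

Definition dominates y : bool := geA (a1 + y) a2 && geA (a2 + y) a1.

Lemma dominatesP y :
  reflect (forall r, `|a2.2 r - a1.2 r| <= y.2 r) (dominates y).
Proof.
apply: (iffP andP) => [[p1 p2] r|H]; first by at_coord r; clear; lia.
by split; apply/geP=> r; move: (H r); coords; clear; lia.
Qed.

(** The last translate of x along - l that dominates d = a2 - a1 is bounded at one
    coordinate, and the determinant then bounds a second one. *)
Lemma small_partner z w (t : int) : (forall r, mag 8 ((cmb w).2 r)) ->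
  det2 z w = 1 -> nneg (cmb w) -> dominates (cmb z + cmb w *~ t) ->
  exists z', [/\ det2 z' w = 1, dominates (cmb z'), mag 20 z'.1 & mag 20 z'.2].
Proof.
move=> mw d w0 dom.
pose zt (k : nat) := (z.1 + w.1 * (t - k%:Z), z.2 + w.2 * (t - k%:Z)).
have ztE k : cmb (zt k) = cmb z + cmb w *~ (t - k%:Z) by rewrite /zt /comb /=; A_ring.
have dzt k : det2 (zt k) w = 1 by rewrite -d /det2 /zt /=; ring.
have [r0 wr0] : exists r, 0 < (cmb w).2 r.
  apply: contrapT => /forallNP H; have [_ _ iso _] := adm.
  have e : w = (0, 0).
    apply: (span_free iso); exists (torsion (cmb w)); apply: A_ext; first by [].
    by move=> r; rewrite coord_tors; move: (nnegP _ w0 r) (H r); clear; lia.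
  by move: d; rewrite e /det2 /= !mulr0.
have [k domk] : exists2 k, dominates (cmb (zt k)) & ~~ dominates (cmb (zt k.+1)).
  pose Q k := dominates (cmb (zt k)).
  apply: (@nat_switch Q (absz ((cmb z + cmb w *~ t)%R.2 r0)).+1); first by rewrite /Q ztE subr0.
  apply/negP=> /dominatesP/(_ r0); rewrite ztE; coords; move: wr0; clear; nia.
move=> /dominatesP/existsNP[r /negP]; rewrite -ltNge => ltr.
have step : (cmb (zt k.+1)).2 r = (cmb (zt k)).2 r - (cmb w).2 r.
  by rewrite !ztE; coords; rewrite (intS k); ring.
have ger := dominatesP _ domk r; rewrite step in ltr.
have wr : (cmb w).2 r != 0 by move: ltr ger; clear; lia.
have [_ _ dr] := size_input_magn r.
have mr : mag 9 ((cmb (zt k)).2 r).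
  apply: (magn_le (y := `|a2.2 r - a1.2 r| + (cmb w).2 r)).
    by move: ltr ger; clear; lia.
  apply: (magnD S2) => //; apply: (magn_le (y := a2.2 r - a1.2 r)); first by clear; lia.
  exact: (magnW S2 _ dr).
have [s o] := omega_exists r; have cr := cross r s (zt k) w; rewrite dzt mulr1 in cr.
have ms : mag 18 ((cmb (zt k)).2 s).
  apply: (magn_factor wr).
  have -> : (cmb (zt k)).2 s * (cmb w).2 r = (cmb (zt k)).2 r * (cmb w).2 s - omega r s.
    by rewrite -cr; ring.
  apply: (magnB S2); first exact: magnM mr (mw s).
  exact: (magnW S2 _ (magn_omega r s)).
have [b1 b2] := magn_pair o (magnW S2 (isT : (9 <= 18)%N) mr) ms.
by exists (zt k); split.
Qed.

Lemma cover_at z w V r c : det2 z w = 1 -> dominates (cmb z) ->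
  nneg (cmb w) -> (cmb w).2 r = c -> c + a2.2 r < a1.2 r ->
  nneg (cmb V) -> (cmb V).2 r = 0 ->
  [/\ mag 20 z.1, mag 20 z.2, mag 6 w.1 & mag 6 w.2] -> mag 1 V.1 -> mag 1 V.2 ->
  let K := Certificate z w V c 0 1 in
  sound a1 a2 h1 h2 K /\ small (S ^ 20) K.
Proof.
move=> d /andP[p1 p2] w0 wc cl v0 vr [b1 b2 b3 b4] v1 v2 K; split.
  rewrite /K /sound d eqxx /=; apply/orP; left; apply/and3P; split=> //.
    apply/and4P; split=> //; apply/negP=> /geP/(_ r); coords; rewrite wc; move: cl; clear; lia.
  by apply/existsP; exists r; rewrite wc vr !eqxx cl.
have c0 : 0 <= c by rewrite -wc; exact: (nnegP _ w0 r).
have [_ _ dr] := size_input_magn r.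
have mc : mag 1 c by apply: magn_le dr; move: c0 cl; clear; lia.
apply: small_intro; [exact: b1|exact: b2|exact: magnW b3|exact: magnW b4|exact: magnW v1
  |exact: magnW v2|exact: magnW mc|exact: (magn0 S 20)|exact: (magn1 S2 20)].
Qed.

Definition covered l := exists K (n : nat), [/\ sound a1 a2 h1 h2 K,
  small (S ^ 20) K & l = cert_base h1 h2 K + cert_step h1 h2 K *+ n].

(** A strictly positive l with l_r = c is moved along the line l_r = c, in the
    direction where all coordinates grow if there is one, back to the last point
    that is strictly positive. If there is none, the line meets the positive cone
    in a segment. *)
Lemma slide_interior w r : spos (cmb w) -> mag 1 ((cmb w).2 r) ->
  exists V (k : nat),
  let w' := (w.1 - V.1 * ((cmb w).2 r * k%:Z), w.2 - V.2 * ((cmb w).2 r * k%:Z)) in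
  [/\ nneg (cmb V), (cmb V).2 r = 0, mag 1 V.1 /\ mag 1 V.2, spos (cmb w')
    & mag 6 w'.1 /\ mag 6 w'.2].
Proof.
move=> /forallP wp mc; set c := (cmb w).2 r in mc *.
have c0 : 0 < c := wp r.
have [r1 r2 _] := size_input_magn r.
pose V0 := (h2.2 r, - h1.2 r).
have V0E s : (cmb V0).2 s = omega s r by rewrite comb_coord /omega /=; ring.
have V0r : (cmb V0).2 r = 0 by rewrite V0E /omega; ring.
have along V : nneg (cmb V) -> (cmb V).2 r = 0 -> mag 1 V.1 /\ mag 1 V.2 ->
    (forall s, (cmb V).2 s = omega s r \/ (cmb V).2 s = - omega s r) ->
    exists V (k : nat), let w' := (w.1 - V.1 * (c * k%:Z), w.2 - V.2 * (c * k%:Z)) in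
    [/\ nneg (cmb V), (cmb V).2 r = 0, mag 1 V.1 /\ mag 1 V.2, spos (cmb w')
      & mag 6 w'.1 /\ mag 6 w'.2].
  move=> v0 vr mV vE.
  pose w' (k : nat) := (w.1 - V.1 * (c * k%:Z), w.2 - V.2 * (c * k%:Z)).
  have w'E k s : (cmb (w' k)).2 s = (cmb w).2 s - (cmb V).2 s * (c * k%:Z).
    by rewrite !comb_coord /w' /=; ring.
  have [s0 os0] := omega_exists r; rewrite omegaC oppr_eq0 in os0.
  have vs0 : 0 < (cmb V).2 s0.
    by have := nnegP _ v0 s0; case: (vE s0) => ->; move: os0; clear; lia.
  have [k wk] : exists2 k, spos (cmb (w' k)) & ~~ spos (cmb (w' k.+1)).
    pose Q k := spos (cmb (w' k)).
    apply: (@nat_switch Q (absz ((cmb w).2 s0))).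
      by apply/forallP=> s; rewrite w'E mulr0 mulr0 subr0; apply: wp.
    apply/negP=> /forallP/(_ s0); rewrite w'E gtz0_abs; last exact: wp.
    have vc : 1 <= (cmb V).2 s0 * c by move: vs0 c0; clear; nia.
    by rewrite mulrA; have := wp s0; move: vc; clear; nia.
  move=> /forallPn[s]; rewrite w'E => ns.
  have ps := forallP wk s; have pr := forallP wk r.
  rewrite w'E in ps.
  have vs : 0 < (cmb V).2 s by have := nnegP _ v0 s; move: ns ps c0; clear; nia.
  have o : omega s r != 0 by move: vs; case: (vE s) => ->; clear; lia.
  exists V, k; split=> //; apply: (magn_pair o); last first.
    by rewrite w'E vr mul0r subr0; apply: (magnW S2 _ mc).
  apply: (magn_le (y := (cmb V).2 s * c)).
    by rewrite w'E; move: ns ps c0 vs; clear; nia.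
  have mv : mag 3 ((cmb V).2 s).
    by case: (vE s) => ->; rewrite ?(magn_omega s r) //; apply: magnN; apply: magn_omega.
  exact: magnM mv mc.
have [v0|/nnnegP[s]] := boolP (nneg (cmb V0)).
  apply: (along V0) => //; last by move=> s; left.
  by split=> //; apply: magnN.
rewrite V0E => os.
have [v0|/nnnegP[t]] := boolP (nneg (cmb (- V0))).
  apply: (along (- V0)) => //.
  - by rewrite combN coordN V0r oppr0.
  - by rewrite pair_opp /=; split; [apply: magnN|rewrite opprK].
  - by move=> s'; right; rewrite combN coordN V0E.
rewrite combN coordN V0E => ot.
have rel : omega t r * (cmb w).2 s - omega s r * (cmb w).2 t = omega t s * c.
  by rewrite /c !comb_coord /omega; ring.
have ms : mag 4 ((cmb w).2 s).
  apply: (magn_le (y := omega t s * c)); last exact: magnM (magn_omega t s) mc.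
  rewrite -rel; have := wp s; have := wp t; move: os ot; clear; nia.
have o : omega s r != 0 by move: os; clear; lia.
have [m1 m2] := magn_pair o ms (magnW S2 (isT : (1 <= 4)%N) mc).
have c0E s' : (cmb 0).2 s' = 0 by rewrite comb_coord !mulr0.
have wE : (w.1 - (0 : int * int).1 * (c * 0%N%:Z), w.2 - (0 : int * int).2 * (c * 0%N%:Z)) = w.
  by rewrite !mulr0 !subr0 -surjective_pairing.
exists 0, 0%N; cbv zeta; rewrite wE; split=> //; first by apply/nnegP=> s'; rewrite c0E.
by apply/forallP.
Qed.

Lemma cover_stationary z w : det2 z w = 1 ->
  stationary a1 a2 (cmb z) (cmb w) -> covered (cmb w).
Proof.
move=> d /and4P[p1 p2 w0 /ngeP[r]]; rewrite coordD addrC => cl.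
have dom : dominates (cmb z) by rewrite /dominates p1 p2.
have [_ _ dr] := size_input_magn r.
have mc : mag 1 ((cmb w).2 r).
  by apply: magn_le dr; move: (nnegP _ w0 r) cl; clear; lia.
have [wp|] := boolP (spos (cmb w)).
  have [V [k [v0 vr [mV1 mV2] wp' [m1 m2]]]] := slide_interior wp mc.
  set w' := (w.1 - _, _) in wp' m1 m2.
  have wr : (cmb w').2 r = (cmb w).2 r.
    have shift t : (cmb (w.1 - V.1 * t, w.2 - V.2 * t)).2 r = (cmb w).2 r - (cmb V).2 r * t.
      by rewrite !comb_coord /=; ring.
    by rewrite /w' shift vr mul0r subr0.
  pose z0 := (z.1 + V.1 * (- k%:Z * (cmb z).2 r), z.2 + V.2 * (- k%:Z * (cmb z).2 r)).
  have d0 : det2 z0 w' = 1.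
    rewrite -d -(shear_det z w (- k%:Z) vr) /z0 /w'; congr (det2 _ (_, _)); ring.
  have m8 s : mag 8 ((cmb w').2 s) by apply: magn_coord.
  have w'0 : nneg (cmb w') by apply/nnegP=> s; apply: ltW; apply: (forallP wp').
  have [|z' [d' dom' b1 b2]] := @small_partner z0 w'
      (\sum_s absz ((cmb z0).2 s) + \sum_s absz (a2.2 s - a1.2 s)%R)%N%:Z m8 d0 w'0.
    apply/dominatesP=> s; rewrite (bigD1 s) // [X in (_ + X)%N](bigD1 s) //.
    set T := (\sum_(_ | _) _)%N; set T' := (\sum_(_ | _) _)%N; coords.
    have := forallP wp' s; set q := (cmb w').2 s; set p := (cmb z0).2 s.
    set e := a2.2 s - a1.2 s; set n := (_ + _ + (_ + _))%N => q0.
    have : n%:Z <= q * n%:Z by move: q0; clear; nia.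
    by rewrite /n; clear; lia.
  have [sd sm] := cover_at d' dom' w'0 wr cl v0 vr (And4 b1 b2 m1 m2) mV1 mV2.
  exists (Certificate z' w' V ((cmb w).2 r) 0 1), k; split=> //.
  by rewrite /cert_base /cert_step /w' /comb /=; A_ring.
move=> /forallPn[m]; rewrite -leNgt => wm.
have {wm} wm : (cmb w).2 m = 0 by have := nnegP _ w0 m; move: wm; clear; lia.
have [_ gen] := oriented_generic adm (ex_intro _ z (ex_intro _ w (And3 erefl erefl d))).
have zm : (cmb z).2 m != 0 by case: (gen m) => [/eqP//|]; rewrite wm.
have m3 s : mag 3 ((cmb w).2 s).
  have := cross m s z w; rewrite d mulr1 wm mulr0 subr0 mulrC => cr.
  by apply: (magn_factor zm); rewrite cr magn_omega.
have [s o] := omega_exists m; have [m1 m2] := magn_pair o (m3 m) (m3 s).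
have dom0 : dominates (cmb z + cmb w *~ 0) by rewrite mulr0z addr0.
have [z' [d' dom' b1 b2]] := small_partner (fun s => magnW S2 (isT : (3 <= 8)%N) (m3 s)) d w0 dom0.
have v0 : nneg (cmb 0) by apply/nnegP=> s'; rewrite comb_coord !mulr0.
have vr : (cmb 0).2 r = 0 by rewrite comb_coord !mulr0.
have w6 := And4 b1 b2 (magnW S2 (isT : (5 <= 6)%N) m1) (magnW S2 (isT : (5 <= 6)%N) m2).
have [sd sm] := cover_at d' dom' w0 erefl cl v0 vr w6 (magn0 S 1) (magn0 S 1).
exists (Certificate z' w 0 ((cmb w).2 r) 0 1), 0%N; split=> //.
by rewrite /cert_base /cert_step /=; A_ring.
Qed.

Lemma small_word r s z w i j : omega r s != 0 ->
  mag 4 ((cmb z).2 r) -> mag 4 ((cmb z).2 s) -> mag 4 ((cmb w).2 r) ->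
  mag 4 ((cmb w).2 s) -> mag 5 i -> mag 5 j -> small (S ^ 20) (Certificate z w 0 0 i j).
Proof.
move=> o zr zs wr ws mi mj.
have [z1 z2] := magn_pair o zr zs; have [w1 w2] := magn_pair o wr ws.
by apply: small_intro; rewrite -/(magn S 20 _) ?magn0 //; [exact: magnW z1|exact: magnW z2
  |exact: magnW w1|exact: magnW w2|exact: magnW mi|exact: magnW mj].
Qed.

Definition swapped_stationary l := exists z w,
  [/\ det2 z w = 1, comb h2 h1 w = l & stationary a2 a1 (comb h2 h1 z) (comb h2 h1 w)].

(** A full-tree root whose second vector l is strictly positive is terminal only
    if l does not dominate d; then - x1 + n l, for n large, shows that l is a
    limit direction on the other side. *)
Lemma full_root_swapped z w : det2 z w = 1 -> spos (cmb w) ->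
  nneg (cmb w) -> terminal a1 a2 (cmb z) (cmb w) -> swapped_stationary (cmb w).
Proof.
move=> d /forallP wp w0 tm.
have n1 : ~~ geA (a1 + cmb w) a2.
  apply: contra tm => p; rewrite w0 p /=; apply/forallP=> r; apply/implyP=> /eqP e.
  by have := wp r; rewrite e.
pose t := (\sum_r (absz ((cmb z).2 r) + absz (a2.2 r - a1.2 r)%R))%N.
have ori : oriented h1 h2 (cmb z) (cmb w) by exists z, w.
have := oriented_addln t (oriented_rot (oriented_swap ori)).
move=> [z' [w' [e1 e2 d']]]; exists z', w'; split=> //; rewrite -e1 -e2.
have big r : `|(cmb z).2 r| + `|a2.2 r - a1.2 r| <= t%:Z.
  by rewrite /t (bigD1 r) //=; set T := (\sum_(_ | _) _)%N; clear; lia.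
apply/and4P; split=> //.
- apply/geP=> r; coords; have := big r; have := wp r; clear; nia.
- apply/geP=> r; coords; have := big r; have := wp r; clear; nia.
Qed.

(** The coordinates r, s to which cross applies are: for x1, x2 >= 0 and x2 zero
    at r, a coordinate s at which x1 >= x2 + d fails; for x2 negative at r, one at
    which d is negative; for x1 negative at r, one at which x2 is negative or being
    terminal shows. *)
Lemma word_small_or_swapped z w i j : det2 z w = 1 ->
  root_ineqs a1 a2 (cmb z) (cmb w) -> terminal a1 a2 (cmb z) (cmb w) ->
  word_coef a1 a2 (cmb z) (cmb w) i j ->
  small (S ^ 20) (Certificate z w 0 0 i j) \/
  (swapped_stationary (cmb w) /\ (i = 0 /\ j = 1)).
Proof.
move=> d /and5P[_ _ _ r1 _] tm /and3P[p1 p2].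
have cr r s := cross r s z w; rewrite d in cr.
have X1 r : a2.2 r - a1.2 r <= (cmb z).2 r by move: (geP _ _ p1 r); coords; clear; lia.
have Y1 r : a1.2 r - a2.2 r <= (cmb w).2 r by move: (geP _ _ p2 r); coords; clear; lia.
have [_ gen] := oriented_generic adm (ex_intro _ z (ex_intro _ w (And3 erefl erefl d))).
have md r : mag 1 (a2.2 r - a1.2 r) by have [_ _ ?] := size_input_magn r.
case: ifP => [q1 /andP[/eqP -> /eqP ->]|/negbT/nnnegP[r xr] wc].
  have [w0|nw] := boolP (nneg (cmb w)).
    have [wp|/forallPn[m]] := boolP (spos (cmb w)).
      by right; split; [exact: (full_root_swapped d wp w0 tm)|split].

    rewrite -leNgt => wm; left.
    have {wm} wm : (cmb w).2 m = 0 by have := nnegP _ w0 m; move: wm; clear; lia.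
    have [s] := ngeP r1; coords => lt.
    have zm : (cmb z).2 m != 0 by case: (gen m) => [/eqP//|]; rewrite wm.
    have ws : 0 < (cmb w).2 s by move: lt (X1 s); clear; lia.
    have o : omega m s != 0 by apply: (omega_neq0 (z := w)); rewrite ?wm.
    have c := cr m s; rewrite wm mulr0 subr0 mulr1 in c.
    have mws : mag 3 ((cmb w).2 s) by apply: (magn_factor zm); rewrite mulrC c magn_omega.
    have mzm : mag 3 ((cmb z).2 m) by apply: (magn_factor (lt0r_neq0 ws)); rewrite c magn_omega.
    apply: (small_word o); rewrite ?wm ?magn0 ?magn1 //.
    - exact: (magnW S2 _ mzm).
    - apply: (magn_le (y := (cmb w).2 s + (a2.2 s - a1.2 s))).
        by move: lt (nnegP _ q1 s); clear; lia.
      by apply: (magnD S2) => //; apply: (magnW S2 _ (md s)).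
    - exact: (magnW S2 _ mws).
  left; have [r wr] := nnnegP nw; have [_ [_ i2] _ _] := adm; have [s ds] := ngeP i2.
  have c := cr r s; rewrite mulr1 in c.
  have ws : 0 < (cmb w).2 s by move: ds (Y1 s); clear; lia.
  have o : omega r s != 0 by apply: (omega_neq0 (z := w)) => //; apply: ltW.
  have xr : 0 < (cmb z).2 r by move: wr (Y1 r) (X1 r); clear; lia.
  have xs := nnegP _ q1 s; have mo := magn_omega r s.
  apply: (small_word o).
  - by apply: (magnW S2 (isT : (3 <= 4)%N)); apply: magn_le mo; move: c ws wr xr xs; clear; nia.
  - by apply: (magnW S2 (isT : (3 <= 4)%N)); apply: magn_le mo; move: c ws wr xr xs; clear; nia.
  - by apply: (magnW S2 (isT : (1 <= 4)%N)); apply: magn_le (md r); move: wr (Y1 r); clear; lia.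
  - by apply: (magnW S2 (isT : (3 <= 4)%N)); apply: magn_le mo; move: c ws wr xr xs; clear; nia.
  - exact: magn1.
  - exact: magn1.
left; have yr : 0 < (cmb w).2 r by move: xr (X1 r) (Y1 r); clear; lia.
have mxr : mag 1 ((cmb z).2 r) by apply: magn_le (md r); move: xr (X1 r); clear; lia.
have [s [mys xs o]] : exists s, [/\ mag 1 ((cmb w).2 s), (cmb z).2 s != 0 & omega r s != 0].
  have [w0|/nnnegP[s ws]] := boolP (nneg (cmb w)); last first.
    have xs : 0 < (cmb z).2 s by move: ws (X1 s) (Y1 s); clear; lia.
    exists s; split; [|exact: lt0r_neq0|by apply: (omega_neq0 (z := z)) => //; apply: ltW].
    by apply: magn_le (md s); move: ws (Y1 s); clear; lia.
  move: tm; rewrite /terminal w0 andTb negb_and => /orP[/ngeP[s]|/forallPn[s]].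
    coords => lt; have xs : 0 < (cmb z).2 s by move: lt (nnegP _ w0 s) (X1 s); clear; lia.
    exists s; split; [|exact: lt0r_neq0|by apply: (omega_neq0 (z := z)) => //; apply: ltW].
    by apply: magn_le (md s); move: lt (nnegP _ w0 s); clear; lia.
  rewrite negb_imply => /andP[/eqP ws _]; exists s; split; first by rewrite ws magn0.
    by case: (gen s) => [/eqP//|]; rewrite ws.
  by rewrite omegaC oppr_eq0; apply: (omega_neq0 (z := w)); rewrite ?ws.
have c : (cmb z).2 s * (cmb w).2 r = (cmb z).2 r * (cmb w).2 s - omega r s.
  by rewrite -(mulr1 (omega r s)) -cr; ring.
have mp : mag 4 ((cmb z).2 s * (cmb w).2 r).
  by rewrite c; apply: (magnB S2) (magn_omega r s); apply: (magnW S2 _ (magnM mxr mys)).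
have mxs : mag 4 ((cmb z).2 s) by apply: magn_factor mp; apply: lt0r_neq0.
have myr : mag 4 ((cmb w).2 r) by apply: (magn_factor xs); rewrite mulrC.
have small_coef : mag 5 i /\ mag 5 j.
  case/orP: wc => [/and5P[_ i0 /eqP-> pi _]|/and5P[_ _ _ /eqP-> /eqP->]]; last first.
    by split; [exact: magn1|exact: magn2].
  split; last exact: magn1.
  apply: (magn_le (y := (cmb w).2 r + (a2.2 r - a1.2 r))).
    by move: (geP _ _ pi r) i0 xr yr; coords; clear; nia.
  by apply: (magnD S2) => //; apply: (magnW S2 _ (md r)).
have [mi mj] := small_coef.
apply: (small_word o) => //; [exact: (magnW S2 _ mxr)|exact: (magnW S2 _ mys)].
Qed.
End Fixed.

(** The other side is there for the full-tree roots whose second vector is strictly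
    positive; the certificates of all other limit directions can be made small. *)
Lemma right_limit_covered a1 a2 h1 h2 l : admissible a1 a2 h1 h2 ->
  right_limit a1 a2 h1 h2 l -> covered a1 a2 h1 h2 l \/ covered a2 a1 h2 h1 l.
Proof.
move=> adm /right_limit_cert[[z [w [d -> st]]]|[z [w [i [j [sd [d rt tm wc ->]]]]]]].
  by left; apply: cover_stationary st.
have [sm|[[z' [w' [d' e' st]]] [-> ->]]] := word_small_or_swapped adm d rt tm wc.
  left; exists (Certificate z w 0 0 i j), 0%N; split=> //.
  by rewrite /cert_base /cert_step /=; A_ring.
right; rewrite mulr0z add0r mulr1z -e'.
exact: (cover_stationary (admissible_swap adm) d' st).
Qed.
End Boxes.

(** * Recursive functions *)
Section Computable.
Local Open Scope nat_scope.
Implicit Types (m n : nat) (F G : seq nat -> nat) (xs e : seq nat).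

(** The arity m is fixed, because a composition has to list the arguments that
    it passes on. *)
Definition comp m F : Prop := exists f, forall xs, size xs = m -> reval f xs (F xs).

Lemma comp_ext m F G : (forall xs, size xs = m -> F xs = G xs) -> comp m F -> comp m G.
Proof. by move=> eq [f fP]; exists f => xs sx; rewrite -eq //; apply: fP. Qed.

Lemma comp_nth m i : comp m (fun xs => nth 0 xs i).
Proof. by exists (RProj i) => xs _; constructor. Qed.

Lemma comp_map m (Gs : seq (seq nat -> nat)) : List.Forall (comp m) Gs ->
  exists gs, forall xs, size xs = m -> revals gs xs [seq G xs | G <- Gs].
Proof.
elim=> [|G {}Gs [g gP] _ [gs gsP]]; first by exists [::] => xs _; constructor.
by exists (g :: gs) => xs sx /=; constructor; [apply: gP|apply: gsP].
Qed.

Lemma comp_app m k F (Gs : seq (seq nat -> nat)) : comp k F -> size Gs = k ->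
  List.Forall (comp m) Gs -> comp m (fun xs => F [seq G xs | G <- Gs]).
Proof.
move=> [f fP] sG /comp_map[gs gsP]; exists (RComp f gs) => xs sx.
by econstructor; [apply: gsP|apply: fP; rewrite size_map].
Qed.

Lemma comp_projections m k j : List.Forall (comp m) [seq (fun xs => nth 0 xs i) | i <- iota k j].
Proof. by elim: j k => [|j IH] k /=; constructor; [exact: comp_nth|exact: IH]. Qed.

Lemma comp_push m F G : comp m.+1 F -> comp m G -> comp m (fun xs => F (G xs :: xs)).
Proof.
move=> cF cG; pose Gs := G :: [seq (fun xs => nth 0 xs i) | i <- iota 0 m].
apply: (comp_ext (F := fun xs => F [seq H xs | H <- Gs])).
  by move=> xs sx; rewrite /Gs /= -map_comp -/(mkseq (nth 0 xs) m) -sx mkseq_nth.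
apply: comp_app cF _ _; first by rewrite /Gs /= size_map size_iota.
by constructor=> //; apply: comp_projections.
Qed.

Lemma comp_drop2 m F : comp m F -> comp m.+2 (fun e => F (drop 2 e)).
Proof.
move=> cF; pose Gs := [seq (fun xs => nth 0 xs i) | i <- iota 2 m].
apply: (comp_ext (F := fun xs => F [seq H xs | H <- Gs])).
  case=> [|x [|y xs]] //= [sx]; rewrite drop0 /Gs -map_comp; congr F.
  by rewrite -[RHS](mkseq_nth 0) sx /mkseq (iotaDl 2 0) -map_comp.
by apply: comp_app cF _ (comp_projections _ _ _); rewrite size_map size_iota.
Qed.

Lemma comp_const m n : comp m (fun=> n).
Proof.
elim: n => [|n [f fP]]; first by exists RZero => xs _; constructor.
exists (RComp RSucc [:: f]) => xs sx.
econstructor; first by constructor; [exact: fP|constructor].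
exact: (reval_succ [:: n]).
Qed.

Lemma comp_succ m F : comp m F -> comp m (fun xs => (F xs).+1).
Proof.
move=> [f fP]; exists (RComp RSucc [:: f]) => xs sx.
econstructor; first by constructor; [exact: fP|constructor].
exact: (reval_succ [:: F xs]).
Qed.

Lemma comp_iteri m (N B : seq nat -> nat) (step : nat -> nat -> seq nat -> nat) :
  comp m N -> comp m B ->
  comp m.+2 (fun e => step (nth 0 e 0) (nth 0 e 1) (drop 2 e)) ->
  comp m (fun xs => iteri (N xs) (fun n y => step n y xs) (B xs)).
Proof.
move=> cN [b bP] [s sP].
pose F xs := iteri (head 0 xs) (fun n y => step n y (behead xs)) (B (behead xs)).
apply: (comp_ext (F := fun xs => F (N xs :: xs))) => //.
apply: comp_push cN; exists (RRec b s) => -[//|n xs] [sx]; rewrite /F /=.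
elim: n => [|n IH]; first by constructor; apply: bP.
econstructor; first exact: IH.
by have := sP [:: n, iteri n (fun k y => step k y xs) (B xs) & xs]; rewrite /= drop0 sx; apply.
Qed.

Lemma comp_add m F G : comp m F -> comp m G -> comp m (fun xs => F xs + G xs).
Proof.
move=> cF cG; apply: comp_ext (comp_iteri (step := fun _ y _ => y.+1) cF cG _).
  by move=> xs _; elim: (F xs) => //= n ->.
by apply: comp_succ; apply: comp_nth.
Qed.

Lemma comp_mul m F G : comp m F -> comp m G -> comp m (fun xs => F xs * G xs).
Proof.
move=> cF cG.
apply: comp_ext (comp_iteri (step := fun _ y xs => y + G xs) cF (comp_const m 0) _).
  by move=> xs _; elim: (F xs) => //= n ->; rewrite mulSn addnC.
by apply: comp_add; [apply: comp_nth|apply: comp_drop2].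
Qed.

Lemma comp_pred m F : comp m F -> comp m (fun xs => (F xs).-1).
Proof.
move=> cF; apply: comp_ext (comp_iteri (step := fun n _ _ => n) cF (comp_const m 0) _).
  by move=> xs _; case: (F xs).
exact: comp_nth.
Qed.

Lemma comp_sub m F G : comp m F -> comp m G -> comp m (fun xs => F xs - G xs).
Proof.
move=> cF cG; apply: comp_ext (comp_iteri (step := fun _ y _ => y.-1) cG cF _).
  by move=> xs _; elim: (G xs) => [|n IH] /=; [rewrite subn0|rewrite subnS IH].
by apply: comp_pred; apply: comp_nth.
Qed.

Lemma comp_exp m F G : comp m F -> comp m G -> comp m (fun xs => F xs ^ G xs).
Proof.
move=> cF cG.
apply: comp_ext (comp_iteri (step := fun _ y xs => F xs * y) cG (comp_const m 1) _).
  by move=> xs _; elim: (G xs) => //= n ->; rewrite expnS.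
by apply: comp_mul; [apply: comp_drop2|apply: comp_nth].
Qed.

Definition compb m (T : seq nat -> bool) : Prop := comp m (fun xs => T xs : nat).

Lemma compb_ext m (T U : seq nat -> bool) : (forall xs, T xs = U xs) -> compb m T -> compb m U.
Proof. by move=> eq; apply: comp_ext => xs _; rewrite eq. Qed.

Lemma compb_not m (T : seq nat -> bool) : compb m T -> compb m (fun xs => ~~ T xs).
Proof.
by move=> cT; apply: comp_ext (comp_sub (comp_const m 1) cT) => xs _; case: (T xs).
Qed.

Lemma compb_and m (T U : seq nat -> bool) :
  compb m T -> compb m U -> compb m (fun xs => T xs && U xs).
Proof. by move=> cT cU; apply: comp_ext (comp_mul cT cU) => xs _; rewrite mulnb. Qed.

Lemma compb_or m (T U : seq nat -> bool) :
  compb m T -> compb m U -> compb m (fun xs => T xs || U xs).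
Proof.
move=> cT cU; apply: compb_ext (compb_not (compb_and (compb_not cT) (compb_not cU))).
by move=> xs; rewrite negb_and !negbK.
Qed.

Lemma compb_implies m (T U : seq nat -> bool) :
  compb m T -> compb m U -> compb m (fun xs => T xs ==> U xs).
Proof.
move=> cT cU; apply: compb_ext (compb_or (compb_not cT) cU).
by move=> xs; rewrite implybE.
Qed.

Lemma compb_leq m F G : comp m F -> comp m G -> compb m (fun xs => F xs <= G xs).
Proof.
move=> cF cG; apply: compb_ext (compb_not (T := fun xs => 0 < F xs - G xs) _).
  by move=> xs; rewrite subn_gt0 -leqNgt.
apply: comp_ext (comp_iteri (step := fun _ _ _ => 1) (comp_sub cF cG) (comp_const m 0) _).
  by move=> xs _; case: (F xs - G xs).
exact: comp_const.
Qed.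

Lemma comp_if m (T : seq nat -> bool) F G : compb m T -> comp m F -> comp m G ->
  comp m (fun xs => if T xs then F xs else G xs).
Proof.
move=> cT cF cG.
apply: comp_ext (comp_add (comp_mul cT cF) (comp_mul (compb_not cT) cG)) => xs _.
by case: (T xs); rewrite ?mul1n ?mul0n ?addn0.
Qed.

Lemma compb_if m (T U V : seq nat -> bool) : compb m T -> compb m U -> compb m V ->
  compb m (fun xs => if T xs then U xs else V xs).
Proof.
move=> cT cU cV; apply: comp_ext (comp_if cT cU cV) => xs _.
by case: (T xs).
Qed.

Lemma comp_div m F G : comp m F -> comp m G -> comp m (fun xs => F xs %/ G xs).
Proof.
move=> cF cG.
apply: comp_ext (comp_if (T := fun xs => 0 < G xs) (compb_leq (comp_const m 1) cG)
  (comp_iteri (step := fun n y xs => y + (n.+1 * G xs <= F xs)) cF (comp_const m 0) _)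
  (comp_const m 0)).
  move=> xs _; case: (posnP (G xs)) => [->|g0]; first by rewrite divn0.
  have H k : iteri k (fun n y => y + (n.+1 * G xs <= F xs)) 0 = minn k (F xs %/ G xs).
    elim: k => [|k IH] /=; first by rewrite min0n.
    by rewrite IH -leq_divRL //; lia.
  by rewrite H; apply/minn_idPr; apply: leq_div.
apply: comp_add; first exact: comp_nth.
apply: compb_leq; last exact: comp_drop2.
by apply: comp_mul; [apply: comp_succ; apply: comp_nth|apply: comp_drop2].
Qed.

Lemma comp_mod m F G : comp m F -> comp m G -> comp m (fun xs => F xs %% G xs).
Proof.
move=> cF cG; apply: comp_ext (comp_sub cF (comp_mul (comp_div cF cG) cG)) => xs _.
by rewrite {1}(divn_eq (F xs) (G xs)) addKn.
Qed.

Lemma comp_seq_sum m (I : Type) (s : seq I) (F : I -> seq nat -> nat) :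
  (forall i, comp m (F i)) -> comp m (fun xs => \sum_(i <- s) F i xs).
Proof.
move=> cF; elim: s => [|i s IH].
  by apply: comp_ext (comp_const m 0) => xs _; rewrite big_nil.
by apply: comp_ext (comp_add (cF i) IH) => xs _; rewrite big_cons.
Qed.

Lemma compb_all m (I : Type) (s : seq I) (T : I -> seq nat -> bool) :
  (forall i, compb m (T i)) -> compb m (fun xs => all (fun i => T i xs) s).
Proof.
move=> cT; elim: s => [|i s IH] /=; first exact: (comp_const m 1).
exact: compb_and.
Qed.

Lemma compb_forall m (I : finType) (T : I -> seq nat -> bool) :
  (forall i, compb m (T i)) -> compb m (fun xs => [forall i, T i xs]).
Proof.
move=> cT; apply: compb_ext (compb_all (enum I) cT) => xs.
by apply/allP/forallP => [H i|H i _]; [apply: H; rewrite mem_enum|exact: H].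
Qed.

Lemma compb_exists m (I : finType) (T : I -> seq nat -> bool) :
  (forall i, compb m (T i)) -> compb m (fun xs => [exists i, T i xs]).
Proof.
move=> cT; apply: compb_ext (compb_not (compb_forall (fun i => compb_not (cT i)))) => xs.
by rewrite negb_forall; apply: eq_existsb => i; rewrite negbK.
Qed.

Lemma comp_code m (Fs : seq (seq nat -> nat)) : List.Forall (comp m) Fs ->
  comp m (fun xs => CodeSeq.code [seq F xs | F <- Fs]).
Proof.
elim=> [|F {}Fs cF _ IH] /=; first exact: comp_const.
apply: comp_ext (comp_mul (comp_exp (comp_const m 2) cF)
  (comp_succ (comp_mul (comp_const m 2) IH))) => xs _.
by rewrite mul2n.
Qed.
End Computable.

Section ComputableVectors.
Variable P : {fset nat}.
Implicit Types (m : nat) (f g : seq nat -> int) (F G : seq nat -> nat) (a b : seq nat -> A P).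

(** Integers are computed as differences of natural numbers. *)
Definition compz m f : Prop := exists p n,
  [/\ comp m p, comp m n & forall xs, f xs = (p xs)%:Z - (n xs)%:Z].

Lemma compz_ext m f g : (forall xs, f xs = g xs) -> compz m f -> compz m g.
Proof. by move=> eq [p [n [cp cn e]]]; exists p, n; split=> // xs; rewrite -eq. Qed.

Lemma compz_nat m F : comp m F -> compz m (fun xs => (F xs)%:Z).
Proof.
by move=> cF; exists F, (fun=> 0%N); split=> // [|xs]; [exact: comp_const|rewrite subr0].
Qed.

Lemma compz_const m (c : int) : compz m (fun=> c).
Proof.
case: c => k; first exact: compz_nat (comp_const m k).
exists (fun=> 0%N), (fun=> k.+1); split=> [||xs]; [exact: comp_const|exact: comp_const|].
by rewrite NegzE sub0r.
Qed.

Lemma compz_add m f g : compz m f -> compz m g -> compz m (fun xs => f xs + g xs).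
Proof.
move=> [p [n [cp cn e]]] [p' [n' [cp' cn' e']]].
exists (fun xs => p xs + p' xs)%N, (fun xs => n xs + n' xs)%N.
by split=> [||xs]; [exact: comp_add|exact: comp_add|rewrite e e' !PoszD; ring].
Qed.

Lemma compz_opp m f : compz m f -> compz m (fun xs => - f xs).
Proof.
move=> [p [n [cp cn e]]]; exists n, p; split=> // xs; rewrite e; ring.
Qed.

Lemma compz_mul m f g : compz m f -> compz m g -> compz m (fun xs => f xs * g xs).
Proof.
move=> [p [n [cp cn e]]] [p' [n' [cp' cn' e']]].
exists (fun xs => p xs * p' xs + n xs * n' xs)%N, (fun xs => p xs * n' xs + n xs * p' xs)%N.
split=> [||xs]; [| |by rewrite e e' !PoszD !PoszM; ring].
  by apply: comp_add; apply: comp_mul.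
by apply: comp_add; apply: comp_mul.
Qed.

Lemma compb_lez m f g : compz m f -> compz m g -> compb m (fun xs => f xs <= g xs).
Proof.
move=> [p [n [cp cn e]]] [p' [n' [cp' cn' e']]].
apply: compb_ext (compb_leq (comp_add cp cn') (comp_add cp' cn)) => xs.
by rewrite e e'; clear; lia.
Qed.

Lemma compb_ltz m f g : compz m f -> compz m g -> compb m (fun xs => f xs < g xs).
Proof.
move=> cf cg; apply: compb_ext (compb_not (compb_lez cg cf)) => xs; by rewrite ltNge.
Qed.

Lemma compb_eqz m f g : compz m f -> compz m g -> compb m (fun xs => f xs == g xs).
Proof.
move=> cf cg; apply: compb_ext (compb_and (compb_lez cf cg) (compb_lez cg cf)) => xs.
by rewrite eq_le.
Qed.

Lemma comp_absz m f : compz m f -> comp m (fun xs => absz (f xs)).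
Proof.
move=> [p [n [cp cn e]]].
apply: comp_ext (comp_add (comp_sub cp cn) (comp_sub cn cp)) => xs _.
by rewrite e; clear; lia.
Qed.

Lemma comp_code_int m f : compz m f -> comp m (fun xs => code_int (f xs)).
Proof.
move=> cf; have two := comp_mul (comp_const m 2) (comp_absz cf).
apply: comp_ext (comp_if (compb_lez (compz_const m 0) cf) two (comp_pred two)) => xs _.
by case: (f xs) => k; rewrite /= ?mul2n; clear; lia.
Qed.

Definition decode_int (k : nat) : int := if odd k then Negz k./2 else Posz k./2.

Lemma code_intK : cancel code_int decode_int.
Proof.
case=> k; rewrite /decode_int /code_int; first by rewrite odd_double doubleK.
by rewrite oddS odd_double; congr Negz; rewrite -[RHS](half_bit_double k true).
Qed.

Lemma compz_decode_int m F : comp m F -> compz m (fun xs => decode_int (F xs)).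
Proof.
move=> cF; have ch := comp_div cF (comp_const m 2).
have co : compb m (fun xs => odd (F xs)).
  by apply: comp_ext (comp_mod cF (comp_const m 2)) => xs _; rewrite modn2.
exists (fun xs => if odd (F xs) then 0 else F xs %/ 2)%N.
exists (fun xs => if odd (F xs) then (F xs %/ 2).+1 else 0)%N; split.
- exact: comp_if co (comp_const m 0) ch.
- exact: comp_if co (comp_succ ch) (comp_const m 0).
move=> xs; rewrite /decode_int -!divn2; case: ifP => _; last by rewrite subr0.
by rewrite NegzE sub0r.
Qed.

Definition compA m a : Prop :=
  comp m (fun xs => torsion (a xs) : nat) /\ forall r, compz m (fun xs => (a xs).2 r).

Lemma compA_add m a b : compA m a -> compA m b -> compA m (fun xs => a xs + b xs).
Proof.
move=> [ta ca] [tb cb]; split.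
  exact: comp_ext (comp_mod (comp_add ta tb) (comp_const m 2)).
by move=> r; apply: compz_ext (compz_add (ca r) (cb r)) => xs; rewrite coordD.
Qed.

Lemma compA_mulz m a f : compA m a -> compz m f -> compA m (fun xs => a xs *~ f xs).
Proof.
move=> [ta ca] cf; split; last first.
  by move=> r; apply: compz_ext (compz_mul (ca r) cf) => xs; rewrite coordMz.
apply: comp_ext (comp_mod (comp_mul ta (comp_absz cf)) (comp_const m 2)) => xs _.
have H (k : nat) : torsion (a xs *+ k) = (torsion (a xs) * k %% 2)%N :> nat.
  elim: k => [|k IH]; first by rewrite mulr0n torsion0 muln0.
  rewrite mulrS torsionD mulnS; transitivity ((torsion (a xs) + torsion (a xs *+ k)%R) %% 2)%N.
    by [].
  by rewrite IH modnDmr.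
by case: (f xs) => k; rewrite /intmul ?torsionN ?Z2_opp -H.
Qed.

Lemma compA_comb m a b f g : compA m a -> compA m b -> compz m f -> compz m g ->
  compA m (fun xs => comb (a xs) (b xs) (f xs, g xs)).
Proof. by move=> ca cb cf cg; apply: compA_add; apply: compA_mulz. Qed.

Lemma compb_nneg m a : compA m a -> compb m (fun xs => nneg (a xs)).
Proof.
move=> [_ ca]; apply: compb_ext (compb_forall (fun r => compb_lez (compz_const m 0) (ca r))).
by move=> xs; apply/forallP/nnegP.
Qed.

Lemma compb_geA m a b : compA m a -> compA m b -> compb m (fun xs => geA (a xs) (b xs)).
Proof.
move=> [_ ca] [_ cb]; apply: compb_ext (compb_forall (fun r => compb_lez (cb r) (ca r))).
by move=> xs; apply/forallP/geP.
Qed.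

Lemma compb_same_coord m a b : compA m a -> compA m b ->
  compb m (fun xs => same_coord (a xs) (b xs)).
Proof. by move=> [_ ca] [_ cb]; apply: compb_forall => r; apply: compb_eqz. Qed.

Lemma forall_cat (T : Type) (Q : T -> Prop) (s t : seq T) :
  List.Forall Q s -> List.Forall Q t -> List.Forall Q (s ++ t).
Proof. by elim=> [|x {}s Qx _ IH] Qt //=; constructor=> //; apply: IH. Qed.

Lemma comp_code_vec m a b (ys : seq (seq nat -> nat)) : compA m a -> compA m b ->
  List.Forall (comp m) ys ->
  comp m (fun xs => CodeSeq.code (code_vec (a xs) ++ code_vec (b xs) ++ [seq y xs | y <- ys])).
Proof.
move=> ca cb cy.
pose vec (c : seq nat -> A P) : seq (seq nat -> nat) :=
  (fun xs => torsion (c xs) : nat) :: [seq (fun xs => code_int ((c xs).2 r)) | r <- enum {: P}].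
have vecE c xs : [seq F xs | F <- vec c] = code_vec (c xs).
  by rewrite /vec map_cons -map_comp.
have cvec c : compA m c -> List.Forall (comp m) (vec c).
  move=> [tc cc]; constructor=> //; elim: (enum {: P}) => [|r s IH] /=; constructor=> //.
  exact: comp_code_int.
apply: comp_ext (comp_code (Fs := vec a ++ vec b ++ ys) _) => [xs _|].
  by rewrite !map_cat !vecE.
by apply: forall_cat; [exact: cvec|apply: forall_cat => //; exact: cvec].
Qed.

Section Tests.
Variable m : nat.
Variables a1 a2 x1 x2 : seq nat -> A P.
Hypotheses (c1 : compA m a1) (c2 : compA m a2) (cx1 : compA m x1) (cx2 : compA m x2).

Lemma compb_stationary : compb m (fun xs => stationary (a1 xs) (a2 xs) (x1 xs) (x2 xs)).
Proof.
apply: compb_and; first by apply: compb_geA => //; apply: compA_add.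
apply: compb_and; first by apply: compb_geA => //; apply: compA_add.
apply: compb_and; first exact: compb_nneg.
by apply: compb_not; apply: compb_geA => //; apply: compA_add.
Qed.

Lemma compb_root_ineqs : compb m (fun xs => root_ineqs (a1 xs) (a2 xs) (x1 xs) (x2 xs)).
Proof.
have e1 := compA_add c1 cx1; have e2 := compA_add c2 cx2.
apply: compb_and; first by apply: compb_or; [exact: compb_nneg|exact: compb_geA].
apply: compb_and; first by apply: compb_or; [exact: compb_nneg|exact: compb_geA].
apply: compb_and; first by apply: compb_or; exact: compb_geA.
by apply: compb_and; apply: compb_not; exact: compb_geA.
Qed.

Lemma compb_terminal : compb m (fun xs => terminal (a1 xs) (a2 xs) (x1 xs) (x2 xs)).
Proof.
apply: compb_not; apply: compb_and; first exact: compb_nneg.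
apply: compb_and; first by apply: compb_geA => //; apply: compA_add.
apply: compb_forall => r; apply: compb_implies.
  by apply: compb_eqz; [exact: (proj2 cx2)|exact: compz_const].
apply: compb_lez; last exact: (proj2 c2).
by apply: compz_add; [exact: (proj2 c1)|exact: (proj2 cx1)].
Qed.

Lemma compb_no_meeting : compb m (fun xs => no_meeting (a1 xs) (a2 xs) (x1 xs) (x2 xs)).
Proof.
by apply: compb_and; apply: compb_not; apply: compb_same_coord => //; apply: compA_add.
Qed.

Lemma compb_word_coef i j : compz m i -> compz m j ->
  compb m (fun xs => word_coef (a1 xs) (a2 xs) (x1 xs) (x2 xs) (i xs) (j xs)).
Proof.
move=> ci cj; have k0 := compz_const m 0; have k1 := compz_const m 1; have k2 := compz_const m 2.
have q1 := compb_nneg cx1; have q2 := compb_nneg cx2.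
have e1 := compA_add c1 cx1; have e2 := compA_add c2 cx2.
apply: compb_and; first exact: compb_geA.
apply: compb_and; first exact: compb_geA.
apply: compb_if => //; first apply: compb_and.
- apply: compb_eqz => //; apply: compz_nat; exact: compb_not.
- exact: compb_eqz.
apply: compb_or.
  apply: compb_and; first by apply: compb_or => //; apply: compb_lez.
  apply: compb_and; first exact: compb_lez.
  apply: compb_and; first exact: compb_eqz.
  apply: compb_and; last apply: compb_not.
    by apply: compb_geA => //; apply: compA_add => //; apply: compA_add => //; apply: compA_mulz.
  apply: compb_geA => //; apply: compA_add => //; apply: compA_add => //; apply: compA_mulz => //.
  exact: compz_add.
apply: compb_and; first exact: compb_not.
apply: compb_and.
  by apply: compb_not; apply: compb_geA => //; apply: compA_add => //; apply: compA_add.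
apply: compb_and; first by apply: compb_geA => //; apply: compA_add => //; apply: compA_add.
by apply: compb_and; apply: compb_eqz.
Qed.
End Tests.
End ComputableVectors.

(** * The algorithm *)
Section Algorithm.
Variable P : {fset nat}.
Implicit Types (a h l : A P) (K : certificate).

Definition digit W t i : int := decode_int (t %/ W ^ i %% W)%N.

(** All certificates of the box are enumerated through their digits. *)
Definition cert_of W t : certificate :=
  Certificate (digit W t 0, digit W t 1) (digit W t 2, digit W t 3)
    (digit W t 4, digit W t 5) (digit W t 6) (digit W t 7) (digit W t 8).

Lemma digits_exist W (ds : seq nat) : (0 < W)%N -> all (fun d => d < W)%N ds ->
  exists2 t, (t < W ^ size ds)%N &
    forall i, (i < size ds)%N -> (t %/ W ^ i %% W)%N = nth 0%N ds i.
Proof.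
move=> W0; elim: ds => [_|d ds IH /= /andP[dW /IH[t tW tP]]]; first by exists 0%N.
exists (d + t * W)%N.
  rewrite expnSr; apply: (@leq_trans (t.+1 * W)); first by rewrite mulSn ltn_add2r.
  by rewrite leq_mul2r tW orbT.
case=> [_|i] /=; first by rewrite expn0 divn1 addnC modnMDl modn_small.
rewrite ltnS => /tP <-; rewrite expnS divnMA; congr (_ %/ _ %% _)%N.
by rewrite addnC divnMDl // divn_small // addn0.
Qed.

Lemma cert_of_small B K : small B K ->
  exists2 t, (t < (2 * B).+1 ^ 9)%N & cert_of (2 * B).+1 t = K.
Proof.
case: K => [[z1 z2] [w1 w2] [v1 v2] c i j] /= sm.
pose xs := [:: z1; z2; w1; w2; v1; v2; c; i; j].
have [|t tW tP] := @digits_exist (2 * B).+1 (map code_int xs) isT.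
  rewrite all_map; apply: sub_all sm => x /= xB.
  by case: x xB => n /=; rewrite ltnS -?mul2n; clear; lia.
exists t => //; have dg k : (k < 9)%N -> digit (2 * B).+1 t k = nth 0 xs k.
  by move=> k9; rewrite /digit tP // (nth_map 0) // code_intK.
by rewrite /cert_of !dg.
Qed.

(** An integer of absolute value at most B has a code of at most 2 B. *)
Definition base a1 a2 h1 h2 : nat := (2 * size_input a1 a2 h1 h2 ^ 20).+1.

Definition prog_of h1 h2 K : progression P :=
  Progression (cert_base h1 h2 K) (cert_step h1 h2 K) (Some 0) None.

Definition progs a1 a2 h1 h2 : seq (progression P) :=
  [seq prog_of h1 h2 (cert_of (base a1 a2 h1 h2) t) |
    t <- rev (iota 0 (base a1 a2 h1 h2 ^ 9))
    & sound a1 a2 h1 h2 (cert_of (base a1 a2 h1 h2) t)].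

Definition limit_progs a1 a2 h1 h2 := progs a1 a2 h1 h2 ++ progs a2 a1 h2 h1.

Lemma In_map_filter (T : Type) (g : nat -> T) (Q : pred nat) s p :
  List.In p [seq g t | t <- s & Q t] <-> exists t, [/\ t \in s, Q t & g t = p].
Proof.
elim: s => [|t s IH] /=; first by split=> // -[t []].
case: ifP => Qt /=; rewrite IH; split.
- move=> [<-|[u [us Qu <-]]]; first by exists t; rewrite mem_head.
  by exists u; rewrite in_cons us orbT.
- move=> [u []]; rewrite in_cons => /orP[/eqP -> _|us Qu] <-; first by left.
  by right; exists u.
- by move=> [u [us Qu <-]]; exists u; rewrite in_cons us orbT.
- move=> [u []]; rewrite in_cons => /orP[/eqP -> |us Qu] //; first by rewrite Qt.
  by exists u.
Qed.

Lemma In_cat (T : Type) (s t : seq T) p : List.In p (s ++ t) <-> List.In p s \/ List.In p t.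
Proof.
elim: s => [|x s IH] /=; first by split=> [|[]//]; right.
by rewrite IH; split=> [[|[]]|[[]|]]; auto.
Qed.

Lemma in_limit_progs a1 a2 h1 h2 p : List.In p (limit_progs a1 a2 h1 h2) ->
  List.In p (progs a1 a2 h1 h2) \/ List.In p (progs a2 a1 h2 h1).
Proof. by rewrite /limit_progs In_cat. Qed.

Lemma in_progs a1 a2 h1 h2 p : List.In p (progs a1 a2 h1 h2) ->
  exists2 K, sound a1 a2 h1 h2 K & p = prog_of h1 h2 K.
Proof.
rewrite /progs; move: (base a1 a2 h1 h2) => W H.
by have [t [_ sd <-]] := proj1 (In_map_filter _ _ _ _) H; exists (cert_of W t).
Qed.

Lemma covered_in_progs a1 a2 h1 h2 l : covered a1 a2 h1 h2 l ->
  exists2 p, List.In p (progs a1 a2 h1 h2) & in_prog p l.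
Proof.
move=> [K [n [sd sm ->]]]; have [t tW e] := cert_of_small sm.
exists (prog_of h1 h2 K); last by exists n%:Z; split.
rewrite /progs /base; move: (2 * _).+1 tW e => W tW e.
by apply/In_map_filter; exists t; rewrite e mem_rev mem_iota add0n; split.
Qed.

(* The candidates are far too many to be enumerated by conversion. *)
#[local] Opaque progs.

Lemma progs_right_limit a1 a2 h1 h2 p l : List.In p (progs a1 a2 h1 h2) ->
  in_prog p l -> right_limit a1 a2 h1 h2 l.
Proof.
move=> /in_progs[K sd ->] [n [/= n0 _ ->]].
by case: n n0 => // n _; exact: sound_right_limit.
Qed.

Lemma comb_mulz h1 h2 z (c : int) : comb h1 h2 z *~ c = comb h1 h2 (z.1 * c, z.2 * c).
Proof. by rewrite /comb /=; A_ring. Qed.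

Lemma progs_in_span a1 a2 h1 h2 p : List.In p (progs a1 a2 h1 h2) ->
  prog_in_span h1 h2 p.
Proof.
move=> /in_progs[K _ ->]; split; rewrite /= /cert_base /cert_step !comb_mulz.
  by eexists; rewrite -combD.
by eexists.
Qed.

Lemma limit_progs_describe a1 a2 h1 h2 : admissible a1 a2 h1 h2 ->
  describes (limit_progs a1 a2 h1 h2) a1 a2 h1 h2.
Proof.
move=> adm; split.
  move=> p /in_limit_progs[ps|ps]; first exact: progs_in_span ps.
  by have [b s] := progs_in_span ps; split; apply: in_span_swap.
move=> l; rewrite limit_directionE //; split.
  have cov : right_limit a1 a2 h1 h2 l \/ right_limit a2 a1 h2 h1 l ->
      covered a1 a2 h1 h2 l \/ covered a2 a1 h2 h1 l.
    case=> [/(right_limit_covered adm) //|].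
    by move=> /(right_limit_covered (admissible_swap adm))[]; [right|left].
  move=> /cov[]/covered_in_progs[p ps pl]; exists p; rewrite /limit_progs ?In_cat //.
    by left; exact: ps.
  by right; exact: ps.
move=> [p /in_limit_progs[ps|ps] pl]; [left|right].
  exact: progs_right_limit ps pl.
exact: progs_right_limit ps pl.
Qed.

(** Prepending is cheap for the coding of lists, so that the list is built from
    its last candidate. *)
Lemma code_search N (Q : pred nat) (g : nat -> progression P) (s : seq (progression P)) :
  code_progs ([seq g t | t <- rev (iota 0 N) & Q t] ++ s) =
  iteri N (fun t y => if Q t then 2 ^ code_prog (g t) * (2 * y).+1 else y)%N (code_progs s).
Proof.
have e n : rev (iota 0 n.+1) = n :: rev (iota 0 n) by rewrite -addn1 iotaD rev_cat.
elim: N => [//|N IH]; rewrite e [iteri _ _ _]/= -IH /=.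
by case: ifP => // _; rewrite mul2n.
Qed.

#[local] Transparent progs.

Section Computation.
Variable m : nat.

Lemma compb_sound (a1 a2 h1 h2 : seq nat -> A P) (z1 z2 w1 w2 v1 v2 c i j : seq nat -> int) :
  compA m a1 -> compA m a2 -> compA m h1 -> compA m h2 ->
  compz m z1 -> compz m z2 -> compz m w1 -> compz m w2 -> compz m v1 -> compz m v2 ->
  compz m c -> compz m i -> compz m j ->
  compb m (fun xs => sound (a1 xs) (a2 xs) (h1 xs) (h2 xs)
    (Certificate (z1 xs, z2 xs) (w1 xs, w2 xs) (v1 xs, v2 xs) (c xs) (i xs) (j xs))).
Proof.
move=> ca1 ca2 ch1 ch2 cz1 cz2 cw1 cw2 cv1 cv2 cc ci cj.
have cx1 := compA_comb ch1 ch2 cz1 cz2; have cx2 := compA_comb ch1 ch2 cw1 cw2.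
have cv := compA_comb ch1 ch2 cv1 cv2.
have k0 := compz_const m 0; have k1 := compz_const m 1.
apply: compb_and.
  apply: compb_eqz k1.
  by apply: compz_ext (compz_add (compz_mul cz1 cw2) (compz_opp (compz_mul cz2 cw1))).
apply: compb_or.
  apply: compb_and; first exact: compb_stationary.
  apply: compb_and; first exact: compb_eqz.
  apply: compb_and; first exact: compb_eqz.
  apply: compb_and; first exact: compb_nneg.
  apply: compb_exists => r.
  apply: compb_and; first exact: (compb_eqz (proj2 cx2 r) cc).
  apply: compb_and; last exact: (compb_eqz (proj2 cv r) k0).
  exact: (compb_ltz (compz_add cc (proj2 ca2 r)) (proj2 ca1 r)).
apply: compb_and; first exact: compb_eqz.
apply: compb_and; first exact: compb_root_ineqs.
apply: compb_and; first exact: compb_terminal.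
apply: compb_and; first exact: compb_no_meeting.
exact: compb_word_coef.
Qed.

Lemma comp_code_prog (h1 h2 : seq nat -> A P) (z1 z2 w1 w2 v1 v2 c i j : seq nat -> int) :
  compA m h1 -> compA m h2 ->
  compz m z1 -> compz m z2 -> compz m w1 -> compz m w2 -> compz m v1 -> compz m v2 ->
  compz m c -> compz m i -> compz m j ->
  comp m (fun xs => code_prog (prog_of (h1 xs) (h2 xs)
    (Certificate (z1 xs, z2 xs) (w1 xs, w2 xs) (v1 xs, v2 xs) (c xs) (i xs) (j xs)))).
Proof.
move=> ch1 ch2 cz1 cz2 cw1 cw2 cv1 cv2 cc ci cj.
have cx1 := compA_comb ch1 ch2 cz1 cz2; have cx2 := compA_comb ch1 ch2 cw1 cw2.
have cv := compA_comb ch1 ch2 cv1 cv2.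
apply: comp_ext (comp_code_vec (compA_add (compA_mulz cx1 ci) (compA_mulz cx2 cj))
  (compA_mulz cv cc) (ys := [:: fun=> 1%N; fun=> 0%N]) _) => //.
by constructor; [exact: comp_const|constructor=> //; exact: comp_const].
Qed.
End Computation.

Lemma comp_size_input m (a1 a2 h1 h2 : seq nat -> A P) :
  compA m a1 -> compA m a2 -> compA m h1 -> compA m h2 ->
  comp m (fun xs => size_input (a1 xs) (a2 xs) (h1 xs) (h2 xs)).
Proof.
move=> [_ c1] [_ c2] [_ d1] [_ d2].
apply: comp_add; first exact: comp_const.
apply: comp_seq_sum => r; apply: comp_add.
  by apply: comp_add; apply: comp_absz.
by apply: comp_absz; apply: compz_add => //; apply: compz_opp.
Qed.

Lemma compA_drop2 m (a : seq nat -> A P) : compA m a -> compA m.+2 (fun e => a (drop 2 e)).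
Proof.
move=> [ta ca]; split; first exact: (comp_drop2 ta).
move=> r; have [p [n [cp cn e]]] := ca r.
exists (fun e => p (drop 2 e)), (fun e => n (drop 2 e)).
by split; [exact: (comp_drop2 cp)|exact: (comp_drop2 cn)|move=> xs; rewrite e].
Qed.

Lemma comp_search m (a1 a2 h1 h2 : seq nat -> A P) (acc : seq nat -> nat) :
  compA m a1 -> compA m a2 -> compA m h1 -> compA m h2 -> comp m acc ->
  comp m (fun xs => let W := base (a1 xs) (a2 xs) (h1 xs) (h2 xs) in
    iteri (W ^ 9) (fun t y =>
      if sound (a1 xs) (a2 xs) (h1 xs) (h2 xs) (cert_of W t)
      then 2 ^ code_prog (prog_of (h1 xs) (h2 xs) (cert_of W t)) * (2 * y).+1 else y)%N
    (acc xs)).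
Proof.
move=> c1 c2 d1 d2 cacc.
have cW : comp m (fun xs => base (a1 xs) (a2 xs) (h1 xs) (h2 xs)).
  apply: comp_succ; apply: comp_mul; first exact: comp_const.
  by apply: comp_exp; [exact: comp_size_input|exact: comp_const].
pose step t y xs := (let W := base (a1 xs) (a2 xs) (h1 xs) (h2 xs) in
  if sound (a1 xs) (a2 xs) (h1 xs) (h2 xs) (cert_of W t)
  then 2 ^ code_prog (prog_of (h1 xs) (h2 xs) (cert_of W t)) * (2 * y).+1 else y)%N.
apply: (comp_iteri (step := step) (comp_exp cW (comp_const m 9)) cacc).
have cW' := comp_drop2 cW.
have cd k : compz m.+2 (fun e => digit
    (base (a1 (drop 2 e)) (a2 (drop 2 e)) (h1 (drop 2 e)) (h2 (drop 2 e))) (nth 0%N e 0) k).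
  apply: compz_decode_int; apply: comp_mod => //; apply: comp_div; first exact: comp_nth.
  by apply: comp_exp => //; exact: comp_const.
have [c1' c2' d1' d2'] := And4 (compA_drop2 c1) (compA_drop2 c2) (compA_drop2 d1) (compA_drop2 d2).
apply: comp_if.
- exact: (compb_sound c1' c2' d1' d2' (cd 0%N) (cd 1%N) (cd 2%N) (cd 3%N) (cd 4%N) (cd 5%N)
    (cd 6%N) (cd 7%N) (cd 8%N)).
- apply: comp_mul.
    apply: comp_exp; first exact: comp_const.
    exact: (comp_code_prog d1' d2' (cd 0%N) (cd 1%N) (cd 2%N) (cd 3%N) (cd 4%N) (cd 5%N)
      (cd 6%N) (cd 7%N) (cd 8%N)).
  by apply: comp_succ; apply: comp_mul; [exact: comp_const|exact: comp_nth].
- exact: comp_nth.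
Qed.

Definition decode_vec (k : nat) (xs : seq nat) : A P :=
  (inZp (nth 0%N xs k), [ffun r => decode_int (nth 0%N xs (k + (index r (enum {: P})).+1))]).

Lemma decode_vecK (s t : seq nat) a : decode_vec (size s) (s ++ code_vec a ++ t) = a.
Proof.
have nthE j : nth 0%N (s ++ code_vec a ++ t) (size s + j) = nth 0%N (code_vec a ++ t) j.
  by rewrite nth_cat ltnNge leq_addr /= addKn.
apply: A_ext.
  have := nthE 0%N; rewrite addn0 /torsion /decode_vec /= => ->.
  by apply: val_inj; rewrite /= modn_small //; exact: ltn_ord.
move=> r; rewrite /decode_vec /= ffunE nthE /= nth_cat size_map index_mem mem_enum /=.
by rewrite (nth_map r) ?index_mem ?mem_enum // nth_index ?mem_enum // code_intK.
Qed.

Lemma compA_decode_vec m k : compA m (decode_vec k).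
Proof.
split; first exact: (comp_mod (comp_nth m k) (comp_const m 2)).
move=> r; apply: compz_ext (compz_decode_int (comp_nth m (k + (index r (enum {: P})).+1))).
by move=> xs; rewrite /decode_vec ffunE.
Qed.

Lemma size_code_vec a : size (code_vec a) = #|{: P}|.+1.
Proof. by rewrite /code_vec /= size_map -cardE. Qed.

Lemma limit_progs_computable : exists f : recfun, forall a1 a2 h1 h2,
  reval f (code_input a1 a2 h1 h2) (code_progs (limit_progs a1 a2 h1 h2)).
Proof.
pose L := #|{: P}|.+1.
pose vec k := decode_vec (k * L)%N.
have cv k : compA (4 * L) (vec k) by apply: compA_decode_vec.
have [f fP] := comp_search (cv 0%N) (cv 1%N) (cv 2%N) (cv 3%N)
  (comp_search (cv 1%N) (cv 0%N) (cv 3%N) (cv 2%N) (comp_const _ 0)).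
exists f => a1 a2 h1 h2.
have sz : size (code_input a1 a2 h1 h2) = (4 * L)%N.
  by rewrite /code_input !size_cat !size_code_vec -/L; clear; lia.
have v0 : vec 0%N (code_input a1 a2 h1 h2) = a1.
  exact: (decode_vecK [::] (code_vec a2 ++ code_vec h1 ++ code_vec h2)).
have v1 : vec 1%N (code_input a1 a2 h1 h2) = a2.
  have e : (1 * L = size (code_vec a1))%N by rewrite size_code_vec mul1n.
  by rewrite /vec e; exact: decode_vecK.
have v2 : vec 2%N (code_input a1 a2 h1 h2) = h1.
  have -> : code_input a1 a2 h1 h2 = (code_vec a1 ++ code_vec a2) ++ code_vec h1 ++ code_vec h2.
    by rewrite -catA.
  have e : (2 * L = size (code_vec a1 ++ code_vec a2))%N.
    by rewrite size_cat !size_code_vec -/L; clear; lia.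
  by rewrite /vec e; exact: decode_vecK.
have v3 : vec 3%N (code_input a1 a2 h1 h2) = h2.
  have -> : code_input a1 a2 h1 h2 =
      (code_vec a1 ++ code_vec a2 ++ code_vec h1) ++ code_vec h2 ++ [::].
    by rewrite cats0 -!catA.
  have e : (3 * L = size (code_vec a1 ++ code_vec a2 ++ code_vec h1))%N.
    by rewrite !size_cat !size_code_vec -/L; clear; lia.
  by rewrite /vec e; exact: decode_vecK.
have := fP _ sz; rewrite v0 v1 v2 v3 /limit_progs /progs; cbv zeta.
move: (base a1 a2 h1 h2) (base a2 a1 h2 h1) => W W' H.
by rewrite code_search -[X in code_progs X]cats0 code_search.
Qed.
End Algorithm.

(** * Finiteness in closed cones *)
#[local] Opaque progs limit_progs.
Section Cones.
Variable R : realType.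
Variable P : {fset nat}.
Implicit Types (a h l : A P) (z : int * int) (K : set 'rV[R]_2).

Definition coord_form h1 h2 (r : P) (v : 'rV[R]_2) : R :=
  (h1.2 r)%:~R * v ord0 0 + (h2.2 r)%:~R * v ord0 1.

Lemma coord_form_pt h1 h2 r z : coord_form h1 h2 r (real_pt R z) = ((comb h1 h2 z).2 r)%:~R.
Proof. by rewrite comb_coord /coord_form !mxE /= intrD !intrM. Qed.

Lemma coord_form_pos h1 h2 r v : pos_cone R h1 h2 v -> 0 < coord_form h1 h2 r v.
Proof.
move=> [n [c [z [c0 zp ->]]]].
have -> : coord_form h1 h2 r (\sum_j c j *: real_pt R (z j)) =
    \sum_j c j * coord_form h1 h2 r (real_pt R (z j)).
  rewrite /coord_form !summxE !mulr_sumr -big_split /=; apply: eq_bigr => j _.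
  by rewrite !mxE; ring.
rewrite big_ord_recl; apply: ltr_pwDl.
  by rewrite coord_form_pt mulr_gt0 // ltr0z; apply: (forallP (zp ord0)).
apply: sumr_ge0 => j _; rewrite coord_form_pt mulr_ge0 //; first exact: ltW.
by rewrite ler0z ltW //; apply: (forallP (zp _)).
Qed.

(** The points b + n s have directions that tend to s, and K is closed. *)
Lemma ray_leaves_cone K (b s : 'rV[R]_2) : closed K -> is_cone K -> ~ K s ->
  exists N : nat, forall n, (N <= n)%N -> ~ K (b + n.+1%:R *: s).
Proof.
move=> clK cone nKs.
have cv : (fun n => harmonic n *: b + s : 'rV[R]_2) @ \oo --> s.
  rewrite -[X in _ --> X](add0r s) -(scale0r b).
  by apply: cvgD; [apply: cvgZr_tmp; exact: cvg_harmonic|exact: cvg_cst].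
have nb : nbhs s (~` K) by apply: open_nbhs_nbhs; split=> //; apply: closed_openC.
have [N _ HN] := cv _ nb; exists N => n Nn Kn; apply: (HN n Nn).
have -> : harmonic n *: b + s = n.+1%:R^-1 *: (b + n.+1%:R *: s).
  by rewrite scalerDr scalerA mulVf ?scale1r // pnatr_eq0.
by apply: cone => //; rewrite invr_gt0 ltr0n.
Qed.

Lemma real_pt_inj : injective (real_pt R).
Proof.
move=> [z1 z2] [w1 w2] e; have e0 := congr1 (fun v : 'rV[R]_2 => v ord0 0) e.
have e1 := congr1 (fun v : 'rV[R]_2 => v ord0 1) e; rewrite !mxE /= in e0 e1.
by congr pair; apply: (@intr_inj R).
Qed.

(** A nonzero s with a zero coordinate is not in the positive cone, hence not in
    K, although it is the limit of the directions of the points b + n s. *)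
Lemma finite_ray a1 a2 h1 h2 K b s r : admissible a1 a2 h1 h2 ->
  closed K -> is_cone K -> K `<=` pos_cone R h1 h2 `|` [set 0] ->
  (comb h1 h2 s).2 r = 0 ->
  finite_set [set l : A P | (exists n : nat, l = comb h1 h2 b + comb h1 h2 s *+ n) /\
    exists z, l = comb h1 h2 z /\ K (real_pt R z)].
Proof.
move=> adm clK cone sub sr; have [_ _ iso _] := adm.
have [s0|sn0] := eqVneq s 0.
  apply: (sub_finite_set _ (finite_set1 (comb h1 h2 b))) => l [[n ->] _] /=.
  have -> : comb h1 h2 s = 0 by rewrite s0 /comb !mulr0z addr0.
  by rewrite mul0rn addr0.
have nK : ~ K (real_pt R s).
  move=> /sub[/(coord_form_pos r)|/= e]; first by rewrite coord_form_pt sr ltxx.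
  case/eqP: sn0; apply: real_pt_inj; rewrite e; apply/rowP => j; rewrite !mxE.
  by case: ifP.
have [N HN] := ray_leaves_cone (real_pt R b) clK cone nK.
apply: (sub_finite_set _ (finite_image
  (fun n => comb h1 h2 b + comb h1 h2 s *+ n) (finite_II N.+1))).
move=> l [[n ->] [z [ez Kz]]]; exists n => //=.
rewrite ltnS leqNgt; apply/negP => Nn.
have ez' : z = (b.1 + s.1 * n%:Z, b.2 + s.2 * n%:Z).
  by apply: (comb_inj iso); rewrite -ez /comb /=; A_ring.
case: n Nn ez ez' => // n Nn _ ez'; apply: (HN n Nn).
suff <- : real_pt R z = real_pt R b + n.+1%:R *: real_pt R s by [].
by apply/rowP => j; rewrite ez' !mxE; case: ifP => _ /=; rewrite intrD intrM mulrC.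
Qed.

Lemma cone_finite a1 a2 h1 h2 K : admissible a1 a2 h1 h2 ->
  closed K -> is_cone K -> K `<=` pos_cone R h1 h2 `|` [set 0] ->
  finite_set [set l : A P | limit_direction a1 a2 h1 h2 l /\
    exists z, l = comb h1 h2 z /\ K (real_pt R z)].
Proof.
move=> adm clK cone sub.
have [_ [i1 _] _ _] := adm; have [r0 _] := ngeP i1.
have step (c1 c2 k1 k2 : A P) p : List.In p (progs c1 c2 k1 k2) -> exists r, (prog_step p).2 r = 0.
  move=> ps; have [[z w V c i j] sd ->] := in_progs ps; rewrite /prog_of /cert_step /=; move: sd.
  case/andP=> _ /orP[/and5P[_ _ _ _ /existsP[r /and3P[_ _ /eqP vr]]]|/andP[/eqP-> _]].
    by exists r; rewrite coordMz vr mul0r.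
  by exists r0; rewrite mulr0z coord0.
have lower (c1 c2 k1 k2 : A P) p : List.In p (progs c1 c2 k1 k2) -> prog_lower p = Some 0.
  by move=> ps; have [k _ ->] := in_progs ps.
have [spans desc] := limit_progs_describe adm.
have one p : List.In p (limit_progs a1 a2 h1 h2) ->
    finite_set [set l : A P | in_prog p l /\ exists z, l = comb h1 h2 z /\ K (real_pt R z)].
  move=> ps; have [[b eb] [s es]] := spans _ ps.
  have [[r pr] lo] : (exists r, (prog_step p).2 r = 0) /\ prog_lower p = Some 0.
    have [ps'|ps'] := in_limit_progs ps.
      by split; [exact: step ps'|exact: lower ps'].
    by split; [exact: step ps'|exact: lower ps'].
  rewrite es in pr; apply: sub_finite_set (finite_ray b adm clK cone sub pr).
  move=> l [[n [n0 _ ->]] Kl]; split; last exact: Kl.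
  rewrite lo in n0.
  by case: n n0 Kl => // n _ _; exists n; rewrite eb es.
move: (limit_progs _ _ _ _) one desc {spans} => ps one desc.
apply: (@sub_finite_set _ _ [set l | (exists2 p, List.In p ps & in_prog p l) /\
    exists z, l = comb h1 h2 z /\ K (real_pt R z)]).
  by move=> l [/desc ld Kl].
elim: ps one {desc} => [|p ps IH] one.
  by apply: (sub_finite_set _ (finite_set0 _)) => l [[p []]].
have f1 := one p (or_introl erefl).
have f2 := IH (fun q qs => one q (or_intror qs)).
apply: (@sub_finite_set _ _ (_ `|` _)); last by rewrite finite_setU; split; [exact: f1|exact: f2].
move=> l [[q [<-|qs] ql] Kl]; [left|right]; split=> //.
by exists q.
Qed.
End Cones.

Theorem theorem4p14 (R : realType) (P : {fset nat})
    (hP : forall p : nat, p \in P -> prime p) :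
  [/\ (* 1 *)
      forall a1 a2 h1 h2 : A P, admissible a1 a2 h1 h2 ->
        exists ps : seq (progression P), describes ps a1 a2 h1 h2,
      (* 2 *)
      exists f : recfun,
        forall a1 a2 h1 h2 : A P, admissible a1 a2 h1 h2 ->
          exists ps : seq (progression P),
            describes ps a1 a2 h1 h2 /\
            reval f (code_input a1 a2 h1 h2) (code_progs ps)
    & (* 3 *)
      forall a1 a2 h1 h2 : A P, admissible a1 a2 h1 h2 ->
        forall K : set 'rV[R]_2,
          closed K -> is_cone K -> K `<=` pos_cone R h1 h2 `|` [set 0] ->
          finite_set [set l : A P | limit_direction a1 a2 h1 h2 l /\
            exists z : int * int, l = comb h1 h2 z /\ K (real_pt R z)]].
Proof.
split=> [a1 a2 h1 h2 adm||a1 a2 h1 h2 adm K clK cone sub].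
- by exists (limit_progs a1 a2 h1 h2); apply: limit_progs_describe.
- have [f fP] := limit_progs_computable P; exists f => a1 a2 h1 h2 adm.
  exists (limit_progs a1 a2 h1 h2); split; first exact: limit_progs_describe.
  exact: fP.
- exact: cone_finite.
Qed.
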